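(* Let $d_1\ge1$ and let $q(\cdot)\in\mathcal{M}_1(\mathbb{Z}^{d_1})$. There exists $\delta_q\in(0,1)$ depending only on $q(\cdot)$ such that the following holds. Let $X$ be a random walk (started at the origin $o$) in an i.i.d. random environment $\omega$ on $\mathbb{Z}^d$, $d=d_0+d_1$, which satisfies assumptions (A0)–(A3) (stated in the context) with kernel $q(\cdot)$ and constants $\gamma,\kappa,\delta\in(0,1]$, $\gamma+\delta\le1$. If $\delta\in(\delta_q,1)$, then the first coordinate $v^{[1]}$ of the (deterministic) limiting velocity $v=\lim_{n\to\infty}X_n/n$ is continuous and strictly increasing as a function of the parameter $\beta\in[0,1]$ (all other ingredients of the law of the environment being kept fixed).
   Context: Notation. $V_k:=\{\pm e_i\}_{1\le i\le k}$ (canonical unit vectors of $\mathbb{Z}^k$ and their negatives; for $k\le d$ the set $V_k$ is also regarded as a subset of $V_d$). For $c>0$, $\mathcal{M}_c(\mathbb{Z}^k)$ is the set of kernels (nonnegative functions) on $\mathbb{Z}^k$ of total mass $c$; $\mathcal{M}_1(E)$ denotes probability measures on $E$. $\Pi_{d_1}:\mathbb{Z}^d\to\mathbb{Z}^{d_1}$ is the projection onto the last $d_1$ coordinates. $w^{[1]}$ is the first coordinate of $w$. Random walk in random environment. $\omega=(\omega_x)_{x\in\mathbb{Z}^d}$ with $\omega_x\in\mathcal{M}_1(\mathbb{Z}^d)$, with law $\mathbb{P}$. Under the quenched law $P_{\omega,x}$, $X$ is the Markov chain started at $x$ with $P_{\omega,x}(X_{n+1}=X_n+u\mid X_0,\dots,X_n)=\omega_{X_n}(u)$;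 $P_x$ is the annealed law, $P_x=\mathbb{P}\times P_{\omega,x}$. Assumptions. Let $d=d_0+d_1$, $1\le d_*\le d_0$, and $\gamma,\kappa,\delta\in(0,1]$ with $\gamma+\delta\le1$; $\beta\in[0,1]$. (A0) $(\omega_x)_{x\in\mathbb{Z}^d}$ are i.i.d. with common law $\mu$, and $\mu$-a.s. $\omega_o$ is supported on $V_d$. Moreover $q\in\mathcal{M}_1(\mathbb{Z}^{d_1})$ satisfies $q(0)=0$ and a.s. $\omega_o\circ\Pi_{d_1}^{-1}=\alpha_{\omega_o}q(\cdot)+(1-\alpha_{\omega_o})\delta_0(\cdot)$ for some $\alpha_{\omega_o}\ge\delta$; and, for the two-sided random walk $(Y_n)_{n\in\mathbb{Z}}$ on $\mathbb{Z}^{d_1}$ with $Y_0=0$ and i.i.d. increments of law $q$, the set $\{n\in\mathbb{Z}:\{Y_k:k\le n-1\}\cap\{Y_k:k\ge n\}=\emptyset\}$ is a.s. non-empty. (A1) $\omega_o=\xi_{d_*}\times\delta_{d-d_*}(o)+\delta_{d_*}(o)\times\tilde\xi_{d-d_*}$, where $\times$ is product measure, $\delta_i(o)$ is the unit mass at the origin of $\mathbb{Z}^i$, and $\xi_{d_*}$, $\tilde\xi_{d-d_*}$ are independent random kernels supported on $V_{d_*}$ and $V_{d-d_*}$ with total masses $\gamma$ and $1-\gamma$ and laws $\mu_{d_*}\in\mathcal{M}_1(\mathcal{M}_\gamma(\mathbb{Z}^{d_*}))$ and $\tilde\mu_{d-d_*}\in\mathcal{M}_1(\mathcal{M}_{1-\gamma}(\mathbb{Z}^{d-d_*}))$,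 respectively. (That is, $\omega_o$ restricted to the first $d_*$ coordinate directions is $\xi_{d_*}$ and restricted to the others is $\tilde\xi_{d-d_*}$.) (A2) There exist $\nu_1,\nu_2\in\mathcal{M}_\gamma(\mathbb{Z}^{d_*})$ with disjoint supports $\mathcal{S}_1,\mathcal{S}_2\subset V_{d_*}$ such that $\mu_{d_*}(\xi_{d_*}=\nu_1)=\kappa(1-\beta)$, $\mu_{d_*}(\xi_{d_*}=\nu_2)=\kappa\beta$, $\mu_{d_*}\big(\mathrm{supp}(\xi_{d_*})\cap(\mathcal{S}_1\cup\mathcal{S}_2\cup\{\pm e_1\})=\emptyset\big)=1-\kappa$, and $\rho:=(\nu_2(e_1)-\nu_2(-e_1))-(\nu_1(e_1)-\nu_1(-e_1))>0$. (A3) With $G_q(x):=\sum_{k=0}^\infty q^{*k}(x)$ ($q^{*k}$ the $k$-fold convolution of $q$), one has $G_q(o)<2$ and $\sup_{x\in\mathbb{Z}^{d_1}}G_q^{*i}(x)<\infty$ for $i=1,2,3,4$, where $G_q^{*i}(\cdot)$ is the $i$-fold convolution of $G_q$. As $\beta$ varies, $d_0,d_1,d_*,\gamma,\kappa,\delta,q,\nu_1,\nu_2,\tilde\mu_{d-d_*}$ and the conditional law of $\xi_{d_*}$ given $\xi_{d_*}\notin\{\nu_1,\nu_2\}$ are fixed. Under these assumptions $X_n/n$ converges $P_o$-a.s. to a deterministic $v\in\mathbb{R}^d$. *)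

(* Defs.v *)
From HB Require Import structures.
From mathcomp Require Import all_boot all_order all_algebra.
From mathcomp Require Import all_classical all_reals all_analysis.

Set Implicit Arguments.
Unset Strict Implicit.
Unset Printing Implicit Defensive.

Import Order.TTheory GRing.Theory Num.Theory.
Import numFieldNormedType.Exports.

Local Open Scope classical_set_scope.
Local Open Scope ring_scope.

(* Needed for the sigma-algebra on trajectories: measurable types are pointed. *)
HB.instance Definition _ := isPointed.Build int 0.

Notation "'Z^ k" := 'rV[int]_k (at level 8, k at level 2, format "''Z^' k").

(* Coordinates are numbered from 0, so the first coordinate of u is
   [coordinate u 0]; coordinates beyond the dimension are 0. *)
Definition coordinate (T : nmodType) (k : nat) (u : 'rV[T]_k) (i : nat) : T :=
  if insub i is Some j then u ord0 j else 0.

(* The first k coordinates of u, and the l coordinates of u following them. *)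
Definition head_coords (d k : nat) (u : 'Z^d) : 'Z^k :=
  \row_(i < k) coordinate u i.
Definition tail_coords (d : nat) (k l : nat) (u : 'Z^d) : 'Z^l :=
  \row_(i < l) coordinate u (k + i).

Definition e1 (k : nat) : 'Z^k := \row_(i < k) ((i == 0%N :> nat)%:R).

Definition signed_units (k : nat) : set 'Z^k :=
  [set u | exists i : 'I_k, u = delta_mx ord0 i \/ u = - delta_mx ord0 i].

Section kernels.
Context {R : realType}.

Definition supp (k : nat) (f : 'Z^k -> R) : set 'Z^k := [set u | f u != 0].

Definition kernels_of_mass (k : nat) (c : R) : set ('Z^k -> R) :=
  [set f | (forall u, 0 <= f u) /\ (\esum_(u in setT) (f u)%:E = c%:E)%E].

Definition unit_mass (k : nat) : 'Z^k -> R := fun u => (u == 0)%:R.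

(* Product kernel on Z^d = Z^k x Z^(d - k). *)
Definition kprod (d k : nat) (f : 'Z^k -> R) (g : 'Z^(d - k) -> R) : 'Z^d -> R :=
  fun u => f (head_coords k u) * g (tail_coords k (d - k) u).

(* The kernel xi * delta_0 + delta_0 * txi, with product kernels: xi acts on the
   first k coordinate directions, txi on the others. *)
Definition glue (d k : nat) (xi : 'Z^k -> R) (txi : 'Z^(d - k) -> R) :
    'Z^d -> R :=
  fun u => kprod xi (@unit_mass (d - k)) u + kprod (@unit_mass k) txi u.

End kernels.

(* Kernels on Z^k, with the sigma-algebra generated by the evaluation maps. *)
Definition evaluation_events (R : realType) (k : nat) : set (set ('Z^k -> R)) :=
  [set A | exists u B, measurable B /\ A = [set f | B (f u)]].
Notation kernel_space R k := (g_sigma_algebraType (@evaluation_events R k)).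

(* Trajectories in Z^d, with the sigma-algebra generated by the coordinate maps. *)
Definition position_events (d : nat) : set (set (nat -> 'Z^d)) :=
  [set A | exists n u, A = [set X | X n = u]].
Notation path_space d := (g_sigma_algebraType (@position_events d)).

Section two_sided_walk.
Context {R : realType} (k : nat) (q : 'Z^k -> R).

Definition two_sided_walk disp (T : measurableType disp) (P : probability T R)
    (Y : int -> T -> 'Z^k) : Prop :=
  [/\ forall n u, measurable [set w | Y n w = u],
      forall w, Y 0 w = 0 &
      forall (s : seq int) (z : int -> 'Z^k), uniq s ->
        P [set w | forall n, n \in s -> Y n w - Y (n - 1) w = z n]
        = (\prod_(n <- s) q (z n))%:E].

Definition cut_times (y : int -> 'Z^k) : set int :=
  [set n | [set y i | i in [set i | (i <= n - 1)%R]]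
           `&` [set y i | i in [set i | (n <= i)%R]] = set0].

(* The law of the two-sided walk is determined by q, so it does not matter on
   which probability space the walk is realised. *)
Definition has_cut_times : Prop :=
  exists disp (T : measurableType disp) (P : probability T R)
      (Y : int -> T -> 'Z^k),
    two_sided_walk P Y /\ {ae P, forall w, cut_times (Y ^~ w) !=set0}.

End two_sided_walk.

Section green.
Context {R : realType}.
Local Open Scope ereal_scope.

Definition conv (k : nat) (f g : 'Z^k -> \bar R) : 'Z^k -> \bar R :=
  fun x => \esum_(y in setT) (f y * g (x - y)%R).

Definition conv_pow (k : nat) (f : 'Z^k -> \bar R) (n : nat) : 'Z^k -> \bar R :=
  iter n (conv f) (fun x => (unit_mass x)%:E).

Definition green (k : nat) (q : 'Z^k -> R) : 'Z^k -> \bar R :=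
  fun x => \sum_(0 <= n <oo) conv_pow (fun y => (q y)%:E) n x.

End green.

Section assumptions.
Context {R : realType}.

(* A condition on q and on the common law mu of the sites; that the environment
   is i.i.d. with law mu is the field [env_iid] of [rwre] below. *)
Definition A0 (d0 d1 : nat) (q : 'Z^d1 -> R) (delta : R)
    (mu : probability (kernel_space R (d0 + d1)) R) : Prop :=
  [/\ {ae mu, forall w, supp w `<=` @signed_units (d0 + d1)},
      q 0 = 0,
      {ae mu, forall w, exists2 alpha : R, delta <= alpha &
        forall y : 'Z^d1,
          (\esum_(u in [set u : 'Z^(d0 + d1) | rsubmx u = y]) (w u)%:E
           = (alpha * q y + (1 - alpha) * unit_mass y)%:E)%E} &
      has_cut_times q].

(* mu is the law of [glue xi txi] for independent xi, txi of laws mus, mut. *)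
Definition A1 (d ds : nat) (gamma : R) (mu : probability (kernel_space R d) R)
    (mus : probability (kernel_space R ds) R)
    (mut : probability (kernel_space R (d - ds)) R) : Prop :=
  [/\ {ae mus, forall xi,
        kernels_of_mass gamma xi /\ supp xi `<=` @signed_units ds},
      {ae mut, forall txi,
        kernels_of_mass (1 - gamma) txi /\ supp txi `<=` @signed_units (d - ds)} &
      forall A : set (kernel_space R d), measurable A ->
        mu A = (mus \x mut)%E [set x | A (glue x.1 x.2)]].

Definition A2 (ds : nat) (gamma kappa beta : R) (nu1 nu2 : 'Z^ds -> R)
    (mus : probability (kernel_space R ds) R) : Prop :=
  [/\ [/\ kernels_of_mass gamma nu1, kernels_of_mass gamma nu2,
          supp nu1 `&` supp nu2 = set0, supp nu1 `<=` @signed_units ds &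
          supp nu2 `<=` @signed_units ds],
      mus [set nu1] = (kappa * (1 - beta))%:E,
      mus [set nu2] = (kappa * beta)%:E,
      mus [set xi | supp xi `&` (supp nu1 `|` supp nu2 `|` [set e1 ds; - e1 ds])
                    = set0] = (1 - kappa)%:E &
      0 < (nu2 (e1 ds) - nu2 (- e1 ds)) - (nu1 (e1 ds) - nu1 (- e1 ds))].

Definition A3 (d1 : nat) (q : 'Z^d1 -> R) : Prop :=
  (green q 0%R < 2%:E)%E /\
  forall i, (1 <= i <= 4)%N ->
    (ereal_sup [set conv_pow (green q) i x | x in setT] < +oo)%E.

(* The conditional law of xi under mus, given that xi is neither nu1 nor nu2, is
   lambda.  By [A2] the conditioning event has probability 1 - kappa; when
   kappa = 1 there is no conditional law and lambda plays no role. *)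
Definition conditional_law (ds : nat) (kappa : R) (nu1 nu2 : 'Z^ds -> R)
    (lambda mus : probability (kernel_space R ds) R) : Prop :=
  forall A : set (kernel_space R ds), measurable A ->
    (mus (A `\` [set nu1; nu2]) = (1 - kappa)%:E * lambda A)%E.

End assumptions.

Section walk.
Context {R : realType} (d : nat).

(* A random walk started at the origin in an i.i.d. environment with common
   law mu: [env_prob] is the law of the environment and [quenched w] is
   $P_{\omega, o}$ for the environment $\omega = (env x w)_x$; its
   one-step condition is the chain rule form of
   $P_{\omega, o}(X_{n+1} = X_n + u | X_0, ..., X_n) = \omega_{X_n}(u)$. *)
Record rwre (mu : probability (kernel_space R d) R) := RWRE {
  env_disp : measure_display;
  env_space : measurableType env_disp;
  env_prob : probability env_space R;
  env : 'Z^d -> env_space -> kernel_space R d;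
  env_kernel : forall x w, kernels_of_mass 1 (env x w);
  env_measurable : forall x, measurable_fun setT (env x);
  env_iid : forall (s : seq 'Z^d) (A : 'Z^d -> set (kernel_space R d)),
    uniq s -> (forall x, measurable (A x)) ->
    env_prob [set w | forall x, x \in s -> A x (env x w)]
    = (\prod_(x <- s) mu (A x))%E;
  quenched : R.-pker env_space ~> path_space d;
  quenched_start : forall w, quenched w [set X | X 0%N = 0] = 1%E;
  quenched_step : forall w (n : nat) (x : nat -> 'Z^d),
    quenched w [set X | forall i, (i <= n.+1)%N -> X i = x i]
    = (quenched w [set X | forall i, (i <= n)%N -> X i = x i]
       * (env (x n) w (x n.+1 - x n))%:E)%E
}.

(* The annealed law of the trajectory. *)
Definition annealed mu (W : rwre mu) (B : set (path_space d)) : \bar R :=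
  (\int[env_prob W]_w quenched W w B)%E.

(* Under the annealed law X_n / n converges a.s. to the constant v.  The annealed
   law is determined by mu, so the choice of the realisation W is immaterial. *)
Definition limiting_velocity mu (v : 'rV[R]_d) : Prop :=
  exists W : rwre mu,
    annealed W [set X : path_space d |
      (fun n : nat => n%:R^-1 *: map_mx intr (X n) : 'rV[R]_d) @ \oo --> v] = 1%E.

End walk.

(* Main.v *)
Require Import Defs.
From HB Require Import structures.
From mathcomp Require Import all_boot all_order all_algebra.
From mathcomp Require Import all_classical all_reals all_analysis.
From mathcomp Require Import measurable_realfun ring lra zify.

Set Implicit Arguments.
Unset Strict Implicit.
Unset Printing Implicit Defensive.

Import Order.TTheory GRing.Theory Num.Theory.
Import numFieldNormedType.Exports.

Local Open Scope classical_set_scope.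
Local Open Scope ring_scope.

(** Call level of a site its last [d1] coordinates, and level steps the steps
    that change it.  Averaging over the environment turns the walk into a walk
    whose next step depends on its past only through the list [l] of its
    earlier departures from the current site ([path_prob_sites],
    [annealed_cylinder]).  The next step is a level step with a probability at
    least [delta], and its direction then has law [q] whatever the past: the
    level word is i.i.d.  The other relevant feature is that [nu1] and [nu2]
    have disjoint supports and that no other type of site charges these
    supports: the first departure from a site in one of the first [ds]
    directions (a xi step) reveals the type of the site.  Hence [beta] enters
    only before that departure, where the two laws of the next step differ by
      p_beta'(l, u) - p_beta(l, u) = kappa (beta' - beta) (nu2(u) - nu1(u))
    ([site_kernel_diff]).

    Let J_beta(n, H) be the mean displacement in the direction e1 during the
    [n] steps that follow a history [H].  Replacing the law of one step after
    the other expands J_beta'(n, H) - J_beta(n, H) as a sum, over the times of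
    the walk with parameter [beta], of
      sum_u (p_beta' - p_beta)(l, u) (e1-part of u + J_beta'(m, H u)).
    If J_beta'(m, H u) did not depend on [u] and no site was ever revisited,
    every term would be kappa (beta' - beta) rho, as [nu1] and [nu2] have the
    same mass.  There are two corrections.
    - The term vanishes once a xi step has left the current site.  Since the
      level of the walk is a random walk of law [q] slowed down by a factor at
      most 1/delta, the mean number of such times among the first [n] is at
      most gamma G_q(0) n / delta ([occupation_xi]).
    - J_beta'(m, H u) depends on [u].  Fix the future level word.  After the
      first index where it is cut (no level visited before is visited again)
      the walk meets fresh sites only, so it forgets [u]; and before that index
      at most 1/delta steps are needed on average for each level step
      ([mean_disp_along_cut]).  The effect of [u] is thus at most 2 rho / delta
      times the mean index of the first cut, and [nu1] and [nu2] weigh it with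
      mass gamma each.
    The mean index of the first cut after a given time is bounded by a constant
    K that depends on [q] only ([first_cut_bounded]).  So
      |J_beta' - J_beta - n kappa (beta' - beta) rho|
        <= n kappa (beta' - beta) rho gamma (2 / delta + 4 K / delta^2)
    ([mean_disp_comparison]).  As gamma <= 1 - delta, the last factor is at most
    1/2 when delta is close enough to 1, in terms of [q] only.  Dividing by [n]
    and letting [n] tend to infinity ([velocity_limit]), the increment of the
    velocity lies between kappa (beta' - beta) rho / 2 and
    2 kappa (beta' - beta) rho: the velocity is Lipschitz and strictly
    increasing.

    For K, let p > 0 be a lower bound for the probability that the midpoint of
    a window of length 2r is a cut within this window; there is one because cut
    times exist ([local_cut_prob_ge]).  If no cut occurs during A consecutive
    windows, then either no window has a local cut at its midpoint, which has
    probability at most (1 - p)^A, or some return of the levels to an earlier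
    value straddles a midpoint and lasts more than [r] steps.  There are at most
    l such possible returns of duration l at a given midpoint, so this second
    case has probability at most A sum_(l > r) l q^{*l}(0) <= A M / r^2, where
    M is the third moment sum_l l^3 q^{*l}(0).  The coefficient of q^{*l} in
    G_q^{*4} is the binomial (l + 3 choose 3), so M <= 6 G_q^{*4}(0).  Taking
    r = 2^s and a number of windows proportional to s makes the tail of the
    first cut summable over s. *)

(** * Words with independent letters and their cuts *)

Section IidWords.
Context {R : realFieldType} {Q : finType} (q : Q -> R).
Hypothesis q_ge0 : forall v, 0 <= q v.
Hypothesis q_sum1 : \sum_v q v = 1.

(** Mean of [f] over words of [n] independent letters of law [q], as a finite sum
    computed letter by letter. *)
Fixpoint iidE n (f : seq Q -> R) : R :=
  if n is n'.+1 then \sum_v q v * iidE n' (fun w => f (v :: w)) else f [::].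

Lemma eq_iidE n f g : (forall w, size w = n -> f w = g w) ->
  iidE n f = iidE n g.
Proof.
elim: n f g => [|n IH] f g fg /=; first exact: fg.
by apply: eq_bigr => v _; congr (_ * _); apply: IH => w wn; apply: fg; rewrite /= wn.
Qed.

Lemma le_iidE n f g : (forall w, size w = n -> f w <= g w) ->
  iidE n f <= iidE n g.
Proof.
elim: n f g => [|n IH] f g fg /=; first exact: fg.
apply: ler_sum => v _; apply: ler_wpM2l => //.
by apply: IH => w wn; apply: fg; rewrite /= wn.
Qed.

Lemma iidE_cat m n f :
  iidE (m + n) f = iidE m (fun s => iidE n (fun t => f (s ++ t))).
Proof.
elim: m f => [|m IH] f //=.
by apply: eq_bigr => v _; rewrite IH.
Qed.

Lemma iidE_cst n (c : R) : iidE n (fun=> c) = c.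
Proof. by elim: n => //= n ->; rewrite -mulr_suml q_sum1 mul1r. Qed.

Lemma iidEZ n c f : iidE n (fun w => c * f w) = c * iidE n f.
Proof.
elim: n f => //= n IH f; rewrite mulr_sumr; apply: eq_bigr => v _.
by rewrite IH mulrCA.
Qed.

Lemma iidEM n c f : iidE n (fun w => f w * c) = iidE n f * c.
Proof. by rewrite mulrC -iidEZ; apply: eq_iidE => w _; rewrite mulrC. Qed.

Lemma iidED n f g : iidE n (fun w => f w + g w) = iidE n f + iidE n g.
Proof.
elim: n f g => //= n IH f g; rewrite -big_split; apply: eq_bigr => v _.
by rewrite IH mulrDr.
Qed.

Lemma iidEB n f g : iidE n (fun w => f w - g w) = iidE n f - iidE n g.
Proof.
rewrite iidED; congr (_ + _); rewrite -[RHS]mulN1r -iidEZ.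
by apply: eq_iidE => w _; rewrite mulN1r.
Qed.

Lemma iidE_sum n (I : Type) (r : seq I) (P : pred I) (F : I -> seq Q -> R) :
  iidE n (fun w => \sum_(i <- r | P i) F i w) = \sum_(i <- r | P i) iidE n (F i).
Proof.
elim: r => [|i r IH].
  by rewrite big_nil -[RHS](iidE_cst n); apply: eq_iidE => w _; rewrite big_nil.
rewrite big_cons; case: (boolP (P i)) => Pi.
  by rewrite -IH -iidED; apply: eq_iidE => w _; rewrite big_cons Pi.
by rewrite -IH; apply: eq_iidE => w _; rewrite big_cons (negPf Pi).
Qed.

Lemma iidE_ge0 n f : (forall w, 0 <= f w) -> 0 <= iidE n f.
Proof. by move=> f0; rewrite -(iidE_cst n 0); apply: le_iidE. Qed.

Lemma ler_norm_iidE n f g : (forall w, size w = n -> `|f w| <= g w) ->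
  `|iidE n f| <= iidE n g.
Proof.
move=> fg; rewrite ler_norml -[- iidE n g]mulN1r -iidEZ; apply/andP; split;
  apply: le_iidE => w /fg; rewrite ler_norml => /andP[]; lra.
Qed.

Context {L : zmodType} (lv : Q -> L).

Definition lsum (w : seq Q) : L := \sum_(v <- w) lv v.

Lemma lsum_cat s t : lsum (s ++ t) = lsum s + lsum t.
Proof. by rewrite /lsum big_cat. Qed.

Lemma lsum_cons v t : lsum (v :: t) = lv v + lsum t.
Proof. by rewrite /lsum big_cons. Qed.

Definition return_prob n := iidE n (fun w => (lsum w == 0)%:R).

(** The finite version of [cut_times], at the end of [s]: as there, the level at the
    time of the cut counts as visited after the cut. *)
Definition is_cut (s t : seq Q) : bool :=
  all (fun i => all (fun j => lsum (drop i s) + lsum (take j t) != 0)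
                    (iota 0 (size t).+1)) (iota 0 (size s)).

Lemma is_cutP s t :
  reflect (forall i j, (i < size s)%N -> (j <= size t)%N ->
             lsum (drop i s) + lsum (take j t) != 0) (is_cut s t).
Proof.
apply: (iffP idP) => [/allP H i j Hi Hj|H].
  have /allP Hi' := H i ltac:(by rewrite mem_iota).
  by apply: Hi'; rewrite mem_iota.
apply/allP => i; rewrite mem_iota add0n => /andP[_ Hi]; apply/allP => j.
by rewrite mem_iota add0n ltnS => /andP[_]; apply: H.
Qed.

Definition local_cut_prob r :=
  iidE (r + r) (fun w => (is_cut (take r w) (drop r w))%:R).

(** The [A] consecutive windows of length [r + r] are disjoint, so the events that
    their midpoints are not local cuts are independent: see [iidE_no_local_cut]. *)
Fixpoint no_local_cut r A (l : seq Q) : bool :=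
  if A is A'.+1 then
    ~~ is_cut (take r (take (r + r) l)) (drop r (take (r + r) l)) &&
    no_local_cut r A' (drop (r + r) l)
  else true.

Lemma iidE_no_local_cut r A n :
  iidE ((r + r) * A + n) (fun l => (no_local_cut r A l)%:R)
  = (1 - local_cut_prob r) ^+ A.
Proof.
elim: A => [|A IH]; first by rewrite expr0 iidE_cst.
rewrite mulnS -addnA iidE_cat exprS -IH.
rewrite /local_cut_prob -[X in (X - _) * _](iidE_cst (r + r)) -iidEB -iidEM.
apply: eq_iidE => s sr; rewrite -iidEZ; apply: eq_iidE => t _ /=.
rewrite take_size_cat // drop_size_cat //.
by case: is_cut; rewrite /= ?(subrr, subr0, mul0r, mul1r).
Qed.

Lemma iidE_window i m n :
  iidE (i + (m + n)) (fun l => (lsum (take m (drop i l)) == 0)%:R)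
  = return_prob m.
Proof.
rewrite iidE_cat -[RHS](iidE_cst i); apply: eq_iidE => s ss.
rewrite iidE_cat; apply: eq_iidE => t st.
rewrite -[RHS](iidE_cst n); apply: eq_iidE => w _.
by rewrite drop_size_cat // take_size_cat.
Qed.

Definition long_return r c (l : seq Q) : R :=
  \sum_(i < c) \sum_(j < (size l - c).+1 | (r < c - i + j)%N)
     (lsum (take (c - i + j) (drop i l)) == 0)%:R.

(** If the midpoint of a window is a cut of the window but not of the whole word, two
    levels agree across the midpoint at times that are not both in the window,
    hence more than [r] apart. *)
Lemma cut_local k r A l : ((k + (r + r) * A)%N <= size l)%N -> (0 < r)%N ->
  (forall c, (k < c <= k + (r + r) * A)%N -> ~~ is_cut (take c l) (drop c l)) ->
  1 <= (no_local_cut r A (drop k l))%:R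
       + \sum_(j < A) long_return r (k + (r + r) * j + r) l.
Proof.
move=> + r0; elim: A k => [|A IH] k kl nocut; first by rewrite big_ord0 addr0.
rewrite big_ord_recl /= muln0 addn0.
have lr0 : forall c, 0 <= long_return r c l.
  by move=> c; apply: sumr_ge0 => i _; apply: sumr_ge0.
case: (boolP (is_cut _ _)) => [loc|nloc] /=; last first.
  rewrite drop_drop addrCA; apply: ler_wpDl => //.
  rewrite (addnC (r + r)%N) (eq_bigr (fun j : 'I_A => long_return r (k + (r + r) + (r + r) * j + r) l)).
    apply: IH; first by rewrite -addnA -mulnS.
    move=> c /andP[c1 c2]; apply: nocut; apply/andP; split; last by rewrite mulnS addnA.
    by apply: leq_trans c1; rewrite ltnS leq_addr.
  by move=> j _; rewrite /bump /= add1n mulnS addnA.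
rewrite add0r; apply: ler_wpDr; first by apply: sumr_ge0.
have := nocut (k + r)%N; set c := (k + r)%N.
move=> /(_ ltac:(rewrite /c mulnS; lia)) /is_cutP nc.
have cl : (c + r <= size l)%N by move: kl; rewrite /c mulnS; lia.
have : exists i j, [/\ (i < c)%N, (j <= size l - c)%N &
    lsum (drop i (take c l)) + lsum (take j (drop c l)) == 0].
  have : ~~ is_cut (take c l) (drop c l) by apply: nocut; rewrite /c mulnS; lia.
  rewrite /is_cut -has_predC => /hasP[i]; rewrite mem_iota add0n => /andP[_ ic].
  rewrite [predC _ _]/= -[_ && _]/(all _ (iota 0 _.+1)) -has_predC => /hasP[j].
  rewrite mem_iota add0n ltnS => /andP[_ jc] /=; rewrite negbK => e.
  by exists i, j; split => //; [move: ic|move: jc];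
    rewrite ?size_drop // size_takel //; lia.
case=> i [j [ic jc /eqP e]].
have e' : lsum (take (c - i + j) (drop i l)) = 0.
  rewrite -e -lsum_cat; congr lsum.
  rewrite -[in LHS](cat_take_drop c l) drop_cat size_takel; last by lia.
  rewrite ic take_cat size_drop size_takel; last by lia.
  by rewrite ltnNge leq_addr /= addKn.
have rij : (r < c - i + j)%N.
  rewrite ltnNge; apply/negP => ijr.
  have /is_cutP := loc => /(_ (i - k)%N j).
  rewrite take_takel ?leq_addr //.
  have -> : drop r (take (r + r) (drop k l)) = take r (drop c l).
    by rewrite -take_drop drop_drop /c addnC.
  have -> : drop (i - k) (take r (drop k l)) = drop i (take c l).
    have ki : (k <= i)%N by move: ijr ic; rewrite /c; lia.
    by rewrite take_drop drop_drop subnK // addnC.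
  rewrite take_takel; last by lia.
  by rewrite e eqxx !size_takel ?size_drop; lia.
rewrite /long_return (bigD1 (Ordinal ic)) //=.
apply: ler_wpDr; first by apply: sumr_ge0 => ? _; apply: sumr_ge0.
rewrite (bigD1 (Ordinal (jc : (j < (size l - c).+1)%N))) //= e' eqxx.
by apply: ler_wpDr => //; apply: sumr_ge0.
Qed.

(** For each [l] at most [l] pairs [(i, j)] satisfy [c - i + j = l]. *)
Lemma sum_pairs_le (F : nat -> R) c n M : (forall l, 0 <= F l) -> (c + n <= M)%N ->
  \sum_(i < c) \sum_(j < n.+1) F (c - i + j)%N <= \sum_(l < M.+1) l%:R * F l.
Proof.
move=> F0 cnM.
apply: (@le_trans _ _ (\sum_(i < c) \sum_(l < M.+1 | (c - i <= l)%N) F l)).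
  apply: ler_sum => i _.
  rewrite -(big_mkord predT (fun j => F (c - i + j)%N)) /=.
  rewrite -(big_mkord (fun l => (c - i <= l)%N) F).
  have ci1 : (c - i <= M.+1)%N by lia.
  have ci2 : (c - i + n.+1 <= M.+1)%N by have := ltn_ord i; lia.
  rewrite [leRHS](big_cat_nat (n := c - i)) //=.
  rewrite [X in _ + X](big_cat_nat (n := c - i + n.+1) (m := c - i)) ?leq_addr //=.
  rewrite addrCA; apply: ler_wpDr.
    by rewrite addr_ge0 //; apply: sumr_ge0.
  rewrite -{2}(add0n (c - i)%N) big_addn addKn big_nat_cond [leRHS]big_nat_cond.
  rewrite le_eqVlt; apply/orP; left; apply/eqP; apply: eq_big => j.
    by rewrite leq_addl andbT.
  by rewrite addnC.
have cM : (c <= M)%N by lia.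
rewrite (exchange_big_dep predT) //=; apply: ler_sum => l _.
rewrite sumr_const -[leLHS]mulr_natl ler_wpM2r // ler_nat.
rewrite -sum1_card (reindex_inj rev_ord_inj) /=.
rewrite (eq_bigl (fun i : 'I_c => (i < l)%N)); last first.
  move=> i; rewrite -[_ \in _]/((c - rev_ord i <= l)%N) /=; have := ltn_ord i; lia.
have [cl|/ltnW lc] := leqP c l; last first.
  by rewrite -(big_ord_widen _ (fun=> 1%N) lc) sum1_card card_ord.
rewrite sum1_card; apply: leq_trans cl; rewrite -[leqRHS](card_ord c).
exact: max_card.
Qed.

(** Long returns across [c] cost one factor [l] for their position, and
    [l <= l ^ 3 / r ^ 2] when [l > r]. *)
Lemma iidE_long_return r c n (M3 : R) : (0 < r)%N -> (c <= n)%N ->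
  (forall n, \sum_(l < n) l%:R ^+ 3 * return_prob l <= M3) ->
  iidE n (long_return r c) <= M3 / r%:R ^+ 2.
Proof.
move=> r0 cn HM.
have u0 l : 0 <= return_prob l by apply: iidE_ge0.
pose F l := (r < l)%N%:R * return_prob l.
have F0 l : 0 <= F l by rewrite mulr_ge0.
have -> : iidE n (long_return r c) = \sum_(i < c) \sum_(j < (n - c).+1) F (c - i + j)%N.
  rewrite (@eq_iidE n _ (fun l => \sum_(i < c) \sum_(j < (n - c).+1 | (r < c - i + j)%N)
     (lsum (take (c - i + j) (drop i l)) == 0)%:R)); last by move=> l <-.
  rewrite iidE_sum; apply: eq_bigr => i _; rewrite iidE_sum big_mkcond /=.
  apply: eq_bigr => j _; rewrite /F; case: ifP => _; rewrite ?mul0r ?mul1r //.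
  rewrite -(@iidE_window i _ (n - (i + (c - i + j)))); congr (iidE _ _).
  by have := ltn_ord i; have := ltn_ord j; lia.
apply: le_trans (sum_pairs_le F0 (_ : _ <= n)%N) _; first by lia.
rewrite ler_pdivlMr ?exprn_gt0 ?ltr0n //; apply: le_trans (HM n.+1).
rewrite mulr_suml; apply: ler_sum => l _; rewrite /F.
case: (ltnP r l) => rl; last by rewrite mul0r mulr0 mul0r mulr_ge0 ?exprn_ge0.
rewrite mul1r mulrAC ler_wpM2r // [leRHS]exprS ler_wpM2l //.
by rewrite lerXn2r ?nnegrE // ler_nat ltnW.
Qed.

(** Index of the first cut that lies strictly after [s] in [s ++ t], counted from the
    end of [s]; it is [(size t).+1] if there is none. *)
Definition first_cut (s t : seq Q) : nat :=
  (find (fun i => is_cut (s ++ take i.+1 t) (drop i.+1 t)) (iota 0 (size t))).+1.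

Lemma first_cut_le s t : (first_cut s t <= (size t).+1)%N.
Proof. by rewrite /first_cut ltnS (leq_trans (find_size _ _)) // size_iota. Qed.

Lemma first_cutP s t : (first_cut s t <= size t)%N ->
  is_cut (s ++ take (first_cut s t) t) (drop (first_cut s t) t).
Proof.
rewrite /first_cut => ft.
have := @nth_find _ 0%N (fun i => is_cut (s ++ take i.+1 t) (drop i.+1 t)) (iota 0 (size t)).
rewrite has_find size_iota => /(_ ft).
by rewrite nth_iota.
Qed.

Lemma first_cut_gt s t m c : (m < first_cut s t)%N -> (0 < c <= m)%N ->
  ~~ is_cut (s ++ take c t) (drop c t).
Proof.
rewrite /first_cut ltnS => mf /andP[c0 cm].
have fs : (find (fun i => is_cut (s ++ take i.+1 t) (drop i.+1 t)) (iota 0 (size t)) <= size t)%N.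
  by rewrite (leq_trans (find_size _ _)) // size_iota.
have cf : (c.-1 < find (fun i => is_cut (s ++ take i.+1 t) (drop i.+1 t)) (iota 0 (size t)))%N by lia.
have := before_find 0%N cf; rewrite nth_iota; last by lia.
by rewrite add0n prednK // => ->.
Qed.

Lemma first_cut_tail k n r A (M3 : R) : (0 < r)%N ->
  (forall n, \sum_(l < n) l%:R ^+ 3 * return_prob l <= M3) ->
  iidE k (fun s => iidE n (fun t => ((r + r) * A < first_cut s t)%N%:R))
  <= (1 - local_cut_prob r) ^+ A + A%:R * (M3 / r%:R ^+ 2).
Proof.
move=> r0 HM.
have p1 : local_cut_prob r <= 1.
  by rewrite -(iidE_cst (r + r) 1); apply: le_iidE => w _; rewrite lern1 leq_b1.
have M0 : 0 <= M3 by have := HM 0%N; rewrite big_ord0.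
have [nA|An] := ltnP n ((r + r) * A)%N.
  rewrite (@eq_iidE k _ (fun=> 0)) ?iidE_cst; last first.
    move=> s _; rewrite -[RHS](iidE_cst n 0); apply: eq_iidE => t tn.
    suff -> : ((r + r) * A < first_cut s t)%N = false by [].
    by apply/negbTE; rewrite -leqNgt (leq_trans (first_cut_le _ _)) ?tn.
  by rewrite addr_ge0 ?exprn_ge0 ?subr_ge0 // mulr_ge0 // divr_ge0 // exprn_ge0.
apply: (@le_trans _ _ (iidE k (fun s => iidE n (fun t =>
   (no_local_cut r A (drop k (s ++ t)))%:R
       + \sum_(j < A) long_return r (k + (r + r) * j + r) (s ++ t))))).
  apply: le_iidE => s sk; apply: le_iidE => t tn.
  case: ltnP => [mf|_]; last first.
    rewrite addr_ge0 //; apply: sumr_ge0 => j _.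
    by apply: sumr_ge0 => i _; apply: sumr_ge0.
  apply: cut_local => //; first by rewrite size_cat sk tn leq_add2l.
  move=> c /andP[kc cA]; rewrite take_cat drop_cat sk ltnNge (ltnW kc) /=.
  by apply: first_cut_gt mf _; lia.
rewrite -(iidE_cat k n (fun l => (no_local_cut r A (drop k l))%:R
       + \sum_(j < A) long_return r (k + (r + r) * j + r) l)).
rewrite iidED lerD //.
  rewrite iidE_cat -[n](subnKC An) -(iidE_no_local_cut r A (n - (r + r) * A)).
  rewrite -[leRHS](iidE_cst k); apply: le_iidE => s sk.
  by apply: le_iidE => t _; rewrite drop_size_cat.
rewrite iidE_sum -[X in X%:R * _](card_ord A) mulr_natl -sumr_const.
apply: ler_sum => j _; apply: iidE_long_return => //.
rewrite -addnA leq_add2l (leq_trans _ An) //.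
by have := ltn_ord j; nia.
Qed.

Lemma sum_sqr_geo B : \sum_(s < B) (s.+1%:R ^+ 2 / 2 ^+ s : R) <= 12.
Proof.
suff -> : \sum_(s < B) (s.+1%:R ^+ 2 / 2 ^+ s : R)
    = 12 - (2 * B%:R ^+ 2 + 8 * B%:R + 12) / 2 ^+ B.
  by rewrite lerBlDr lerDl divr_ge0 ?exprn_ge0.
(* the partial sums have a closed form, which can be checked by induction *)
elim: B => [|B IH]; first by rewrite big_ord0 expr0; field.
rewrite big_ord_recr /= IH (exprS 2 B) -[in RHS](natr1 B) -[in LHS](natr1 B).
have : 2 ^+ B != 0 :> R by rewrite expf_neq0 // pnatr_eq0.
set x := 2 ^+ B; set b := B%:R => x0; field.
by rewrite x0.
Qed.

(** The tail is estimated at the times [m s] with windows of half-length [2 ^ s] and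
    [A * s] of them: both parts of [first_cut_tail] are then of order
    [s * 4 ^- s], while [m s] is of order [s * 2 ^ s]. *)
Lemma first_cut_bounded (p M3 : R) (A : nat) :
  (forall r, p <= local_cut_prob r) -> (1 - p) ^+ A <= 4^-1 -> 0 <= p <= 1 ->
  (forall n, \sum_(l < n) l%:R ^+ 3 * return_prob l <= M3) ->
  forall k n, iidE k (fun s => iidE n (fun t => (first_cut s t)%:R))
    <= 48 * A%:R * (1 + A%:R * M3).
Proof.
move=> pl pA p01 HM k n.
pose m s := ((2 ^ s + 2 ^ s) * (A * s))%N.
have M0 : 0 <= M3 by have := HM 0%N; rewrite big_ord0.
have A0 : (0 < A)%N.
  by case: A pA {m} => //; rewrite expr0; lra.
have mB B : (B <= m B)%N.
  by rewrite /m -[leqLHS]mul1n leq_mul // ?addn_gt0 ?expn_gt0 // leq_pmull.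
have mS s : (m s <= m s.+1)%N by rewrite /m leq_mul ?leq_mul // leq_add // leq_exp2l.
pose B := n.+1.
(* summation by parts along the times [m i]; [first_cut] never exceeds [n.+1] *)
apply: (@le_trans _ _ (iidE k (fun s => iidE n (fun t =>
   \sum_(i < B) (m i.+1 - m i)%N%:R * (m i < first_cut s t)%N%:R)))).
  apply: le_iidE => s _; apply: le_iidE => t tn.
  have H b : (minn (first_cut s t) (m b))%:R <=
     \sum_(i < b) (m i.+1 - m i)%N%:R * (m i < first_cut s t)%N%:R :> R.
    elim: b => [|b IH]; first by rewrite big_ord0 /m !muln0 minn0.
    rewrite big_ord_recr /= (le_trans _ (lerD IH (lexx _))) //.
    rewrite -natrM -natrD ler_nat.
    by have := mS b; case: ltnP; lia.
  apply: le_trans (H B); rewrite ler_nat leq_min leqnn /=.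
  by apply: leq_trans (mB B); rewrite /B -tn first_cut_le.
rewrite (eq_iidE (g := fun s => \sum_(i < B) (m i.+1 - m i)%:R *
   iidE n (fun t => (m i < first_cut s t)%N%:R))); last first.
  by move=> s _; rewrite iidE_sum; apply: eq_bigr => i _; rewrite iidEZ.
rewrite iidE_sum.
have -> : 48 * A%:R * (1 + A%:R * M3) = (4 * A%:R * (1 + A%:R * M3)) * 12.
  ring.
rewrite (le_trans _ (ler_wpM2l _ (sum_sqr_geo B))) //; last first.
  by rewrite !mulr_ge0 // addr_ge0 // mulr_ge0.
rewrite mulr_sumr; apply: ler_sum => i _; rewrite iidEZ.
have r0 : (0 < 2 ^ i)%N by rewrite expn_gt0.
have lp0 : 0 <= 1 - local_cut_prob (2 ^ i).
  rewrite subr_ge0 -(iidE_cst (2 ^ i + 2 ^ i) 1).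
  by apply: le_iidE => w _; rewrite lern1 leq_b1.
have x0 : 0 < 2 ^+ i :> R by rewrite exprn_gt0.
have tail : iidE k (fun s => iidE n (fun t => (m i < first_cut s t)%N%:R))
   <= (1 + A%:R * i%:R * M3) / (2 ^+ i) ^+ 2.
  apply: le_trans (first_cut_tail _ _ _ r0 HM) _.
  rewrite natrX natrM mulrDl mul1r lerD //; last first.
    by rewrite le_eqVlt; apply/orP; left; apply/eqP; ring.
  have pl' := pl (2 ^ i)%N.
  apply: (@le_trans _ _ ((1 - p) ^+ (A * i))).
    by apply: lerXn2r; rewrite ?nnegrE //; lra.
  (* here the choice of [A] is used: [A] windows divide the probability by 4 *)
  have -> : (2 ^+ i ^+ 2)^-1 = (4^-1) ^+ i :> R.
    by rewrite exprVn -exprM mulnC exprM; congr (_ ^+ _)^-1; ring.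
  rewrite exprM.
  by apply: lerXn2r; rewrite ?nnegrE ?exprn_ge0 ?subr_ge0 ?invr_ge0 //; lra.
have mi : (m i.+1 - m i)%:R <= 4 * A%:R * i.+1%:R * 2 ^+ i :> R.
  rewrite -natrX -!natrM ler_nat (leq_trans (leq_subr _ _)) // /m expnS.
  by rewrite leq_eqVlt; apply/orP; left; apply/eqP; ring.
apply: le_trans (ler_pM _ _ mi tail) _ => //.
  by apply: iidE_ge0 => s; apply: iidE_ge0.
have -> : 4 * A%:R * i.+1%:R * 2 ^+ i * ((1 + A%:R * i%:R * M3) / 2 ^+ i ^+ 2)
  = 4 * A%:R * (i.+1%:R * (1 + A%:R * i%:R * M3) / 2 ^+ i).
  by field; rewrite gt_eqF.
have key : i.+1%:R * (1 + A%:R * i%:R * M3) <= (1 + A%:R * M3) * i.+1%:R ^+ 2 :> R.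
  have i0 : 0 <= i%:R :> R by [].
  have AM : 0 <= A%:R * M3 by rewrite mulr_ge0.
  rewrite -natr1 mulrAC expr2 [leRHS]mulrA [leRHS]mulrC ler_wpM2l ?addr_ge0 //.
  nra.
have -> : 4 * A%:R * (1 + A%:R * M3) * (i.+1%:R ^+ 2 / 2 ^+ i) =
  4 * A%:R * ((1 + A%:R * M3) * i.+1%:R ^+ 2 / 2 ^+ i) by ring.
apply: ler_wpM2l; first by rewrite !mulr_ge0.
by apply: ler_wpM2r => //; rewrite invr_ge0 ltW.
Qed.

End IidWords.

(** * Walks driven by the departures from the current site *)

Section Histories.
Context {Q D : finType} {V : zmodType} (vec : Q + D -> V).
Local Notation step := (Q + D)%type.

Definition displacement (H : seq step) : V := \sum_(x <- H) vec x.

(** The steps by which the walk left its current site, in chronological order: a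
    prefix of [H] ends at the current site when the rest of [H] has displacement 0. *)
Fixpoint departures (H : seq step) : seq step :=
  if H is x :: H' then
    (if displacement H == 0 then [:: x] else [::]) ++ departures H'
  else [::].

Definition level_word (H : seq step) : seq Q :=
  pmap (fun x => if x is inl v then Some v else None) H.

Lemma level_word_cat H K : level_word (H ++ K) = level_word H ++ level_word K.
Proof. exact: pmap_cat. Qed.

Lemma level_word_rcons_inl H v : level_word (rcons H (inl v)) = rcons (level_word H) v.
Proof. by rewrite -cats1 level_word_cat cats1. Qed.

Lemma level_word_rcons_inr H u : level_word (rcons H (inr u)) = level_word H.
Proof. by rewrite -cats1 level_word_cat cats0. Qed.

Lemma departures_cat H F :
  (forall i, (i < size H)%N -> displacement (drop i H ++ F) != 0) ->
  departures (H ++ F) = departures F.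
Proof.
elim: H => //= x H IH HF.
rewrite -[x :: H ++ F]/((x :: H) ++ F) -{1}(drop0 (x :: H)) (negPf (HF 0%N _)) //.
by apply: IH => i; apply: (HF i.+1).
Qed.

Context {L : zmodType} (lv : Q -> L).
Hypothesis level_vec : forall H,
  displacement H = 0 -> lsum lv (level_word H) = 0.

(** After a cut the walk only sees fresh sites: a visit to a site of the past would
    repeat the level of that site. *)
Lemma departures_cut H v F t :
  is_cut lv (rcons (level_word H) v) (level_word F ++ t) ->
  departures (rcons H (inl v) ++ F) = departures F.
Proof.
move=> /is_cutP C; apply: departures_cat => i; rewrite size_rcons ltnS => iH.
have E : level_word H = level_word (take i H) ++ level_word (drop i H).
  by rewrite -level_word_cat cat_take_drop.
apply/eqP => /level_vec; rewrite level_word_cat lsum_cat.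
have -> : level_word (drop i (rcons H (inl v))) =
   drop (size (level_word (take i H))) (rcons (level_word H) v).
  by rewrite drop_rcons // level_word_rcons_inl [in RHS]E rcons_cat drop_size_cat.
move=> e; have := C (size (level_word (take i H))) (size (level_word F)).
rewrite take_size_cat // e eqxx size_rcons size_cat leq_addr => C'.
suff : false by []; apply: C' => //; rewrite ltnS.
by rewrite [in leqRHS]E size_cat leq_addr.
Qed.
End Histories.
Arguments level_word {Q D} H : simpl never.

Section Walk.
Context {R : realFieldType} {Q D : finType} {V L : zmodType}.
Variables (vec : Q + D -> V) (lv : Q -> L).
Local Notation step := (Q + D)%type.
Hypothesis level_vec : forall H : seq step,
  displacement vec H = 0 -> lsum lv (level_word H) = 0.
Variable (q : Q -> R).
Hypothesis q_ge0 : forall v, 0 <= q v.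
Hypothesis q_sum1 : \sum_v q v = 1.
Variables (a : seq step -> R) (delta rho : R) (disp : D -> R).
Hypothesis delta_gt0 : 0 < delta.
Hypothesis a_ge : forall l, delta <= a l.
Hypothesis rho_ge0 : 0 <= rho.

(** [p l u] is the probability of the non-level step [u] and [a l] that of a level step,
    when [l] lists the earlier departures from the current site. *)
Definition local_kernel (p : seq step -> D -> R) :=
  [/\ forall l u, 0 <= p l u, forall l, a l + \sum_u p l u = 1 &
      forall l, `|\sum_u p l u * disp u| <= rho].

Local Notation deps := (departures vec).

Section OneKernel.
Variable p : seq step -> D -> R.
Hypothesis pK : local_kernel p.

Let p_ge0 l u : 0 <= p l u. Proof. by case: pK. Qed.
Let p_sum l : a l + \sum_u p l u = 1. Proof. by case: pK. Qed.
Let p_drift l : `|\sum_u p l u * disp u| <= rho. Proof. by case: pK. Qed.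
Let a_ge0 l : 0 <= a l. Proof. exact: le_trans (ltW delta_gt0) (a_ge l). Qed.
Definition step_mean (l : seq step) (f : step -> R) : R :=
  a l * (\sum_v q v * f (inl v)) + \sum_u p l u * f (inr u).

Arguments step_mean : simpl never.

Lemma step_mean_cst l c : step_mean l (fun=> c) = c.
Proof. by rewrite /step_mean -!mulr_suml q_sum1 mul1r -mulrDl p_sum mul1r. Qed.

Lemma step_meanD l f g : step_mean l (fun x => f x + g x) = step_mean l f + step_mean l g.
Proof.
rewrite /step_mean [RHS]addrACA -mulrDr -!big_split /=; congr (_ * _ + _);
  by apply: eq_bigr => ? _; rewrite mulrDr.
Qed.

Lemma step_meanZ l c f : step_mean l (fun x => c * f x) = c * step_mean l f.
Proof.
rewrite /step_mean [RHS]mulrDr [X in _ = X + _]mulrCA; congr (_ * _ + _);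
  by rewrite mulr_sumr; apply: eq_bigr => ? _; rewrite mulrCA.
Qed.

Lemma le_step_mean l f g : (forall x, f x <= g x) -> step_mean l f <= step_mean l g.
Proof.
move=> fg; rewrite /step_mean lerD // ?ler_wpM2l //;
  by apply: ler_sum => ? _; rewrite ler_wpM2l.
Qed.

Lemma ler_norm_step_mean l f g : (forall x, `|f x| <= g x) ->
  `|step_mean l f| <= step_mean l g.
Proof.
move=> fg; rewrite ler_norml -mulN1r -step_meanZ; apply/andP; split;
  by apply: le_step_mean => x; have := fg x; rewrite ler_norml => /andP[]; lra.
Qed.

Fixpoint mean_disp n H : R :=
  if n is n'.+1 then
    \sum_u p (deps H) u * disp u
    + step_mean (deps H) (fun x => mean_disp n' (rcons H x))
  else 0.

(** The level steps are prescribed by [t], which allows two walks to be compared along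
    the same level word.  The walk stops when a level step is due and [t] is exhausted. *)
Fixpoint mean_disp_along n H (t : seq Q) : R :=
  if n is n'.+1 then
    \sum_u p (deps H) u * disp u +
    (a (deps H) * (if t is v :: t' then mean_disp_along n' (rcons H (inl v)) t' else 0)
    + \sum_u p (deps H) u * mean_disp_along n' (rcons H (inr u)) t)
  else 0.

Lemma mean_disp_alongE n N H : (n <= N)%N ->
  iidE q N (mean_disp_along n H) = mean_disp n H.
Proof.
elim: n N H => [|n IH] [|N] H nN //; first exact: iidE_cst.
rewrite [LHS]iidED // iidE_cst //; congr (_ + _).
rewrite iidED // iidEZ // iidE_sum //; congr (_ * _ + _).
  by apply: eq_bigr => v _; congr (_ * _); apply: IH.
by apply: eq_bigr => u _; rewrite iidEZ //; congr (_ * _); apply/IH/ltnW.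
Qed.

(** The two means differ by the mean displacement of one step, the last one. *)
Lemma mean_disp_along_incr n H t :
  `|mean_disp_along n.+1 H t - mean_disp_along n H t| <= rho.
Proof.
elim: n H t => [|n IH] H t.
  rewrite /= subr0 [X in _ + (_ + X)]big1 ?addr0; last by move=> u _; rewrite mulr0.
  by case: t => [|v t]; rewrite mulr0 addr0.
have -> : mean_disp_along n.+2 H t - mean_disp_along n.+1 H t =
  a (deps H) * (if t is v :: t' then mean_disp_along n.+1 (rcons H (inl v)) t' -
       mean_disp_along n (rcons H (inl v)) t' else 0) +
  \sum_u p (deps H) u * (mean_disp_along n.+1 (rcons H (inr u)) t -
      mean_disp_along n (rcons H (inr u)) t).
  rewrite [mean_disp_along n.+2 _ _]/= -/(mean_disp_along n.+1) [X in _ - X]/=.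
  rewrite opprD addrACA subrr add0r opprD addrACA -sumrB.
  case: t => [|v t]; rewrite -?mulrBr ?subr0; congr (_ + _);
    by apply: eq_bigr => u _; rewrite mulrBr.
apply: le_trans (ler_normD _ _) _.
rewrite -[leRHS](mulr1) -(p_sum (deps H)) mulrDr lerD //.
  rewrite normrM ger0_norm // mulrC ler_wpM2r //.
  by case: t => [|v t]; rewrite ?normr0.
rewrite mulr_sumr; apply: le_trans (ler_norm_sum _ _ _) _.
by apply: ler_sum => u _; rewrite normrM ger0_norm // mulrC ler_wpM2r.
Qed.

Lemma mean_disp_along_le n H t : `|mean_disp_along n H t| <= rho *+ n.
Proof.
elim: n => [|n IH]; first by rewrite normr0.
rewrite -[X in `|X|](subrK (mean_disp_along n H t)) mulrS.
by apply: le_trans (ler_normD _ _) _; rewrite lerD // mean_disp_along_incr.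
Qed.

Lemma mean_disp_along_fresh n H v F t :
  is_cut lv (rcons (level_word H) v) (level_word F ++ t) ->
  mean_disp_along n (rcons H (inl v) ++ F) t = mean_disp_along n F t.
Proof.
elim: n F t => // n IH F t C /=.
rewrite (departures_cut level_vec C); congr (_ + (_ * _ + _)).
  case: t C => // w t C; rewrite rcons_cat.
  by apply: IH; rewrite level_word_rcons_inl cat_rcons.
by apply: eq_bigr => u _; rewrite rcons_cat IH // level_word_rcons_inr.
Qed.

(** Loss of memory at a cut.  Induction on [n] with the [c] level steps left before the
    cut: while waiting for the next level step, every time unit costs at most [2 * rho]
    (the displacement of one step, and one time unit less for the walk restarted at the
    cut), and the waiting time has mean at most [delta^-1].  When [c = 0] the history
    ends with a level step, so that the current site is fresh as well. *)
Lemma mean_disp_along_cut n c H t : (c <= size t)%N ->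
  (c = 0%N -> exists H' v, H = rcons H' (inl v)) ->
  is_cut lv (level_word H ++ take c t) (drop c t) ->
  `|mean_disp_along n H t - mean_disp_along n [::] (drop c t)|
    <= 2 * rho * c%:R / delta.
Proof.
have di : 0 <= delta^-1 by rewrite invr_ge0 ltW.
elim: n c H t => [|n IH] [|c] H t ct Hc C.
- by rewrite subrr normr0 mulr0 mul0r.
- by rewrite subrr normr0 !mulr_ge0.
- have [H' [v HE]] := Hc erefl; rewrite HE drop0.
  have -> : mean_disp_along n.+1 (rcons H' (inl v)) t = mean_disp_along n.+1 [::] t.
    rewrite -[rcons H' _]cats0 mean_disp_along_fresh //.
    by move: C; rewrite HE take0 cats0 drop0 level_word_rcons_inl.
  by rewrite subrr normr0 mulr0 mul0r.
case: t ct C => // w t ct C.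
set g := mean_disp_along n [::] (drop c t).
have -> : mean_disp_along n.+1 H (w :: t) - mean_disp_along n.+1 [::] (drop c.+1 (w :: t)) =
  (\sum_u p (deps H) u * disp u) - (mean_disp_along n.+1 [::] (drop c t) - g)
  + (a (deps H) * (mean_disp_along n (rcons H (inl w)) t - g) +
     \sum_u p (deps H) u * (mean_disp_along n (rcons H (inr u)) (w :: t) - g)).
  have sB (X : D -> R) : \sum_u p (deps H) u * (X u - g) =
      \sum_u p (deps H) u * X u - (1 - a (deps H)) * g.
    have -> : 1 - a (deps H) = \sum_u p (deps H) u by rewrite -(p_sum (deps H)) addrC addKr.
    by rewrite mulr_suml -sumrB; apply: eq_bigr => u _; rewrite mulrBr.
  rewrite sB [mean_disp_along n.+1 H _]/=.
  rewrite -/(mean_disp_along n.+1 [::] (drop c t)).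
  set X := mean_disp_along n.+1 [::] _; ring.
apply: le_trans (ler_normD _ _) _.
set A := a (deps H); have A0 : 0 <= A by apply: a_ge0.
have b1 : `|(\sum_u p (deps H) u * disp u) - (mean_disp_along n.+1 [::] (drop c t) - g)| <= 2 * rho.
  apply: le_trans (ler_normB _ _) _; rewrite mulr2n mulrDl mul1r lerD //.
  exact: mean_disp_along_incr.
have b2 : `|A * (mean_disp_along n (rcons H (inl w)) t - g) +
     \sum_u p (deps H) u * (mean_disp_along n (rcons H (inr u)) (w :: t) - g)|
   <= A * (2 * rho * c%:R / delta) + (1 - A) * (2 * rho * c.+1%:R / delta).
  apply: le_trans (ler_normD _ _) _; rewrite lerD //.
    rewrite normrM ger0_norm ?ler_wpM2l //; apply: IH => //; first by eauto.
    by move: C; rewrite /= level_word_rcons_inl cat_rcons.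
  have -> : 1 - A = \sum_u p (deps H) u by rewrite -(p_sum (deps H)) addrC addKr.
  rewrite mulr_suml; apply: le_trans (ler_norm_sum _ _ _) _; apply: ler_sum => u _.
  rewrite normrM ger0_norm ?ler_wpM2l //.
  by apply: (IH c.+1 (rcons H (inr u)) (w :: t)) => //; rewrite level_word_rcons_inr.
apply: le_trans (lerD b1 b2) _.
rewrite -[c.+1%:R]natr1.
have E : 2 * rho * (c%:R + 1) / delta =
   A * (2 * rho * c%:R / delta) + (1 - A) * (2 * rho * (c%:R + 1) / delta)
    + (A / delta) * (2 * rho) by ring.
rewrite [leRHS]E [leLHS]addrC lerD2l ler_peMl ?mulr_ge0 //.
by rewrite ler_pdivlMr // mul1r; apply: a_ge.
Qed.

Fixpoint occupation (f : seq step -> R) n H : R :=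
  if n is n'.+1 then
    f H + step_mean (deps H) (fun x => occupation f n' (rcons H x))
  else 0.

(** A supersolution [U] of the recursion dominates the occupation functional. *)
Lemma occupation_le_potential (f : seq step -> R) (U : nat -> seq step -> R) n H :
  (forall H, 0 <= U 0%N H) ->
  (forall n H, f H + step_mean (deps H) (fun x => U n (rcons H x)) <= U n.+1 H) ->
  occupation f n H <= U n H.
Proof.
move=> U0 US; elim: n H => [|n IH] H //=.
by apply: le_trans (US n H); rewrite lerD2l; apply: le_step_mean.
Qed.

Lemma occupationD f g n H :
  occupation (fun H => f H + g H) n H = occupation f n H + occupation g n H.
Proof.
elim: n H => [|n IH] H /=; first by rewrite addr0.
rewrite [RHS]addrACA -step_meanD; congr (_ + (_ * _ + _));
  by apply: eq_bigr => ? _; rewrite IH.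
Qed.

Lemma occupationZ c f n H :
  occupation (fun H => c * f H) n H = c * occupation f n H.
Proof.
elim: n H => [|n IH] H /=; first by rewrite mulr0.
rewrite mulrDr -step_meanZ; congr (_ + (_ * _ + _));
  by apply: eq_bigr => ? _; rewrite IH.
Qed.

Definition iid_occupation (f : seq Q -> R) n s : R :=
  \sum_(k < n) iidE q k (fun t => f (s ++ t)).

Lemma iid_occupationS f n s :
  iid_occupation f n.+1 s = f s + \sum_v q v * iid_occupation f n (rcons s v).
Proof.
rewrite /iid_occupation big_ord_recl /= cats0; congr (_ + _).
under [in RHS]eq_bigr => v _ do rewrite mulr_sumr.
rewrite exchange_big /=; apply: eq_bigr => k _.
apply: eq_bigr => v _; congr (_ * _).
by apply: eq_iidE => w _; rewrite cat_rcons.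
Qed.

Lemma iid_occupation_ge0 f n s : (forall s, 0 <= f s) -> 0 <= iid_occupation f n s.
Proof. by move=> f0; apply: sumr_ge0 => k _; apply: iidE_ge0. Qed.

Lemma iid_occupation_mono f n s : (forall s, 0 <= f s) ->
  iid_occupation f n s <= iid_occupation f n.+1 s.
Proof.
by move=> f0; rewrite /iid_occupation big_ord_recr lerDl; apply: iidE_ge0.
Qed.

Lemma a_le1 l : a l <= 1.
Proof. by rewrite -(p_sum l) lerDl sumr_ge0. Qed.

(** A functional that only changes at level steps, which occur with probability
    [A >= delta], grows by a factor [delta^-1] at most: the supersolution property of
    [delta^-1 * z] when the functional is [x] now, [z - x] after a level step, and [y]
    with one time unit less. *)
Lemma delayed_step (A x y z : R) : delta <= A -> A <= 1 -> 0 <= x -> y <= z ->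
  x + (A * (delta^-1 * (z - x)) + (1 - A) * (delta^-1 * y)) <= delta^-1 * z.
Proof.
move=> dA A1 x0 yz.
have d0 : 0 <= delta^-1 by rewrite invr_ge0 ltW.
have dA' : 1 <= A * delta^-1 by rewrite ler_pdivlMr // mul1r.
have : (1 - A) * (delta^-1 * y) <= (1 - A) * (delta^-1 * z).
  by rewrite ler_wpM2l ?subr_ge0 // ler_wpM2l.
have : x <= A * delta^-1 * x by rewrite ler_peMl.
set di := delta^-1; nra.
Qed.

(** The level word is a word of i.i.d. letters, revealed at a random speed of at least
    [delta]. *)
Lemma occupation_levels (f : seq Q -> R) n H : (forall s, 0 <= f s) ->
  occupation (f \o level_word) n H <= delta^-1 * iid_occupation f n (level_word H).
Proof.
move=> f0.
apply: (occupation_le_potential (U := fun n H => delta^-1 * iid_occupation f n (level_word H))) => {n H}.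
  by move=> H; rewrite mulr_ge0 ?invr_ge0 ?(ltW delta_gt0) ?iid_occupation_ge0.
move=> n H.
have -> : step_mean (deps H) (fun x => delta^-1 * iid_occupation f n (level_word (rcons H x)))
  = a (deps H) * (delta^-1 * (iid_occupation f n.+1 (level_word H) - f (level_word H)))
   + (1 - a (deps H)) * (delta^-1 * iid_occupation f n (level_word H)).
  rewrite /step_mean iid_occupationS addrAC subrr add0r.
  have -> : 1 - a (deps H) = \sum_u p (deps H) u by rewrite -(p_sum (deps H)) addrC addKr.
  rewrite [X in _ = _ + X]mulr_suml; congr (_ * _ + _).
    by rewrite mulr_sumr; apply: eq_bigr => x _; rewrite level_word_rcons_inl mulrCA.
  by apply: eq_bigr => x _; rewrite level_word_rcons_inr.
exact: delayed_step (a_ge _) (a_le1 _) (f0 _) (iid_occupation_mono n (level_word H) f0).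
Qed.

Variables (xi : pred D) (gamma G : R).
Hypothesis xi_mass : forall l, \sum_(u | xi u) p l u <= gamma.
Hypothesis return_sum : forall n, \sum_(k < n) return_prob q lv k <= G.

Definition xi_step (x : step) : bool := if x is inr u then xi u else false.

Definition level_green n (z : L) : R :=
  \sum_(k < n) iidE q k (fun w => (z + lsum lv w == 0)%:R).

(** Every xi step of the history is charged the mean number of returns of the levels, in
    [n] further level steps, to the level from which it was made. *)
Fixpoint xi_green n (H : seq step) : R :=
  if H is x :: H' then
    (xi_step x)%:R * level_green n (lsum lv (level_word H)) + xi_green n H'
  else 0.

(** Number of xi steps made from the current level; it dominates the number of xi steps
    made from the current site. *)
Fixpoint xi_count (H : seq step) : R :=
  if H is x :: H' then
    (xi_step x && (lsum lv (level_word H) == 0))%:R + xi_count H'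
  else 0.

Lemma xi_count_ge0 H : 0 <= xi_count H.
Proof. by elim: H => //= x H IH; rewrite addr_ge0. Qed.

Lemma has_xi_le H : (has xi_step (deps H))%:R <= xi_count H.
Proof.
elim: H => //= x H IH; rewrite has_cat.
have [e|e] := eqVneq (displacement vec (x :: H)) 0; last first.
  by rewrite /= ler_wpDl.
have -> := level_vec e; rewrite eqxx andbT /= orbF.
case: (xi_step x) => /=; last by rewrite add0r.
by rewrite lerDl xi_count_ge0.
Qed.

Lemma level_greenS n z :
  level_green n.+1 z = (z == 0)%:R + \sum_v q v * level_green n (z + lv v).
Proof.
rewrite /level_green big_ord_recl /= /lsum big_nil addr0; congr (_ + _).
under [in RHS]eq_bigr => v _ do rewrite mulr_sumr.
rewrite exchange_big /=; apply: eq_bigr => k _.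
apply: eq_bigr => v _; congr (_ * _).
by apply: eq_iidE => w _; rewrite big_cons addrA.
Qed.

Lemma level_green_mono n z : level_green n z <= level_green n.+1 z.
Proof.
by rewrite /level_green big_ord_recr lerDl; apply: iidE_ge0.
Qed.

Lemma level_green_ge0 n z : 0 <= level_green n z.
Proof. by apply: sumr_ge0 => k _; apply: iidE_ge0. Qed.

Lemma level_green0 n : level_green n 0 <= G.
Proof.
apply: le_trans (return_sum n); apply: ler_sum => k _.
by apply: le_iidE => // w _; rewrite add0r.
Qed.

Lemma xi_green_ge0 n H : 0 <= xi_green n H.
Proof. by elim: H => //= x H IH; rewrite addr_ge0 // mulr_ge0 ?level_green_ge0. Qed.

Lemma xi_green_mono n H : xi_green n H <= xi_green n.+1 H.
Proof.
elim: H => //= x H IH; rewrite lerD // ler_wpM2l //; exact: level_green_mono.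
Qed.

Lemma xi_green_inl n H :
  \sum_v q v * xi_green n (rcons H (inl v)) = xi_green n.+1 H - xi_count H.
Proof.
elim: H => [|x H IH] /=.
  by rewrite subrr big1 // => v _; rewrite mul0r add0r mulr0.
under eq_bigr => v _ do rewrite mulrDr.
rewrite big_split /= IH opprD addrACA; congr (_ + _).
rewrite level_greenS -mulnb natrM mulrDr addrAC subrr add0r mulr_sumr.
apply: eq_bigr => v _; rewrite mulrCA; congr (_ * (_ * _)).
rewrite -rcons_cons level_word_rcons_inl.
by rewrite -cats1 lsum_cat lsum_cons /lsum big_nil addr0.
Qed.

Lemma xi_green_inr n H u :
  xi_green n (rcons H (inr u)) = xi_green n H + (xi u)%:R * level_green n 0.
Proof.
elim: H => [|x H IH] /=; first by rewrite /lsum big_nil addr0 add0r.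
by rewrite IH addrA -rcons_cons level_word_rcons_inr.
Qed.

(** The supersolution is [delta^-1 * (xi_green n H + gamma * G *+ n)]: a level step
    consumes [xi_count H] from [xi_green], and a non-level step creates a new charge, at
    most [G], with probability at most [gamma]. *)
Lemma occupation_xi n :
  occupation (fun H => (has xi_step (deps H))%:R) n [::] <= delta^-1 * (gamma * G *+ n).
Proof.
have d0 : 0 <= delta^-1 by rewrite invr_ge0 ltW.
have g0 : 0 <= gamma by apply: le_trans (xi_mass [::]); apply: sumr_ge0.
have G0 : 0 <= G by apply: le_trans (level_green0 0); apply: level_green_ge0.
apply: le_trans (occupation_le_potential (U := fun n H => delta^-1 * (xi_green n H + gamma * G *+ n)) _ _ _ _) _; last by rewrite /= add0r.
  by move=> H; rewrite mulr0n addr0 mulr_ge0 ?xi_green_ge0.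
move=> {}n H.
set A := a (deps H).
have A1 : 0 <= 1 - A by rewrite subr_ge0 a_le1.
have sA : 1 - A = \sum_u p (deps H) u by rewrite -(p_sum (deps H)) addrC addKr.
have E : step_mean (deps H) (fun x => xi_green n (rcons H x)) <=
   A * (xi_green n.+1 H - xi_count H) + (1 - A) * xi_green n H + gamma * G.
  rewrite /step_mean xi_green_inl -addrA lerD2l.
  under eq_bigr => u _ do rewrite xi_green_inr mulrDr.
  rewrite big_split /= -mulr_suml -sA lerD2l.
  rewrite (bigID xi) /= [X in _ + X]big1 ?addr0; last first.
    by move=> u /negPf ->; rewrite mul0r mulr0.
  under eq_bigr => u -> do rewrite mul1r.
  rewrite -mulr_suml; apply: ler_pM => //; [exact: sumr_ge0|exact: level_green_ge0|].
  exact: level_green0.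
rewrite step_meanZ step_meanD step_mean_cst.
apply: (@le_trans _ _ (xi_count H + delta^-1 * (A * (xi_green n.+1 H - xi_count H) + (1 - A) * xi_green n H + gamma * G + gamma * G *+ n))).
  by rewrite lerD ?has_xi_le // ler_wpM2l // lerD2r.
have := delayed_step (a_ge (deps H)) (a_le1 (deps H)) (xi_count_ge0 H) (xi_green_mono n H).
rewrite -/A mulrSr; set z := gamma * G; set y := _ *+ n; set di := delta^-1.
set X1 := xi_green _ _; set X2 := xi_green _ _; set X3 := xi_count _; lra.
Qed.

End OneKernel.

Variables (p p' : seq step -> D -> R) (xi : pred D) (gamma eps G K : R)
  (nu1 nu2 : D -> R).
Hypotheses (pK : local_kernel p) (pK' : local_kernel p').
Hypothesis xi_mass : forall l, \sum_(u | xi u) p l u <= gamma.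
Hypothesis return_sum : forall n, \sum_(k < n) return_prob q lv k <= G.
Hypothesis eps_ge0 : 0 <= eps.
Hypotheses (nu1_ge0 : forall u, 0 <= nu1 u) (nu2_ge0 : forall u, 0 <= nu2 u).
Hypotheses (nu1_mass : \sum_u nu1 u = gamma) (nu2_mass : \sum_u nu2 u = gamma).
Hypothesis nu_drift : \sum_u (nu2 u - nu1 u) * disp u = rho.
Hypothesis kernel_diff : forall l u,
  p' l u - p l u = (~~ has (xi_step xi) l)%:R * eps * (nu2 u - nu1 u).
Hypothesis cut_bound : forall k n,
  iidE q k (fun s => iidE q n (fun t => (first_cut lv s t)%:R)) <= K.

(** Truncated mean waiting time for the next cut: a word of length [N] without a cut
    counts for [N.+1]. *)
Definition recoupling N (s : seq Q) : R := iidE q N (fun t => (first_cut lv s t)%:R).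

(** The centring [g] is the mean displacement of the walk restarted at the first cut of
    the level word, which does not depend on the step [u]. *)
Lemma mean_disp_centered N n H : (n <= N)%N ->
  exists g, forall u,
  `|mean_disp p' n (rcons H (inr u)) - g|
    <= 2 * rho / delta * recoupling N (level_word H).
Proof.
move=> nN.
have d1 : 1 <= delta^-1.
  rewrite invf_ge1 //; apply: le_trans (a_ge [::]) _.
  exact: a_le1 pK' _.
pose s := level_word H.
pose g t := if (first_cut lv s t <= size t)%N then
   mean_disp_along p' n [::] (drop (first_cut lv s t) t) else 0.
exists (iidE q N g) => u.
(* both walks use the same level word of length [N], long enough for [n] steps *)
rewrite -(mean_disp_alongE p' _ nN) -iidEB // /recoupling -iidEZ //.
apply: ler_norm_iidE => // t tN; rewrite /g.
case: ifP => [ft|/negbT]; last first.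
  rewrite -ltnNge subr0 => ft.
  (* without a cut, [first_cut] exceeds [N], hence [n], and the trivial bound suffices *)
  apply: le_trans (mean_disp_along_le pK' _ _ _) _.
  rewrite -[leLHS]mulr_natr -!mulrA mulrCA ler_wpM2l // mulrA.
  rewrite -[leLHS]mul1r ler_pM //; first by lra.
  by rewrite ler_nat ltnW // (leq_ltn_trans _ ft) // tN.
rewrite mulrAC; apply: mean_disp_along_cut => //.
by rewrite level_word_rcons_inr; apply: first_cutP.
Qed.

(** The centring [g] of [mean_disp_centered] drops out because [nu1] and [nu2] have the
    same mass. *)
Lemma mean_disp_diff_step N n H : (n <= N)%N ->
  `|\sum_u (p' (deps H) u - p (deps H) u) *
      (disp u + mean_disp p' n (rcons H (inr u))) - eps * rho|
  <= eps * rho * ((has (xi_step xi) (deps H))%:R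
        + 4 * gamma / delta * recoupling N (level_word H)).
Proof.
move=> nN; have er0 : 0 <= eps * rho by rewrite mulr_ge0.
have rec0 : 0 <= 4 * gamma / delta * recoupling N (level_word H).
  rewrite mulr_ge0 ?iidE_ge0 // divr_ge0 ?(ltW delta_gt0) //.
  by rewrite mulr_ge0 // -nu1_mass sumr_ge0.
under eq_bigr => u _ do rewrite kernel_diff.
case: has; rewrite ?(mul0r, mul1r) /=.
  rewrite big1 ?sub0r ?normrN; last by move=> u _; rewrite mul0r mul0r.
  by rewrite ger0_norm // -[leLHS]mulr1 ler_wpM2l // lerDl.
have [g Hg] := mean_disp_centered H nN.
rewrite [X in `|X|](_ : _ = eps * \sum_u (nu2 u - nu1 u) * (mean_disp p' n (rcons H (inr u)) - g)); last first.
  rewrite -{1}nu_drift !mulr_sumr -sumrB.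
  have -> : \sum_u eps * ((nu2 u - nu1 u) * (mean_disp p' n (rcons H (inr u)) - g)) =
    \sum_u eps * ((nu2 u - nu1 u) * mean_disp p' n (rcons H (inr u))) -
      eps * g * \sum_u (nu2 u - nu1 u).
    by rewrite mulr_sumr -sumrB; apply: eq_bigr => u _; ring.
  have -> : \sum_u (nu2 u - nu1 u) = 0 by rewrite sumrB nu1_mass nu2_mass subrr.
  rewrite mulr0 subr0.
  by apply: eq_bigr => u _; ring.
rewrite normrM ger0_norm // add0r -mulrA ler_wpM2l //.
apply: le_trans (ler_norm_sum _ _ _) _.
apply: (@le_trans _ _ (\sum_u (nu2 u + nu1 u) * (2 * rho / delta * recoupling N (level_word H)))).
  apply: ler_sum => u _; rewrite normrM ler_pM //.
  by apply: le_trans (ler_normB _ _) _; rewrite !ger0_norm.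
rewrite -mulr_suml big_split /= nu1_mass nu2_mass le_eqVlt; apply/orP; left.
by apply/eqP; ring.
Qed.

(** Replacing the law of one step after the other expresses the difference as an occupation
    functional of the walk with kernel [p]; its two parts are bounded by
    [occupation_xi] and [occupation_levels]. *)
Lemma mean_disp_comparison n :
  `|mean_disp p' n [::] - mean_disp p n [::] - eps * rho *+ n|
   <= eps * rho * (gamma * (G / delta + 4 * K / delta ^+ 2)) *+ n.
Proof.
pose f (H : seq step) : R := (has (xi_step xi) (deps H))%:R
        + 4 * gamma / delta * recoupling n (level_word H).
have er0 : 0 <= eps * rho by rewrite mulr_ge0.
have g0 : 0 <= gamma by rewrite -nu1_mass sumr_ge0.
have di : 0 <= delta^-1 by rewrite invr_ge0 ltW.
apply: (@le_trans _ _ (eps * rho * occupation p f n [::])); last first.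
  rewrite -mulrnAr ler_wpM2l // /f occupationD.
  have H1 := occupation_xi pK xi_mass return_sum n.
  have H2 : occupation p (fun H => 4 * gamma / delta * recoupling n (level_word H)) n [::]
     <= 4 * gamma / delta * (delta^-1 * (K *+ n)).
    rewrite occupationZ ler_wpM2l ?divr_ge0 ?mulr_ge0 ?(ltW delta_gt0) //.
    apply: le_trans (occupation_levels pK (f := recoupling n) n [::] _) _.
      by move=> s; apply: iidE_ge0.
    rewrite ler_wpM2l // -[n in leRHS]card_ord -sumr_const.
    by apply: ler_sum => k _; apply: cut_bound.
  apply: le_trans (lerD H1 H2) _; rewrite -(mulr_natr (gamma * G)) -(mulr_natr K).
  rewrite -[leRHS]mulr_natr le_eqVlt.
  apply/orP; left; apply/eqP.
  by field; rewrite gt_eqF.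
suff H m H0 : (m <= n)%N -> `|mean_disp p' m H0 - mean_disp p m H0 - eps * rho *+ m|
   <= eps * rho * occupation p f m H0 by apply: H.
elim: m H0 => [|m IH] H0 mn; first by rewrite /= subrr subr0 normr0 mulr0.
have -> : mean_disp p' m.+1 H0 - mean_disp p m.+1 H0 - eps * rho *+ m.+1 =
  (\sum_u (p' (deps H0) u - p (deps H0) u) *
      (disp u + mean_disp p' m (rcons H0 (inr u))) - eps * rho)
  + step_mean p (deps H0) (fun x => mean_disp p' m (rcons H0 x) - mean_disp p m (rcons H0 x) - eps * rho *+ m).
  have mB (X Y : step -> R) : step_mean p (deps H0) (fun x => X x - Y x - eps * rho *+ m) =
     step_mean p (deps H0) X - step_mean p (deps H0) Y - eps * rho *+ m.
    suff -> : step_mean p (deps H0) X = step_mean p (deps H0) (fun x => X x - Y x - eps * rho *+ m)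
        + (step_mean p (deps H0) Y + step_mean p (deps H0) (fun=> eps * rho *+ m)).
      by rewrite (step_mean_cst pK); ring.
    rewrite -!step_meanD /step_mean; congr (_ * _ + _);
      by apply: eq_bigr => ? _; congr (_ * _); ring.
  rewrite mB /= mulrS.
  have -> : \sum_u (p' (deps H0) u - p (deps H0) u) * (disp u + mean_disp p' m (rcons H0 (inr u)))
    = (\sum_u p' (deps H0) u * disp u + \sum_u p' (deps H0) u * mean_disp p' m (rcons H0 (inr u)))
    - (\sum_u p (deps H0) u * disp u + \sum_u p (deps H0) u * mean_disp p' m (rcons H0 (inr u))).
    by rewrite -!big_split /= -sumrB; apply: eq_bigr => u _; ring.
  rewrite /step_mean; ring.
rewrite [occupation _ _ _ _]/= mulrDr.
apply: le_trans (ler_normD _ _) _; apply: lerD.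
  by apply: mean_disp_diff_step; apply: ltnW.
rewrite -step_meanZ; apply: (ler_norm_step_mean pK) => x.
by apply: IH; apply: ltnW.
Qed.
End Walk.

(** * Means of products over independent sites *)

Section Independence.
Local Open Scope ereal_scope.
Context {R : realType}.

Import HBNNSimple.

(** An identity known for indicators extends to nonnegative functions by monotone
    approximation with simple functions. *)
Lemma integral_weighted_law d d' (T : measurableType d) (S : measurableType d')
    (P : {measure set T -> \bar R}) (mu : {measure set S -> \bar R})
    (g : T -> R) (Z : T -> S) (c : R) (f : S -> \bar R) :
  measurable_fun setT g -> (forall t, 0 <= g t)%R -> measurable_fun setT Z ->
  (0 <= c)%R ->
  (forall A, measurable A -> \int[P]_t (g t * \1_A (Z t))%:E = c%:E * mu A) ->
  measurable_fun setT f -> (forall x, 0 <= f x) ->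
  \int[P]_t ((g t)%:E * f (Z t)) = c%:E * \int[mu]_x f x.
Proof.
move=> mg g0 mZ c0 gA mf f0.
pose h := nnsfun_approx measurableT mf.
have hf x : EFin \o h ^~ x @ \oo --> f x by apply: cvg_nnsfun_approx.
have Cmu : \int[mu]_x (EFin \o h n) x @[n --> \oo] --> \int[mu]_x f x.
  under eq_integral => x _ do rewrite -(cvg_lim _ (hf x))//.
  apply: cvg_monotone_convergence => //.
  - by move=> n; apply/measurable_EFinP.
  - by move=> n x _ //=; rewrite lee_fin.
  - by move=> x _ a b ab; rewrite lee_fin; exact/lefP/nd_nnsfun_approx.
have CP : \int[P]_t ((g t)%:E * (h n (Z t))%:E) @[n --> \oo] -->
    \int[P]_t ((g t)%:E * f (Z t)).
  have gf t : (g t)%:E * (h n (Z t))%:E @[n --> \oo] --> (g t)%:E * f (Z t).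
    by apply: cvgeZl => //; exact: hf.
  under eq_integral => t _ do rewrite -(cvg_lim _ (gf t))//.
  apply: cvg_monotone_convergence => //.
  - move=> n; apply: emeasurable_funM; apply/measurable_EFinP => //.
    exact: measurableT_comp.
  - by move=> n x _ /=; rewrite mule_ge0 ?lee_fin.
  - move=> x _ a b ab; apply: lee_wpmul2l; rewrite lee_fin //.
    exact/lefP/nd_nnsfun_approx.
have step n : \int[P]_t ((g t)%:E * (h n (Z t))%:E) = c%:E * \int[mu]_x (EFin \o h n) x.
  transitivity (\int[P]_t (\sum_(y \in range (h n)) (y%:E * (g t * \1_(h n @^-1` [set y]) (Z t))%:E))).
    apply: eq_integral => t _; rewrite fimfunE -fsumEFin //= ge0_mule_fsumr.
      by apply: eq_fsbigr => y _; rewrite !EFinM muleCA.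
    by move=> y; apply: nnfun_muleindic_ge0.
  have mI y : measurable_fun setT (fun t => (g t * \1_(h n @^-1` [set y]) (Z t))%:E).
    apply/measurable_EFinP; apply: measurable_funM => //.
    by apply: measurableT_comp => //.
  rewrite ge0_integral_fsum //; last 2 first.
  - by move=> y; apply: emeasurable_funM.
  - move=> y t _; have := nnfun_muleindic_ge0 (h n) y (Z t).
    by rewrite !EFinM muleCA => ?; rewrite mule_ge0 // lee_fin.
  rewrite integral_nnsfun // patch_setT sintegralE ge0_mule_fsumr; last first.
    move=> y.
    exact: nnsfun_mulemu_ge0.
  apply: eq_fsbigr => y; rewrite inE => -[x _ <-].
  rewrite ge0_integralZl //.
  - by rewrite gA // muleCA.
  - by move=> t _; rewrite lee_fin mulr_ge0.
  - by rewrite lee_fin.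
have Cc : c%:E * \int[mu]_x (EFin \o h n) x @[n --> \oo] --> c%:E * \int[mu]_x f x.
  exact: cvgeZl.
move: CP; under eq_fun do rewrite step; move=> CP.
by rewrite -[LHS](cvg_lim _ CP) // -(cvg_lim _ Cc).
Qed.

(** Products of such functions stay bounded, which keeps every mean below finite. *)
Definition unit_valued d (T : measurableType d) (f : T -> R) :=
  measurable_fun setT f /\ (forall x, 0 <= f x <= 1)%R.

Definition mean d (T : measurableType d) (mu : {measure set T -> \bar R})
  (f : T -> R) : R := fine (\int[mu]_x (f x)%:E).

Lemma meanE d (T : measurableType d) (mu : probability T R) f :
  unit_valued f -> (mean mu f)%:E = \int[mu]_x (f x)%:E.
Proof.
move=> [mf f01]; rewrite /mean fineK // ge0_fin_numE; last first.
  by apply: integral_ge0 => x _; rewrite lee_fin; case/andP: (f01 x).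
apply: (@le_lt_trans _ _ (\int[mu]_x 1%:E)).
  apply: ge0_le_integral => //.
  - by move=> x _; rewrite lee_fin; case/andP: (f01 x).
  - exact/measurable_EFinP.
  - by move=> x _; rewrite lee_fin; case/andP: (f01 x).
by rewrite integral_cst // mul1e [ltLHS](_ : _ = mu setT) // probability_setT ltry.
Qed.

Lemma mean_ge0 d (T : measurableType d) (mu : {measure set T -> \bar R}) f :
  (forall x, 0 <= f x)%R -> (0 <= mean mu f)%R.
Proof.
by move=> f0; apply: fine_ge0; apply: integral_ge0 => x _; rewrite lee_fin.
Qed.

Lemma mean1 d (T : measurableType d) (mu : probability T R) :
  mean mu (fun=> 1)%R = 1%R.
Proof.
rewrite /mean integral_cst // mul1e [X in fine X](_ : _ = mu setT) //.
by rewrite probability_setT.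
Qed.

Lemma mean_sum_ae d (T : measurableType d) (mu : probability T R) (I : Type)
    (s : seq I) (f : I -> T -> R) (c : R) (g : T -> R) :
  (forall i, unit_valued (f i)) -> unit_valued g -> (0 <= c)%R ->
  {ae mu, forall x, (\sum_(i <- s) f i x = c * g x)%R} ->
  (\sum_(i <- s) mean mu (f i) = c * mean mu g)%R.
Proof.
move=> uf ug c0 fg; apply: EFin_inj; rewrite EFinM meanE // -sumEFin.
under eq_bigr => i _ do rewrite meanE //.
rewrite -ge0_integral_sum //; last 2 first.
- by move=> i; apply/measurable_EFinP; case: (uf i).
- by move=> i x _; rewrite lee_fin; case: (uf i) => _ /(_ x)/andP[].
have [mg g01] := ug.
rewrite -ge0_integralZl //; last 2 first.
- exact/measurable_EFinP.
- by move=> x _; rewrite lee_fin; case/andP: (g01 x).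
apply: ge0_ae_eq_integral => //.
- by apply: emeasurable_sum => i; apply/measurable_EFinP; case: (uf i).
- by apply: emeasurable_funM => //; apply/measurable_EFinP.
- by move=> x _; apply: sume_ge0 => i _; rewrite lee_fin; case: (uf i) => _ /(_ x)/andP[].
- by move=> x _; rewrite -EFinM lee_fin mulr_ge0 //; case/andP: (g01 x).
by apply: filterS fg => x e _; rewrite sumEFin e EFinM.
Qed.

Lemma prod01 (I : Type) (s : seq I) (f : I -> R) :
  (forall i, 0 <= f i <= 1)%R -> (0 <= \prod_(i <- s) f i <= 1)%R.
Proof.
move=> f01; elim: s => [|i s /andP[p0 p1]]; first by rewrite big_nil ler01 lexx.
case/andP: (f01 i) => i0 i1.
by rewrite big_cons mulr_ge0 //= mulr_ile1.
Qed.

Lemma unit_valued_prod d (T : measurableType d) (I : eqType) (s : seq I)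
    (f : I -> T -> R) : (forall i, unit_valued (f i)) ->
  unit_valued (fun x => \prod_(i <- s) f i x)%R.
Proof.
move=> uf; split; first by apply: measurable_prod => i _; case: (uf i).
by move=> x; apply: prod01 => i; case: (uf i).
Qed.

Lemma unit_valued_indic d (T : measurableType d) (A : set T) :
  measurable A -> unit_valued (\1_A : T -> R).
Proof.
move=> mA; split; first exact: measurable_indic.
by move=> x; rewrite indicE; case: (x \in A); rewrite ?lexx ?ler01.
Qed.

Lemma unit_valuedM d (T : measurableType d) (f g : T -> R) :
  unit_valued f -> unit_valued g -> unit_valued (fun x => f x * g x)%R.
Proof.
move=> [mf f01] [mg g01]; split; first exact: measurable_funM.
by move=> x; case/andP: (f01 x) (g01 x) => f0 f1 /andP[g0 g1]; rewrite mulr_ge0 //= mulr_ile1.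
Qed.

Lemma unit_valued_comp d d' (T : measurableType d) (S : measurableType d')
    (Z : T -> S) (f : S -> R) : measurable_fun setT Z ->
  unit_valued f -> unit_valued (f \o Z).
Proof. by move=> mZ [mf f01]; split; [exact: measurableT_comp|move=> x; apply: f01]. Qed.

Section Iid.
Context d d' (T : measurableType d) (S : measurableType d') (I : choiceType)
  (P : probability T R) (mu : probability S R) (Z : I -> T -> S).
Hypothesis mZ : forall i, measurable_fun setT (Z i).
Hypothesis iidZ : forall (s : seq I) (A : I -> set S), uniq s ->
  (forall i, measurable (A i)) ->
  P [set w | forall i, i \in s -> A i (Z i w)] = \prod_(i <- s) mu (A i).

(* the functions are replaced by indicators one site at a time: [s1] holds the sites
   that still carry a function, [s2] those that carry an indicator *)
Let mean_prod_aux (f : I -> S -> R) (s1 s2 : seq I) (A : I -> set S) :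
  (forall i, unit_valued (f i)) -> (forall i, measurable (A i)) ->
  uniq (s1 ++ s2) ->
  \int[P]_w ((\prod_(i <- s1) f i (Z i w)) * \prod_(i <- s2) \1_(A i) (Z i w))%:E
  = ((\prod_(i <- s1) mean mu (f i)) * \prod_(i <- s2) fine (mu (A i)))%:E.
Proof.
move=> uf; elim: s1 s2 A => [|i s1 IH] s2 A mA us.
  have pE (w : T) : (\prod_(i <- s2) \1_(A i) (Z i w) : R)%R =
      \1_[set w | forall i, i \in s2 -> A i (Z i w)] w.
    rewrite indicE; elim: (s2) => [|j s IHs].
      by rewrite big_nil mem_set.
    rewrite big_cons IHs indicE -natrM mulnb; congr (_%:R); congr nat_of_bool.
    apply/andP/idP => [[/set_mem Aj /set_mem As]|/set_mem H].
      by apply/mem_set => k; rewrite inE => /predU1P[->//|]; apply: As.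
    split; apply/mem_set; first by apply: H; rewrite inE eqxx.
    by move=> k ks; apply: H; rewrite inE ks orbT.
  under eq_integral => w _ do rewrite big_nil mul1r pE.
  have mE : measurable [set w | forall i, i \in s2 -> A i (Z i w)].
    rewrite (_ : [set _ | _] = \bigcap_(i in [set` s2]) (Z i @^-1` A i)); last first.
      by apply/seteqP; split.
    apply: fin_bigcap_measurable => // j _.
    by rewrite -[X in measurable X]setTI; apply: mZ.
  rewrite integral_indic // setIT.
  rewrite [LHS](_ : _ = P [set w | forall i, i \in s2 -> A i (Z i w)]) // iidZ // big_nil mul1r -prodEFin.
  apply: eq_bigr => j _; rewrite fineK //; exact: fin_num_measure.
have ui : i \notin s1 ++ s2 by move: us => /= /andP[].
have us' : uniq (s1 ++ (i :: s2)) by rewrite -[i :: s2]/([:: i] ++ s2) uniq_catCA.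
pose g w := ((\prod_(j <- s1) f j (Z j w)) * \prod_(j <- s2) \1_(A j) (Z j w))%R.
pose c := ((\prod_(j <- s1) mean mu (f j)) * \prod_(j <- s2) fine (mu (A j)))%R.
have ug : unit_valued g.
  apply: unit_valuedM; apply: unit_valued_prod => j;
    by apply: (unit_valued_comp (mZ j)) => //; apply: unit_valued_indic.
have c0 : (0 <= c)%R.
  apply: mulr_ge0; apply: prodr_ge0 => j _.
    by apply: mean_ge0 => x; case: (uf j) => _ /(_ x)/andP[].
  exact: fine_ge0.
have := @integral_weighted_law _ _ _ _ P mu g (Z i) c (fun x => (f i x)%:E)
  ug.1 _ (mZ i) c0 _ _ _.
have [mfi fi01] := uf i.
move=> H; transitivity (\int[P]_t ((g t)%:E * (f i (Z i t))%:E)).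
  by apply: eq_integral => w _; rewrite -EFinM big_cons; congr (_%:E); rewrite /g; ring.
rewrite {}H.
- by rewrite -meanE // -EFinM big_cons /c; congr (_%:E); ring.
- by move=> t; case/andP: (ug.2 t).
- move=> B mB; pose A' j := if j == i then B else A j.
  have eqA s : i \notin s -> forall F : set S -> I -> R,
     (\prod_(j <- s) F (A' j) j = \prod_(j <- s) F (A j) j)%R.
    move=> ni F; rewrite big_seq [RHS]big_seq; apply: eq_bigr => j js.
    by rewrite /A'; case: eqP => // e; rewrite -e js in ni.
  have ni2 : i \notin s2 by move: ui; rewrite mem_cat negb_or => /andP[].
  transitivity (c * fine (mu B))%:E; last by rewrite EFinM fineK //; exact: fin_num_measure.
  have A'i : A' i = B by rewrite /A' eqxx.
  have mA' j : measurable (A' j) by rewrite /A'; case: ifP.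
  have := IH (i :: s2) A' mA' us'.
  rewrite big_cons (eqA s2 ni2 (fun B _ => fine (mu B))) A'i mulrCA -/c [(_ * c)%R]mulrC => <-.
  apply: eq_integral => w _; rewrite big_cons (eqA s2 ni2 (fun B j => \1_B (Z j w))).
  by rewrite A'i /g; congr (_%:E); ring.
- exact/measurable_EFinP.
- by move=> x; rewrite lee_fin; case/andP: (fi01 x).
Qed.

Lemma mean_prod_iid (f : I -> S -> R) (s : seq I) :
  (forall i, unit_valued (f i)) -> uniq s ->
  mean P (fun w => \prod_(i <- s) f i (Z i w))%R = (\prod_(i <- s) mean mu (f i))%R.
Proof.
move=> uf us; have H := @mean_prod_aux f s [::] (fun=> setT) uf (fun=> measurableT).
rewrite cats0 big_nil mulr1 in H.
rewrite /mean (eq_integral (fun w => ((\prod_(i <- s) f i (Z i w)) *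
    \prod_(i <- [::]) \1_setT (Z i w))%:E)) ?(H us) //.
by move=> w _; rewrite big_nil mulr1.
Qed.
End Iid.
End Independence.

(** * Cut times and return probabilities of the level walk *)

Section Words.
Context {R : realType} {Q : finType} (q : Q -> R).

Definition weight (w : seq Q) : R := \prod_(v <- w) q v.

Fixpoint words n : seq (seq Q) :=
  if n is n'.+1 then [seq v :: w | v <- enum Q, w <- words n'] else [:: [::]].

Lemma mem_words n w : (w \in words n) = (size w == n).
Proof.
elim: n w => [|n IH] [|v w] //=.
  by apply/allpairsP => -[[? ?] [_ _]].
rewrite eqSS -IH; apply/allpairsP/idP => [[[v' w'] /= [_ ww' [_ ->]]] //|ww].
by exists (v, w); split => //=; rewrite mem_enum.
Qed.

Lemma uniq_words n : uniq (words n).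
Proof.
elim: n => //= n IH; rewrite allpairs_uniq ?enum_uniq //.
by move=> [v w] [v' w'] _ _ /= [-> ->].
Qed.

Lemma iidE_words n f : iidE q n f = \sum_(w <- words n) weight w * f w.
Proof.
elim: n f => [|n IH] f /=; first by rewrite big_seq1 /weight big_nil mul1r.
rewrite big_allpairs_dep big_enum /=; apply: eq_bigr => v _.
rewrite IH mulr_sumr; apply: eq_bigr => w _.
by rewrite /weight big_cons mulrA.
Qed.
End Words.

Definition unit_vec k (x : 'I_k * bool) : 'Z^k :=
  if x.2 then - delta_mx ord0 x.1 else delta_mx ord0 x.1.

Lemma signed_unitsE k : @signed_units k = range (@unit_vec k).
Proof.
apply/seteqP; split=> u.
  by case=> i [->|->]; [exists (i, false)|exists (i, true)].
by case=> -[i []] _ <-; exists i; [right|left].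
Qed.

Lemma unit_vecE k (x : 'I_k * bool) (j : 'I_k) :
  unit_vec x ord0 j = (if x.2 then - (j == x.1)%:R else (j == x.1)%:R).
Proof. by rewrite /unit_vec; case: x => i []; rewrite !mxE eqxx. Qed.

Lemma unit_vec_inj k : injective (@unit_vec k).
Proof.
move=> [i b] [j c] e; have := congr1 (fun u : 'Z^k => u ord0 i) e.
rewrite /unit_vec /=; case: b e; case: c => e; rewrite !mxE !eqxx /=;
  by case: eqP => [->|].
Qed.

Lemma unit_vec_neq0 k (x : 'I_k * bool) : unit_vec x != 0.
Proof.
apply/eqP => e; have := congr1 (fun u : 'Z^k => u ord0 x.1) e.
by rewrite unit_vecE !mxE eqxx; case: x.2.
Qed.

Section CutProbability.
Context {R : realType} (k : nat) (q : 'Z^k -> R).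
Let Q := ('I_k * bool)%type.
Let qs (v : Q) := q (unit_vec v).
Local Notation lv := (@unit_vec k).
Hypothesis q_ge0 : forall u, 0 <= q u.
Hypothesis qs_sum1 : \sum_v qs v = 1.

Section Walk.
Context d (T : measurableType d) (P : probability T R) (Y : int -> T -> 'Z^k).
Hypothesis walkY : two_sided_walk q P Y.

Let Ym n u : measurable [set w | Y n w = u]. Proof. by case: walkY. Qed.
Let Yincr (s : seq int) (z : int -> 'Z^k) : uniq s ->
  P [set w | forall n, n \in s -> Y n w - Y (n - 1) w = z n]
  = (\prod_(n <- s) q (z n))%:E.
Proof. by case: walkY => _ _; apply. Qed.

Definition follows (m : int) (w : seq Q) : set T :=
  [set t | forall i, (i < size w)%N ->
     Y (m + i.+1%:Z) t - Y (m + i%:Z) t = nth 0 (map lv w) i].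

Let times (m : int) n : seq int := [seq m + i.+1%:Z | i <- iota 0 n].

Lemma followsE m w : follows m w =
  [set t | forall n : int, n \in times m (size w) ->
     Y n t - Y (n - 1) t = nth 0 (map lv w) (absz (n - m - 1)%R)].
Proof.
have e i : absz (m + i.+1%:Z - m - 1)%R = i by lia.
have e' i : m + i.+1%:Z - 1 = m + i%:Z by lia.
apply/seteqP; split=> t H.
  move=> n /mapP[i]; rewrite mem_iota add0n => /andP[_ iw] ->.
  by rewrite e e' H.
move=> i iw; have := H (m + i.+1%:Z); rewrite e e'; apply.
by apply/mapP; exists i => //; rewrite mem_iota.
Qed.

Lemma follows_prob m w : P (follows m w) = (weight qs w)%:E.
Proof.
rewrite followsE Yincr; last first.
  by rewrite map_inj_uniq ?iota_uniq // => i j; lia.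
rewrite /weight big_map.
have e i : absz (m + i.+1%:Z - m - 1)%R = i by lia.
under eq_bigr => i _ do rewrite e.
rewrite -[in RHS](big_map lv predT q) [in RHS](big_nth 0) size_map.
by rewrite /index_iota subn0.
Qed.

Lemma measurable_follows m w : measurable (follows m w).
Proof.
rewrite followsE.
rewrite (_ : [set t | _] = \bigcap_(n in [set` times m (size w)])
   [set t | Y n t - Y (n - 1) t = nth 0 (map lv w) (absz (n - m - 1)%R)]); last first.
  by apply/seteqP; split=> t.
apply: fin_bigcap_measurable => // n _.
rewrite (_ : [set t | _] = \bigcup_u ([set t | Y (n - 1) t = u] `&`
   [set t | Y n t = u + nth 0 (map lv w) (absz (n - m - 1)%R)])); last first.
  apply/seteqP; split=> t /=.
    by move=> e; exists (Y (n - 1) t) => //; split => //=; rewrite -e addrC subrK.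
  by case=> u _ [/= -> ->]; rewrite addrC addKr.
by apply: countable_bigcupT_measurable => // u; apply: measurableI.
Qed.

Lemma follows_lsum m w t a b : follows m w t -> (a + b <= size w)%N ->
  Y (m + (a + b)%N%:Z) t - Y (m + a%:Z) t = lsum lv (take b (drop a w)).
Proof.
move=> H; elim: b => [|b IH] abw; first by rewrite addn0 subrr take0 /lsum big_nil.
have abw' : (a + b < size w)%N by move: abw; rewrite addnS.
have bd : (b < size (drop a w))%N by rewrite size_drop; lia.
case: w H abw abw' bd IH => // v0 w0; set w := v0 :: w0 => H abw abw' bd IH.
rewrite (take_nth v0) // -cats1 lsum_cat lsum_cons /lsum big_nil addr0 -/(lsum lv _).
rewrite -IH; last exact: ltnW.
rewrite nth_drop -(nth_map v0 0 lv) // -(H (a + b)%N) // addnS.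
by rewrite [RHS]addrC addrA subrK.
Qed.

(** The walk crosses the window of half-length [r] around [n] along a word whose midpoint
    is a cut; stated by excluding the other words of unit steps, so that it contains the
    event that [n] is a cut time without any null set. *)
Definition local_cut_event (r : nat) (n : int) : set T :=
  ~` \bigcup_(w in [set` [seq w <- words (r + r) | ~~ is_cut lv (take r w) (drop r w)]])
       follows (n - r%:Z) w.

Lemma measurable_local_cut_event r n : measurable (local_cut_event r n).
Proof.
apply: measurableC; apply: fin_bigcup_measurable => // w _.
exact: measurable_follows.
Qed.

Lemma cut_sub_local r n : [set t | cut_times (Y ^~ t) n] `<=` local_cut_event r n.
Proof.
move=> t /= ct [w /=]; rewrite mem_filter mem_words => /andP[/negP nc /eqP sw] fw.
apply: nc; apply/is_cutP => i j; rewrite size_takel ?sw ?leq_addr // => ir.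
rewrite size_drop sw addnK => jr; apply/eqP => e.
have := @follows_lsum _ _ _ i (r - i + j)%N fw; rewrite sw => /(_ ltac:(lia)).
have -> : take (r - i + j) (drop i w) = drop i (take r w) ++ take j (drop r w).
  rewrite -[in LHS](cat_take_drop r w) drop_cat size_takel ?sw ?leq_addr // ir.
  by rewrite take_cat size_drop size_takel ?sw ?leq_addr // ltnNge leq_addr /= addKn.
rewrite lsum_cat e => /eqP; rewrite subr_eq0 => /eqP Yij.
have : [set Y i t | i in [set i | (i <= n - 1)%R]]
           `&` [set Y i t | i in [set i | (n <= i)%R]] = set0 := ct.
apply/eqP/set0P; exists (Y (n - r%:Z + i%:Z) t); split.
  by exists (n - r%:Z + i%:Z) => //=; lia.
by exists (n - r%:Z + (i + (r - i + j))%N%:Z) => //=; lia.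
Qed.

Lemma local_cut_event_prob r n :
  P (local_cut_event r n) = (local_cut_prob qs lv r)%:E.
Proof.
rewrite probability_setC; last first.
  by apply: fin_bigcup_measurable => // w _; apply: measurable_follows.
rewrite measure_fin_bigcup; [|exact: finite_seq| |]; last 2 first.
- move=> w w' /=; rewrite !mem_filter !mem_words => /andP[_ /eqP sw] /andP[_ /eqP sw'].
  case=> t [tw tw']; apply: (inj_map (@unit_vec_inj k)).
  apply: (@eq_from_nth _ 0); first by rewrite !size_map sw sw'.
  move=> i; rewrite size_map => iw; rewrite -(tw i) // -(tw' i) // sw'.
  by rewrite -sw.
- by move=> w _; apply: measurable_follows.
rewrite -fsbig_seq ?filter_uniq ?uniq_words //.
rewrite (eq_bigr (fun w => (weight qs w)%:E)); last first.
  by move=> w _; apply: follows_prob.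
rewrite sumEFin -EFinB; congr (_%:E).
rewrite /local_cut_prob iidE_words big_filter.
rewrite -[X in X - _](iidE_cst qs_sum1 (r + r)) iidE_words.
rewrite (bigID (fun w => is_cut lv (take r w) (drop r w))) /=.
under [X in _ + X - _]eq_bigr => w _ do rewrite mulr1.
rewrite addrK [RHS](bigID (fun w => is_cut lv (take r w) (drop r w))) /=.
rewrite [X in _ = _ + X]big1 ?addr0; last by move=> w /negPf ->; rewrite mulr0.
by apply: eq_bigr => w ->.
Qed.
End Walk.

(** Otherwise every fixed time is almost surely not a cut time, as being one implies
    a local cut in windows of any length; then there are almost surely no cut times. *)
Lemma local_cut_prob_ge : has_cut_times q ->
  exists2 p, 0 < p & forall r, p <= local_cut_prob qs lv r.
Proof.
move=> [d [T [P [Y [walkY cutY]]]]]; apply: contrapT => Hp.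
have small p : 0 < p -> exists r, local_cut_prob qs lv r < p.
  move=> p0; apply: contrapT => H; apply: Hp; exists p => // r.
  by rewrite leNgt; apply/negP => rp; apply: H; exists r.
have nul (n : int) : {ae P, forall t, ~ cut_times (Y ^~ t) n}.
  exists (\bigcap_r local_cut_event Y r n); split.
  - by apply: bigcapT_measurable => r; apply: measurable_local_cut_event walkY _ _.
  - apply/eqP; rewrite eq_le measure_ge0 andbT; apply/lee_addgt0Pr => e e0.
    have [r re] := small e e0; rewrite add0e.
    apply: (@le_trans _ _ (P (local_cut_event Y r n))).
      apply: le_measure; rewrite ?inE.
      + by apply: bigcapT_measurable => r'; apply: measurable_local_cut_event walkY _ _.
      + exact: measurable_local_cut_event walkY _ _.
      + by move=> t; apply.
    by rewrite (local_cut_event_prob walkY) lee_fin ltW.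
  - by move=> t /= /contrapT ct r _; exact: (cut_sub_local ct).
have nulpos : {ae P, forall t, forall n : nat, ~ cut_times (Y ^~ t) n%:Z}.
  by apply: ae_foralln => n; apply: nul.
have nulneg : {ae P, forall t, forall n : nat, ~ cut_times (Y ^~ t) (- n%:Z)}.
  by apply: ae_foralln => n; apply: nul.
have : {ae P, forall t, False}.
  move: cutY nulpos nulneg; apply: filterS3 => t [n cn] Hpos Hneg.
  have [n0|n0] := leP 0 n.
    by apply: (Hpos `|n|%N); rewrite gez0_abs.
  by apply: (Hneg `|n|%N); rewrite ltz0_abs // opprK.
move=> [N [mN N0 sN]].
have : P setT = 0%E.
  apply/eqP; rewrite eq_le measure_ge0 andbT -N0 le_measure ?inE //.
  by move=> t _; apply: sN.
by rewrite probability_setT => /eqP; rewrite onee_eq0.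
Qed.

Definition hit_prob n (x : 'Z^k) : R := iidE qs n (fun w => (lsum lv w == x)%:R).

Lemma hit_prob_ge0 n x : 0 <= hit_prob n x.
Proof. by apply: iidE_ge0 => // v; apply: q_ge0. Qed.

Lemma hit_probS n x : hit_prob n.+1 x = \sum_v qs v * hit_prob n (x - lv v).
Proof.
apply: eq_bigr => v _; congr (_ * _); apply: eq_iidE => w _.
by rewrite lsum_cons -(inj_eq (addrI (- lv v))) addKr (addrC (- _)).
Qed.

Lemma sum_le_esum (I : choiceType) (s : seq I) (f : I -> \bar R) :
  uniq s -> (\sum_(i <- s) f i <= \esum_(i in setT) f i)%E.
Proof.
move=> us; apply: esum_ge; exists [set` s]; last by rewrite fsbig_seq.
by split.
Qed.

Lemma hit_prob_le_conv_pow n x :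
  ((hit_prob n x)%:E <= conv_pow (fun y => (q y)%:E) n x)%E.
Proof.
elim: n x => [|n IH] x.
  by rewrite /hit_prob /= /unit_mass /lsum big_nil eq_sym.
rewrite /conv_pow iterS -/(conv_pow _ _) /conv.
have us : uniq [seq lv v | v <- enum {: 'I_k * bool}].
  by rewrite map_inj_uniq ?enum_uniq //; apply: unit_vec_inj.
apply: le_trans _ (sum_le_esum _ us).
rewrite big_map big_enum /= hit_probS -sumEFin; apply: lee_sum => v _.
rewrite EFinM; apply: lee_wpmul2l; first by rewrite lee_fin; apply: q_ge0.
exact: IH.
Qed.

Definition reached n : seq 'Z^k := undup [seq lsum lv w | w <- words n].

Lemma hit_prob_cat a b x (s : seq 'Z^k) : uniq s -> {subset reached a <= s} ->
  hit_prob (a + b) x = \sum_(y <- s) hit_prob a y * hit_prob b (x - y).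
Proof.
move=> us sub; rewrite /hit_prob iidE_cat.
under [RHS]eq_bigr => y _ do rewrite -iidEM.
rewrite -iidE_sum //; apply: eq_iidE => w wa.
have ws : lsum lv w \in s.
  by apply: sub; rewrite mem_undup map_f // mem_words wa.
rewrite (bigD1_seq (lsum lv w)) //= eqxx mul1r big1 ?addr0; last first.
  by move=> y /negPf yw; rewrite eq_sym yw mul0r.
apply: eq_iidE => t _.
by rewrite lsum_cat -(inj_eq (addrI (- lsum lv w))) addKr (addrC (- _)).
Qed.

(** Coefficient of [q^{*n}] in the [i]-fold convolution of the Green function; it is the
    binomial coefficient [n + i - 1] choose [i - 1] for [i > 0]. *)
Fixpoint green_coef i (n : nat) : nat :=
  if i is i'.+1 then \sum_(b < n.+1) green_coef i' b else (n == 0)%N.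

Lemma green_ge n x : ((\sum_(a < n) hit_prob a x)%:E <= green q x)%E.
Proof.
apply: le_trans _ (nneseries_lim_ge n _); last first.
  move=> m _ _; apply: le_trans (hit_prob_le_conv_pow m x).
  by rewrite lee_fin hit_prob_ge0.
rewrite big_mkord -sumEFin; apply: lee_sum => i _.
exact: hit_prob_le_conv_pow.
Qed.

(** Only lower bounds are needed: the convolutions are infinite sums of nonnegative terms,
    and restricting them to the finitely many points reached in less than [n] steps
    leaves finite sums. *)
Lemma green_pow_ge i n x :
  ((\sum_(a < n) (green_coef i a)%:R * hit_prob a x)%:E <= conv_pow (green q) i x)%E.
Proof.
elim: i x => [|i IH] x.
  case: n => [|n]; first by rewrite big_ord0 /= /unit_mass lee_fin.
  rewrite big_ord_recl /= mul1r big1 ?addr0; last by move=> j _; rewrite mul0r.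
  by rewrite /hit_prob /= /unit_mass /lsum big_nil eq_sym.
rewrite /conv_pow iterS -/(conv_pow _ _) /conv.
pose s := undup (flatten [seq reached a | a <- iota 0 n]).
have us : uniq s by apply: undup_uniq.
have sub a : (a < n)%N -> {subset reached a <= s}.
  move=> an y ya; rewrite mem_undup; apply/flattenP; exists (reached a) => //.
  by apply/mapP; exists a => //; rewrite mem_iota.
apply: le_trans _ (sum_le_esum _ us).
apply: (@le_trans _ _ (\sum_(y <- s) ((\sum_(a < n) hit_prob a y) *
   (\sum_(b < n) (green_coef i b)%:R * hit_prob b (x - y)))%:E)); last first.
  apply: lee_sum => y _; rewrite EFinM; apply: lee_pmul.
  - by rewrite lee_fin sumr_ge0 // => a _; apply: hit_prob_ge0.
  - by rewrite lee_fin sumr_ge0 // => a _; rewrite mulr_ge0 ?hit_prob_ge0.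
  - exact: green_ge.
  - exact: IH.
rewrite sumEFin lee_fin.
have -> : \sum_(y <- s) (\sum_(a < n) hit_prob a y) *
     (\sum_(b < n) (green_coef i b)%:R * hit_prob b (x - y)) =
  \sum_(b < n) \sum_(a < n) (green_coef i b)%:R * hit_prob (a + b) x.
  under eq_bigr => y _ do rewrite mulr_suml.
  under eq_bigr => y _ do under eq_bigr => a _ do rewrite mulr_sumr.
  rewrite exchange_big /= [RHS]exchange_big /=; apply: eq_bigr => a _.
  rewrite exchange_big /=; apply: eq_bigr => b _.
  rewrite (@hit_prob_cat a b x s) // ?mulr_sumr; last exact: sub.
  by apply: eq_bigr => y _; rewrite mulrCA.
apply: (@le_trans _ _ (\sum_(b < n) \sum_(c < n | (b <= c)%N) (green_coef i b)%:R * hit_prob c x)).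
  rewrite (exchange_big_dep predT) //=; apply: ler_sum => a _.
  rewrite natr_sum mulr_suml.
  by rewrite (big_ord_widen n (fun b => (green_coef i b)%:R * hit_prob a x)).
apply: ler_sum => b _.
rewrite -(big_mkord (fun c => (b <= c)%N) (fun c => (green_coef i b)%:R * hit_prob c x)).
rewrite -(big_mkord predT (fun a => (green_coef i b)%:R * hit_prob (a + b) x)).
have bn := ltnW (ltn_ord b).
rewrite (big_cat_nat (n := b)) //= big_nat_cond big1 ?add0r; last first.
  by move=> c /andP[/andP[_ cb] bc]; rewrite ltnNge bc in cb.
rewrite -{1}(add0n b) big_addn [leRHS](big_cat_nat (n := n - b)) ?leq_subr //=.
rewrite (eq_bigl predT) => [|c]; last by rewrite leq_addl.
by rewrite lerDl sumr_ge0 // => c _; rewrite mulr_ge0 ?hit_prob_ge0.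
Qed.

Local Arguments green_coef : simpl never.

Lemma green_coef4 n : (n ^ 3 <= 6 * green_coef 4 n)%N.
Proof.
have cS i m : green_coef i.+1 m = (\sum_(b < m.+1) green_coef i b)%N by [].
have c1 m : green_coef 1 m = 1%N by rewrite cS big_ord_recl big1.
have c2 m : green_coef 2 m = m.+1.
  by rewrite cS (eq_bigr (fun=> 1%N)) ?sum1_card ?card_ord.
have c3 m : (2 * green_coef 3 m = m.+1 * m.+2)%N.
  elim: m => [|m IH]; first by rewrite cS big_ord_recl big_ord0 c2.
  by rewrite cS big_ord_recr -cS mulnDr IH c2 /=; lia.
have c4 m : (6 * green_coef 4 m = m.+1 * m.+2 * m.+3)%N.
  elim: m => [|m IH].
    by rewrite cS big_ord_recl big_ord0 /=; have := c3 0%N; lia.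
  rewrite cS big_ord_recr -cS mulnDr IH /=.
  by rewrite -[6%N]/(3 * 2)%N -(mulnA 3 2) c3; lia.
by rewrite c4 !expnS expn0 muln1; nia.
Qed.

(** [l ^ 3 <= 6 * green_coef 4 l], so the third moment of the return times is controlled
    by the fourth convolution power of the Green function at 0. *)
Lemma A3_moments : A3 q ->
  (forall n, \sum_(l < n) return_prob qs lv l <= 2) /\
  exists M3, forall n, \sum_(l < n) l%:R ^+ 3 * return_prob qs lv l <= M3.
Proof.
move=> [G2 /(_ 4%N isT) G4]; split.
  by move=> n; rewrite -lee_fin; apply: le_trans (green_ge n 0) (ltW G2).
have G40 : (conv_pow (green q) 4 0 < +oo)%E.
  by apply: le_lt_trans G4; apply: ereal_sup_ubound; exists 0.
have G40' : (0 <= conv_pow (green q) 4 0)%E.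
  by apply: le_trans (green_pow_ge 4 0 0); rewrite big_ord0.
exists (6 * fine (conv_pow (green q) 4 0)) => n.
have H := green_pow_ge 4 n 0.
rewrite -lee_fin EFinM fineK ?ge0_fin_numE //.
apply: le_trans (lee_wpmul2l _ H); last by rewrite lee_fin.
rewrite -EFinM lee_fin mulr_sumr; apply: ler_sum => l _.
rewrite mulrA -natrM ler_wpM2r ?hit_prob_ge0 //.
by rewrite -natrX ler_nat green_coef4.
Qed.

End CutProbability.

(** * The law of the next step given the earlier departures *)

Definition walk_kernel (R : realFieldType) (Q D : finType) (q : Q -> R)
    (a : seq (Q + D) -> R) (p : seq (Q + D) -> D -> R) (l : seq (Q + D)) (x : Q + D) : R :=
  match x with inl v => a l * q v | inr u => p l u end.

Section Posterior.
Context {R : realFieldType} {Q D : finType}.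
Local Notation step := (Q + D)%type.
Variables (q : Q -> R) (disp : D -> R) (xi : pred D) (gamma delta kappa rho : R).
Hypothesis kappa01 : 0 <= kappa <= 1.

(** The kernel at a site splits into a xi part and another part, which are independent.
    [mT l] stands for the mean of the product of the probabilities, in the other part, of
    the steps of [l], and [A l] for the same mean weighted with the probability of a
    level step. *)
Variables (mT A : seq step -> R).
Hypothesis mT_nil : mT [::] = 1.
Hypothesis mT_ge0 : forall l, 0 <= mT l.
Hypothesis mT_inl : forall l v, mT (rcons l (inl v)) = q v * A l.
Hypothesis A_ge : forall l, delta * mT l <= A l.
Hypothesis mT_sum : forall l,
  A l + \sum_(u | ~~ xi u) mT (rcons l (inr u)) = (1 - gamma) * mT l.

(** [mX b l] stands for the same mean in the xi part when the parameter is [b]: it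
    decomposes according to the type of the site, which is [n1], [n2], or another
    one with contribution [M l], independent of [b]. *)
Variables (n1 n2 : D -> R) (M : seq step -> R) (mX : R -> seq step -> R).
Definition word_prod (n : D -> R) (l : seq step) : R :=
  \prod_(x <- l) (if x is inr u then n u else 0).
Hypotheses (n1_ge0 : forall u, 0 <= n1 u) (n2_ge0 : forall u, 0 <= n2 u).
Hypotheses (n1_supp : forall u, ~~ xi u -> n1 u = 0) (n2_supp : forall u, ~~ xi u -> n2 u = 0).
Hypotheses (n1_sum : \sum_u n1 u = gamma) (n2_sum : \sum_u n2 u = gamma).
Hypothesis n12 : forall u, n1 u * n2 u = 0.
Hypothesis M_nil : M [::] = 1 - kappa.
Hypothesis M_ge0 : forall l, 0 <= M l.
Hypothesis M_sum : forall l, \sum_(u | xi u) M (rcons l (inr u)) = gamma * M l.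
Hypothesis M_supp : forall l u, inr u \in l ->
  [|| n1 u != 0, n2 u != 0 | disp u != 0] -> M l = 0.
Hypothesis mX_nil : forall b, mX b [::] = 1.
Hypothesis mX_E : forall b l, 0 <= b <= 1 -> l != [::] ->
  mX b l = kappa * (1 - b) * word_prod n1 l + kappa * b * word_prod n2 l + M l.
Hypothesis disp_xi : forall u, ~~ xi u -> disp u = 0.
Hypothesis drifts : [/\ \sum_u n1 u * disp u <= 0, 0 <= \sum_u n2 u * disp u &
  \sum_u n2 u * disp u - \sum_u n1 u * disp u = rho].

Local Notation is_xi := (xi_step xi).
Definition xi_part (l : seq step) := [seq x <- l | is_xi x].
Definition other_part (l : seq step) := [seq x <- l | ~~ is_xi x].

(** Conditioning on departures of probability 0 is conditioning on nothing, so that the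
    kernels below are probability kernels for all histories. *)
Definition regular (m : seq step -> R) (l : seq step) := if m l == 0 then [::] else l.

Lemma mT_regular l : mT (regular mT l) != 0.
Proof. by rewrite /regular; case: ifPn => //= _; rewrite mT_nil oner_neq0. Qed.

Definition jump_rate (l : seq step) : R :=
  let t := regular mT (other_part l) in A t / mT t.

(** The first xi step [y] tells the type of the site.  The head of [m] is always of the form
    [inr w]; [u] is a default value in the other case.  In the last
    case, if [M m] is 0 the history has probability 0, and [n1] is an arbitrary choice
    that keeps the mass [gamma]. *)
Definition xi_kernel (b : R) (m : seq step) (u : D) : R :=
  if m is x :: m' then
    let y := if x is inr w then w else u in
    if n1 y != 0 then n1 u else if n2 y != 0 then n2 u else
    if M m == 0 then n1 u else M (rcons m (inr u)) / M m
  else kappa * (1 - b) * n1 u + kappa * b * n2 u + M [:: inr u].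

Definition site_kernel (b : R) (l : seq step) (u : D) : R :=
  if xi u then xi_kernel b (xi_part l) u
  else let t := regular mT (other_part l) in mT (rcons t (inr u)) / mT t.

Lemma jump_rate_ge l : delta <= jump_rate l.
Proof.
rewrite /jump_rate /=; set t := regular _ _.
by rewrite ler_pdivlMr ?A_ge // lt_neqAle eq_sym mT_regular mT_ge0.
Qed.

Lemma xi_part_head l x m : xi_part l = x :: m -> exists2 w, x = inr w & xi w.
Proof.
move=> e; have : x \in xi_part l by rewrite e inE eqxx.
by rewrite mem_filter => /andP[]; case: x {e} => //= w ? _; exists w.
Qed.

Lemma xi_kernel_ge0 b l u : 0 <= b <= 1 -> 0 <= xi_kernel b (xi_part l) u.
Proof.
move=> /andP[b0 b1]; rewrite /xi_kernel; case E: (xi_part l) => [|x m].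
  case/andP: kappa01 => k0 k1.
  by rewrite !addr_ge0 ?M_ge0 // !mulr_ge0 ?n1_ge0 ?n2_ge0 ?subr_ge0.
by do !case: ifP => _ //; rewrite divr_ge0.
Qed.

Lemma xi_kernel_sum b l : \sum_(u | xi u) xi_kernel b (xi_part l) u = gamma.
Proof.
have s1 : \sum_(u | xi u) n1 u = gamma.
  by rewrite -n1_sum [RHS](bigID xi) /= [X in _ + X]big1 ?addr0.
have s2 : \sum_(u | xi u) n2 u = gamma.
  by rewrite -n2_sum [RHS](bigID xi) /= [X in _ + X]big1 ?addr0.
case E: (xi_part l) => [|x m].
  rewrite /= !big_split /= -!mulr_sumr s1 s2.
  by have := M_sum [::]; rewrite /= M_nil => ->; ring.
have [w -> _] := xi_part_head E; rewrite /=.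
case: (eqVneq (n1 w) 0) => //= _; case: (eqVneq (n2 w) 0) => //= _.
case: eqVneq => // M0.
rewrite -mulr_suml; have -> := M_sum (inr w :: m); by rewrite mulfK.
Qed.

(** The drift of [n1] is at most 0 and that of [n2] at least 0, so these drifts and their
    mixtures are bounded by the difference; the other types do not move along e1. *)
Lemma xi_kernel_drift b l : 0 <= b <= 1 ->
  `|\sum_u xi_kernel b (xi_part l) u * disp u| <= rho.
Proof.
move=> /andP[b0 b1]; have [d1 d2 dr] := drifts; case/andP: kappa01 => k0 k1.
have r0 : 0 <= rho by lra.
have n1r : `|\sum_u n1 u * disp u| <= rho by rewrite ler_norml; lra.
have n2r : `|\sum_u n2 u * disp u| <= rho by rewrite ler_norml; lra.
have Mz m u : M (rcons m (inr u)) * disp u = 0.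
  have [->|du] := eqVneq (disp u) 0; first by rewrite mulr0.
  by rewrite (@M_supp _ u) ?mul0r ?mem_rcons ?inE ?eqxx // du !orbT.
case E: (xi_part l) => [|x m].
  rewrite (eq_bigr (fun u => kappa * (1 - b) * (n1 u * disp u) + kappa * b * (n2 u * disp u))).
    rewrite big_split /= -!mulr_sumr.
    move: d1 d2 dr; set D1 := \sum_u _; set D2 := \sum_u _ => d1 d2 dr.
    have c1 : 0 <= kappa * (1 - b) by rewrite mulr_ge0 // subr_ge0.
    have c2 : 0 <= kappa * b by rewrite mulr_ge0.
    have k1' : kappa * (1 - b) <= 1 by nra.
    have k2' : kappa * b <= 1 by nra.
    rewrite ler_norml; apply/andP; split; nra.
  by move=> u _; rewrite /= mulrDl (Mz [::]) addr0; ring.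
have [w -> _] := xi_part_head E; rewrite /=.
case: (eqVneq (n1 w) 0) => //= _; case: (eqVneq (n2 w) 0) => //= _.
case: eqVneq => // M0.
rewrite big1 ?normr0 // => u _.
by rewrite mulrAC (Mz (inr w :: m)) mul0r.
Qed.

Lemma site_kernel_xi_mass b l : \sum_(u | xi u) site_kernel b l u = gamma.
Proof.
rewrite -(xi_kernel_sum b l); apply: eq_bigr => u xu.
by rewrite /site_kernel xu.
Qed.

Lemma site_kernel_local b : 0 <= b <= 1 ->
  local_kernel jump_rate rho disp (site_kernel b).
Proof.
move=> b01; split.
- move=> l u; rewrite /site_kernel; case: ifP => _; first exact: xi_kernel_ge0.
  by rewrite divr_ge0.
- move=> l; rewrite (bigID xi) /= site_kernel_xi_mass.
  rewrite (eq_bigr (fun u => mT (rcons (regular mT (other_part l)) (inr u)) /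
     mT (regular mT (other_part l)))); last first.
    by move=> u /negPf xu; rewrite /site_kernel xu.
  rewrite -mulr_suml addrCA -mulrDl mT_sum mulfK ?mT_regular //.
  by rewrite addrC subrK.
- move=> l; rewrite (eq_bigr (fun u => xi_kernel b (xi_part l) u * disp u)).
    exact: xi_kernel_drift.
  move=> u _; rewrite /site_kernel; case: ifPn => // xu.
  by rewrite disp_xi // !mulr0.
Qed.

Lemma has_xi_part l : has is_xi l = (xi_part l != [::]).
Proof. by rewrite has_filter. Qed.

(** The parameter acts only through the prior weights of the two types, hence only as long
    as no xi step has revealed the type. *)
Lemma site_kernel_diff b b' l u :
  site_kernel b' l u - site_kernel b l u =
  (~~ has is_xi l)%:R * (kappa * (b' - b)) * (n2 u - n1 u).
Proof.
rewrite has_xi_part negbK /site_kernel; case: ifPn => xu; last first.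
  by rewrite n1_supp // n2_supp // !subrr mulr0.
case E: (xi_part l) => [|x m] /=; first by ring.
by rewrite subrr !mul0r.
Qed.

(** Annealed probability of the departures [l] from a single site. *)
Definition path_weight b l : R := mX b (xi_part l) * mT (other_part l).

Let mT0_rcons l : mT l = 0 -> A l = 0 /\ forall u, ~~ xi u -> mT (rcons l (inr u)) = 0.
Proof.
move=> l0; have := mT_sum l; rewrite l0 mulr0.
have Al : 0 <= A l by have := A_ge l; rewrite l0 mulr0.
have sl : 0 <= \sum_(u | ~~ xi u) mT (rcons l (inr u)) by apply: sumr_ge0.
move=> e; split; first by lra.
have /eqP : \sum_(u | ~~ xi u) mT (rcons l (inr u)) = 0 by lra.
rewrite psumr_eq0 // => /allP H u xu; apply/eqP.
by have := H u (mem_index_enum _); rewrite xu.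
Qed.

Let M0_rcons l u : M l = 0 -> xi u -> M (rcons l (inr u)) = 0.
Proof.
move=> l0 xu; have := M_sum l; rewrite l0 mulr0 => /eqP.
rewrite psumr_eq0 // => /allP H; apply/eqP.
by have := H u (mem_index_enum _); rewrite xu.
Qed.

Lemma word_prod_rcons n l u : word_prod n (rcons l (inr u)) = word_prod n l * n u.
Proof. by rewrite /word_prod big_rcons. Qed.

Lemma word_prod_cons n l u : word_prod n (inr u :: l) = n u * word_prod n l.
Proof. by rewrite /word_prod big_cons. Qed.

Lemma mX_rcons b l u : 0 <= b <= 1 -> xi u ->
  mX b (rcons (xi_part l) (inr u)) = mX b (xi_part l) * xi_kernel b (xi_part l) u.
Proof.
move=> b01 xu; case E: (xi_part l) => [|x m].
  by rewrite mX_nil mul1r mX_E // /word_prod !big_seq1.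
have [w -> _] := xi_part_head E; rewrite !mX_E // word_prod_rcons word_prod_rcons.
rewrite /xi_kernel; set m' := inr w :: m.
have wm : inr w \in m' by rewrite inE eqxx.
have wmu : inr w \in rcons m' (inr u) by rewrite mem_rcons inE wm orbT.
case: (eqVneq (n1 w) 0) => [n10|n10] /=; last first.
  have n20 : n2 w = 0 by apply/eqP; have := n12 w => /eqP; rewrite mulf_eq0 (negPf n10).
  rewrite (M_supp wm) ?n10 // (M_supp wmu) ?n10 //.
  by rewrite [word_prod n2 m']word_prod_cons n20; ring.
case: (eqVneq (n2 w) 0) => [n20|n20] /=; last first.
  rewrite (M_supp wm) ?n20 ?orbT // (M_supp wmu) ?n20 ?orbT //.
  by rewrite [word_prod n1 m']word_prod_cons n10; ring.
rewrite ![word_prod _ m']word_prod_cons n10 n20 !mul0r !mulr0 !add0r.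
case: eqVneq => [M0|M0]; first by rewrite M0 mul0r; apply: (@M0_rcons m').
by rewrite mulrCA mulfV // mulr1.
Qed.

(** The chain rule: the kernels are the conditional probabilities of the next departure. *)
Lemma path_weight_rcons b l x : 0 <= b <= 1 ->
  path_weight b (rcons l x) =
  path_weight b l * walk_kernel q jump_rate (site_kernel b) l x.
Proof.
move=> b01; rewrite /path_weight /xi_part /other_part !filter_rcons.
have cancelT c (F : seq step -> R) : (mT (other_part l) = 0 -> c = 0) ->
    c = F (other_part l) ->
    c = mT (other_part l) * (F (regular mT (other_part l)) / mT (regular mT (other_part l))).
  move=> c0 cF; rewrite /regular; case: eqVneq => [e|e]; first by rewrite e mul0r c0.
  by rewrite mulrCA mulfV // mulr1.
case: x => [v|u] /=.
  rewrite -mulrA; congr (_ * _); rewrite /jump_rate /= mulrA.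
  rewrite mT_inl [LHS]mulrC; congr (_ * _).
  by apply: cancelT => // /mT0_rcons[].
rewrite /site_kernel; case: ifPn => xu /=.
  by rewrite mX_rcons // mulrAC.
rewrite -mulrA; congr (_ * _).
by apply: (cancelT _ (fun t => mT (rcons t (inr u)))) => // /mT0_rcons[_]; apply.
Qed.
End Posterior.

(** * Unit steps and their projections *)

Lemma coordinate_unit k (x : 'I_k * bool) i :
  coordinate (unit_vec x) i = if x.2 then - (i == x.1 :> nat)%:R else (i == x.1 :> nat)%:R.
Proof.
rewrite /coordinate; case: insubP => [j _ <-|ik]; first exact: unit_vecE.
have -> : (i == x.1 :> nat) = false by apply/negbTE/eqP => e; rewrite e ltn_ord in ik.
by case: x.2; rewrite ?oppr0.
Qed.

Lemma kernel_le_mass {R : realType} (k : nat) (c : R) (f : 'Z^k -> R) u :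
  kernels_of_mass c f -> f u <= c.
Proof.
move=> [_ fc]; rewrite -lee_fin -fc.
by have := @sum_le_esum R _ [:: u] (fun u => (f u)%:E) isT; rewrite big_seq1.
Qed.

Lemma kernel_mass_sum {R : realType} (k : nat) (c : R) (f : 'Z^k -> R)
    (I : finType) (P : pred I) (h : I -> 'Z^k) :
  {in P &, injective h} -> (forall u, signed_units u -> exists2 x, P x & h x = u) ->
  kernels_of_mass c f -> supp f `<=` @signed_units k ->
  \sum_(x | P x) f (h x) = c.
Proof.
move=> hi hs [f0 fc] fs; apply: EFin_inj; rewrite -fc.
pose s := [seq h x | x <- enum P].
have us : uniq s.
  rewrite map_inj_in_uniq ?enum_uniq // => x y; rewrite !mem_enum => xP yP.
  exact: hi.
rewrite -sumEFin -big_enum /= -(big_map h predT (fun u => (f u)%:E)) -/s fsbig_seq //.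
rewrite -esum_fset; [|exact: finite_seq|by move=> u _; rewrite lee_fin].
rewrite [LHS]esum_mkcond; apply: eq_esum => u _.
case: ifPn => //; rewrite notin_setE => nu.
suff -> : f u = 0 by [].
apply: contrapT => /eqP fu; apply: nu; have [x Px <-] := hs _ (fs _ fu).
by rewrite /= map_f // mem_enum.
Qed.

Lemma kernel_units_sum {R : realType} (k : nat) (c : R) (f : 'Z^k -> R) :
  kernels_of_mass c f -> supp f `<=` @signed_units k ->
  \sum_x f (unit_vec x) = c.
Proof.
move=> fc fs; apply: (kernel_mass_sum (P := predT) (h := @unit_vec k)) => //.
  by move=> x y _ _; apply: unit_vec_inj.
by move=> u; rewrite signed_unitsE => -[x _ <-]; exists x.
Qed.

Section Steps.
Variables (d0 d1 ds : nat).
Hypothesis ds_bounds : (1 <= ds <= d0)%N.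
Local Notation d := (d0 + d1)%N.
Local Notation Q := ('I_d1 * bool)%type.
Local Notation D := ('I_d0 * bool)%type.
Local Notation step := (Q + D)%type.

(** The last [d1] coordinates carry the level steps [inl], the first [d0] the others. *)
Definition step_index (x : step) : 'I_d * bool :=
  match x with inl v => (rshift d0 v.1, v.2) | inr u => (lshift d1 u.1, u.2) end.

Definition step_vec (x : step) : 'Z^d := unit_vec (step_index x).
Definition step_head (x : step) : 'Z^ds := head_coords ds (step_vec x).
Definition step_tail (x : step) : 'Z^(d - ds) := tail_coords ds (d - ds) (step_vec x).
Definition xi_dir : pred D := fun u => (u.1 < ds)%N.

Lemma step_index_surj y : exists x, step_index x = y.
Proof.
case: y => i b; case: (splitP i) => j e.
  by exists (inr (j, b)); congr (_, _); apply: val_inj.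
by exists (inl (j, b)); congr (_, _); apply: val_inj.
Qed.

Lemma step_index_inj : injective step_index.
Proof.
move=> [[i b]|[i b]] [[j c]|[j c]] /= [] e.
- by rewrite (val_inj (addnI e)) => ->.
- by have := ltn_ord j; rewrite -e ltnNge leq_addr.
- by have := ltn_ord i; rewrite e ltnNge leq_addr.
- by rewrite (val_inj e) => ->.
Qed.

Lemma step_vec_inj : injective step_vec.
Proof. by move=> x y /unit_vec_inj/step_index_inj. Qed.

Lemma step_vec_surj u : signed_units u -> exists x, step_vec x = u.
Proof.
rewrite signed_unitsE => -[y _ <-]; have [x <-] := step_index_surj y.
by exists x.
Qed.

Lemma xi_stepE x : xi_step xi_dir x = ((step_index x).1 < ds)%N.
Proof.
case: x => [[j b]|[j b]] //=; case/andP: ds_bounds => _ dsd0.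
by apply/esym/negbTE; rewrite -leqNgt (leq_trans dsd0) ?leq_addr.
Qed.

Lemma step_headE x i : step_head x ord0 i =
  (if (step_index x).2 then - (i == (step_index x).1 :> nat)%:R
   else (i == (step_index x).1 :> nat)%:R).
Proof. by rewrite !mxE coordinate_unit. Qed.

Lemma step_tailE x i : step_tail x ord0 i =
  (if (step_index x).2 then - ((ds + i)%N == (step_index x).1 :> nat)%:R
   else ((ds + i)%N == (step_index x).1 :> nat)%:R).
Proof. by rewrite !mxE coordinate_unit. Qed.

Lemma step_head_xi x (xd : ((step_index x).1 < ds)%N) :
  step_head x = unit_vec (Ordinal xd, (step_index x).2).
Proof. by apply/rowP => i; rewrite step_headE unit_vecE. Qed.

Lemma step_head0 x : ~~ xi_step xi_dir x -> step_head x = 0.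
Proof.
rewrite xi_stepE -leqNgt => xd; apply/rowP => i; rewrite step_headE mxE.
have -> : (i == (step_index x).1 :> nat) = false.
  by apply/negbTE; rewrite neq_ltn (leq_trans (ltn_ord i) xd).
by case: ifP; rewrite ?oppr0.
Qed.

Lemma step_tail0 x : xi_step xi_dir x -> step_tail x = 0.
Proof.
rewrite xi_stepE => xd; apply/rowP => i; rewrite step_tailE mxE.
have -> : ((ds + i)%N == (step_index x).1 :> nat) = false.
  by apply/negbTE; rewrite neq_ltn orbC (leq_trans xd) ?leq_addr.
by case: ifP; rewrite ?oppr0.
Qed.

Lemma step_tail_lt x : ~~ xi_step xi_dir x -> ((step_index x).1 - ds < d - ds)%N.
Proof. by rewrite xi_stepE -leqNgt => xd; have := ltn_ord (step_index x).1; lia. Qed.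

Lemma step_tail_other x (xd : ~~ xi_step xi_dir x) :
  step_tail x = unit_vec (Ordinal (step_tail_lt xd), (step_index x).2).
Proof.
apply/rowP => i; rewrite step_tailE unit_vecE /=.
have -> // : ((ds + i)%N == (step_index x).1 :> nat) = (i == Ordinal (step_tail_lt xd)).
rewrite -val_eqE /=; move: xd; rewrite xi_stepE -leqNgt => xd.
by apply/eqP/eqP => e; lia.
Qed.

Lemma step_head_neq0 x : xi_step xi_dir x -> step_head x != 0.
Proof. by rewrite xi_stepE => xd; rewrite step_head_xi unit_vec_neq0. Qed.

Lemma step_tail_neq0 x : ~~ xi_step xi_dir x -> step_tail x != 0.
Proof. by move=> xd; rewrite (step_tail_other xd) unit_vec_neq0. Qed.

Lemma step_head_inj : {in xi_step xi_dir &, injective step_head}.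
Proof.
move=> x y; rewrite -!topredE /= => xd yd; move: (xd) (yd); rewrite !xi_stepE => xd' yd'.
rewrite !step_head_xi => /unit_vec_inj [e1 e2]; apply: step_index_inj.
by rewrite [LHS]surjective_pairing [RHS]surjective_pairing e2; congr (_, _); apply: val_inj.
Qed.

Lemma step_tail_inj : {in (fun x => ~~ xi_step xi_dir x) &, injective step_tail}.
Proof.
move=> x y; rewrite -!topredE /= => xd yd.
rewrite (step_tail_other xd) (step_tail_other yd) => /unit_vec_inj [e1 e2].
apply: step_index_inj.
rewrite [LHS]surjective_pairing [RHS]surjective_pairing e2; congr (_, _); apply: val_inj => /=.
by move: xd yd; rewrite !xi_stepE -!leqNgt; lia.
Qed.

Lemma step_head_surj u : signed_units u -> exists2 x, xi_step xi_dir x & step_head x = u.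
Proof.
rewrite signed_unitsE => -[[i b] _ <-]; case/andP: ds_bounds => _ dsd0.
have id0 : (i < d0)%N := leq_trans (ltn_ord i) dsd0.
exists (inr (Ordinal id0, b)); first by rewrite /= /xi_dir /=.
have xd : ((step_index (inr (Ordinal id0, b) : step)).1 < ds)%N := ltn_ord i.
rewrite (step_head_xi xd); have -> : Ordinal xd = i by apply: val_inj.
by [].
Qed.

Lemma step_tail_surj u : signed_units u ->
  exists2 x, ~~ xi_step xi_dir x & step_tail x = u.
Proof.
rewrite signed_unitsE => -[[i b] _ <-].
have id : (ds + i < d)%N by have := ltn_ord i; lia.
have [x ex] := step_index_surj (Ordinal id, b).
have xd : ~~ xi_step xi_dir x by rewrite xi_stepE ex /= -leqNgt leq_addr.
exists x => //; rewrite (step_tail_other xd); congr unit_vec.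
have -> : Ordinal (step_tail_lt xd) = i by apply: val_inj; rewrite /= ex /= addKn.
by rewrite ex.
Qed.

Lemma rsubmx_step x : rsubmx (step_vec x) =
  (if x is inl v then unit_vec v else 0) :> 'Z^d1.
Proof.
apply/rowP => j; rewrite mxE unit_vecE; case: x => [v|u] /=.
  rewrite unit_vecE; have -> // : (rshift d0 j == rshift d0 v.1) = (j == v.1).
  by rewrite eq_rshift.
by rewrite eq_rlshift mxE; case: ifP; rewrite ?oppr0.
Qed.

Lemma level_of_displacement (H : seq step) :
  lsum (@unit_vec d1) (level_word H) = rsubmx (displacement step_vec H).
Proof.
elim: H => [|x H IH]; first by rewrite /lsum /displacement !big_nil raddf0.
rewrite /displacement big_cons raddfD /= rsubmx_step -/(displacement _ _) -IH.
rewrite -cat1s level_word_cat lsum_cat; congr (_ + _).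
by case: x => [v|u]; rewrite /level_word /= /lsum ?big_seq1 ?big_nil.
Qed.

Lemma level_vec H : displacement step_vec H = 0 ->
  lsum (@unit_vec d1) (level_word H) = 0.
Proof. by rewrite level_of_displacement => ->; rewrite raddf0. Qed.

Definition disp {R : realType} (u : D) : R :=
  if (u.1 == 0 :> nat)%N then (if u.2 then -1 else 1) else 0.

Lemma disp_xi {R : realType} u : ~~ xi_dir u -> disp u = 0 :> R.
Proof.
rewrite /xi_dir /disp; case: eqP => // ->.
by case/andP: ds_bounds => ->.
Qed.

Lemma step_head_e1 {R : realType} u : disp u != 0 :> R ->
  step_head (inr u) = (if u.2 then - e1 ds else e1 ds).
Proof.
rewrite /disp; case: (eqVneq (u.1 : nat) 0%N) => [u0 _|_ /eqP //].
by apply/rowP => i; rewrite step_headE /= u0; case: u.2; rewrite !mxE.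
Qed.

Lemma sum_disp {R : realType} (n : 'Z^ds -> R) :
  \sum_u (if xi_dir u then n (step_head (inr u)) else 0) * disp u = n (e1 ds) - n (- e1 ds).
Proof.
case/andP: (ds_bounds) => ds1 dsd0.
have d00 : (0 < d0)%N by apply: leq_trans ds1 dsd0.
pose o : 'I_d0 := Ordinal d00.
rewrite (bigD1 (o, false)) //= (bigD1 (o, true)) //= big1 ?addr0; last first.
  move=> [i b] /= /andP[H1 H2]; rewrite /disp /=; case: eqP => [i0|_]; last by rewrite mulr0.
  have io : i = o by apply: val_inj.
  by move: H1 H2; rewrite io; case: b; rewrite eqxx.
rewrite /xi_dir /= ds1 /disp /= mulr1 mulrN1.
have /= -> := @step_head_e1 R (o, false) _; last by rewrite /disp /= oner_neq0.
by have /= -> := @step_head_e1 R (o, true) _; last by rewrite /disp /= oppr_eq0 oner_neq0.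
Qed.

Lemma coordinate_step {R : realType} x :
  (coordinate (step_vec x) 0)%:~R = (if x is inr u then disp u else 0) :> R.
Proof.
rewrite coordinate_unit; case: x => [v|u] /=.
  have -> : (0 == d0 + v.1)%N = false.
    by case/andP: ds_bounds => a b; apply/negbTE/eqP; lia.
  by case: ifP; rewrite ?oppr0.
by rewrite /disp eq_sym; case: eqP => _; case: u.2.
Qed.

Lemma glue_step {R : realType} (xi : 'Z^ds -> R) (txi : 'Z^(d - ds) -> R) x :
  Defs.glue xi txi (step_vec x) =
  if xi_step xi_dir x then xi (step_head x) else txi (step_tail x).
Proof.
rewrite /Defs.glue /kprod /unit_mass -/(step_head x) -/(step_tail x).
case: ifPn => xd.
  by rewrite step_tail0 // eqxx (negPf (step_head_neq0 xd)) mulr1 mul0r addr0.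
by rewrite step_head0 // eqxx (negPf (step_tail_neq0 xd)) mul1r mulr0 add0r.
Qed.
End Steps.

(** * Moments of the environment at one site *)

(** Kernels take values in the unit interval only almost surely; truncating makes the
    moments below means of bounded functions without changing them. *)
Definition clamp {R : realType} (r : R) : R := Num.min `|r| 1.

Lemma clamp01 {R : realType} (r : R) : 0 <= clamp r <= 1.
Proof. by rewrite /clamp le_min ge_min normr_ge0 ler01 lexx orbT. Qed.

Lemma clampE {R : realType} (r : R) : 0 <= r -> r <= 1 -> clamp r = r.
Proof. by move=> r0 r1; rewrite /clamp ger0_norm // min_l. Qed.

Lemma clamp0 {R : realType} : clamp (0 : R) = 0.
Proof. by rewrite clampE. Qed.

Section KernelSpace.
Context {R : realType} (k : nat).
Local Notation K := (kernel_space R k).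

Lemma measurable_eval (u : 'Z^k) : measurable_fun setT (fun w : K => w u : R).
Proof.
move=> _ B mB; rewrite setTI; apply: sub_sigma_algebra.
by exists u, B.
Qed.

Lemma unit_valued_clamp d (T : measurableType d) (f : T -> R) :
  measurable_fun setT f -> unit_valued (fun x => clamp (f x)).
Proof.
move=> mf; split; last by move=> x; apply: clamp01.
apply: measurable_minr => //.
by apply: (@measurableT_comp _ _ _ _ _ _ (@Num.norm R R)).
Qed.

Lemma unit_valued_eval (u : 'Z^k) : unit_valued (fun w : K => clamp (w u)).
Proof. by apply: unit_valued_clamp; apply: measurable_eval. Qed.

Lemma bigcap_points_measurable (F : 'Z^k -> set K) :
  (forall u, measurable (F u)) -> measurable (\bigcap_u F u).
Proof.
move=> mF; rewrite -[X in measurable X]setCK; apply: measurableC.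
rewrite setC_bigcap; apply: countable_bigcupT_measurable => // u.
exact: measurableC.
Qed.

Lemma measurable_eval_eq (u : 'Z^k) (c : R) : measurable [set w : K | w u = c].
Proof.
have := measurable_eval u measurableT (measurable_set1 c).
by rewrite setTI.
Qed.

Lemma measurable_kernel1 (f : K) : measurable [set f].
Proof.
rewrite (_ : [set f] = \bigcap_u [set w : K | w u = f u]).
  by apply: bigcap_points_measurable => u; apply: measurable_eval_eq.
apply/seteqP; split=> w /=; first by move=> ->.
by move=> H; apply/funext => u; apply: H.
Qed.

Lemma measurable_vanish (F : set 'Z^k) :
  measurable [set w : K | supp w `&` F = set0].
Proof.
rewrite (_ : [set w | _] = \bigcap_u (if `[< F u >] then [set w : K | w u = 0] else setT)).
  by apply: bigcap_points_measurable => u; case: ifP => _ //; apply: measurable_eval_eq.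
apply/seteqP; split=> w /=.
  move=> H u _; case: ifPn => // /asboolP Fu /=; apply: contrapT => /eqP wu.
  by have : (supp w `&` F) u by []; rewrite H.
move=> H; apply/seteqP; split => // u [wu Fu].
have := H u I; case: ifPn => [_ /= e|/asboolP //].
by move: wu; rewrite /supp /= e eqxx.
Qed.
End KernelSpace.

Lemma mean_ae_eq {R : realType} d (T : measurableType d) (mu : probability T R)
    (f g : T -> R) (c : R) : unit_valued f -> unit_valued g -> 0 <= c ->
  {ae mu, forall x, f x = c * g x} -> mean mu f = c * mean mu g.
Proof.
move=> uf ug c0 fg; have := @mean_sum_ae R d T mu _ [:: tt] (fun=> f) c g.
rewrite big_seq1 => ->//.
by apply: filterS fg => x; rewrite big_seq1.
Qed.

Lemma le_mean_ae {R : realType} d (T : measurableType d) (mu : probability T R)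
    (f g : T -> R) (c : R) : unit_valued f -> unit_valued g -> 0 <= c ->
  {ae mu, forall x, c * f x <= g x} -> c * mean mu f <= mean mu g.
Proof.
move=> uf ug c0 fg; rewrite -lee_fin EFinM !meanE //.
have [mf f01] := uf; have [mg g01] := ug.
rewrite -ge0_integralZl //; last 2 first.
- exact/measurable_EFinP.
- by move=> x _; rewrite lee_fin; case/andP: (f01 x).
apply: ae_ge0_le_integral => //.
- by move=> x _; rewrite mule_ge0 ?lee_fin //; case/andP: (f01 x).
- by apply: emeasurable_funM => //; apply/measurable_EFinP.
- by move=> x _; rewrite lee_fin; case/andP: (g01 x).
- exact/measurable_EFinP.
by apply: filterS fg => x H _; rewrite -EFinM lee_fin.
Qed.

Lemma aeS {R : realType} d (T : measurableType d) (mu : probability T R)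
    (A B : T -> Prop) : (forall x, A x -> B x) ->
  {ae mu, forall x, A x} -> {ae mu, forall x, B x}.
Proof. by move=> AB; apply: filterS. Qed.

Lemma aeS2 {R : realType} d (T : measurableType d) (mu : probability T R)
    (A B C : T -> Prop) : (forall x, A x -> B x -> C x) ->
  {ae mu, forall x, A x} -> {ae mu, forall x, B x} -> {ae mu, forall x, C x}.
Proof. by move=> AB; apply: filterS2. Qed.

Lemma aeS3 {R : realType} d (T : measurableType d) (mu : probability T R)
    (A B C E : T -> Prop) : (forall x, A x -> B x -> C x -> E x) ->
  {ae mu, forall x, A x} -> {ae mu, forall x, B x} -> {ae mu, forall x, C x} ->
  {ae mu, forall x, E x}.
Proof. by move=> AB; apply: filterS3. Qed.

Lemma ae_exists {R : realType} d (T : measurableType d) (mu : probability T R)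
    (A : T -> Prop) : {ae mu, forall x, A x} -> exists x, A x.
Proof.
move=> H; apply: contrapT => nA.
have [N [mN N0 sN]] : {ae mu, forall x, False}.
  by apply: filterS H => x Ax; apply: nA; exists x.
have : mu setT = 0%E.
  apply/eqP; rewrite eq_le measure_ge0 andbT -N0 le_measure ?inE //.
  by move=> t _; apply: sN.
by rewrite probability_setT => /eqP; rewrite onee_eq0.
Qed.

Section Moments.
Context {R : realType} (d0 d1 ds : nat).
Hypothesis ds_bounds : (1 <= ds <= d0)%N.
Local Notation d := (d0 + d1)%N.
Local Notation Q := ('I_d1 * bool)%type.
Local Notation D := ('I_d0 * bool)%type.
Local Notation step := (Q + D)%type.
Local Notation xi_dir := (@xi_dir d0 ds).
Local Notation is_xi := (xi_step xi_dir).
Local Notation head := (@step_head d0 d1 ds).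
Local Notation tail := (@step_tail d0 d1 ds).
Local Notation vec := (@step_vec d0 d1).

(** Probability that independent steps drawn at one site with fixed kernel follow [l]; the
    three versions are for the xi part, the other part and the whole kernel. *)
Definition head_prod (l : seq step) (xi : kernel_space R ds) : R :=
  \prod_(x <- l) clamp (xi (head x)).
Definition tail_prod (l : seq step) (txi : kernel_space R (d - ds)) : R :=
  \prod_(x <- l) clamp (txi (tail x)).
Definition site_prod (l : seq step) (w : kernel_space R d) : R :=
  \prod_(x <- l) clamp (w (vec x)).

Lemma unit_valued_head_prod l : unit_valued (head_prod l).
Proof. by apply: unit_valued_prod => x; apply: unit_valued_eval. Qed.
Lemma unit_valued_tail_prod l : unit_valued (tail_prod l).
Proof. by apply: unit_valued_prod => x; apply: unit_valued_eval. Qed.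
Lemma unit_valued_site_prod l : unit_valued (site_prod l).
Proof. by apply: unit_valued_prod => x; apply: unit_valued_eval. Qed.

Lemma head_prod_rcons l x xi : head_prod (rcons l x) xi = head_prod l xi * clamp (xi (head x)).
Proof. by rewrite /head_prod big_rcons. Qed.
Lemma tail_prod_rcons l x xi : tail_prod (rcons l x) xi = tail_prod l xi * clamp (xi (tail x)).
Proof. by rewrite /tail_prod big_rcons. Qed.

Lemma glue_prod l xi txi :
  site_prod l (Defs.glue xi txi) =
  head_prod (xi_part xi_dir l) xi * tail_prod (other_part xi_dir l) txi.
Proof.
rewrite /site_prod /head_prod /tail_prod /xi_part /other_part !big_filter.
rewrite (bigID is_xi) /=; congr (_ * _); apply: eq_bigr => x xd;
  by rewrite glue_step // ?xd ?(negPf xd).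
Qed.

Lemma measurable_glue : measurable_fun setT
  (fun x : kernel_space R ds * kernel_space R (d - ds) =>
     Defs.glue x.1 x.2 : kernel_space R d).
Proof.
apply: (@measurability _ _ _ _ setT _ (@evaluation_events R d : set (set (kernel_space R d)))) => [|_ [_ [u [B [mB ->]] <-]]]; first by [].
rewrite setTI.
have mf : measurable_fun setT (fun x : kernel_space R ds * kernel_space R (d - ds) =>
     Defs.glue x.1 x.2 u : R).
  rewrite /Defs.glue /kprod; apply: measurable_funD; apply: measurable_funM => //.
    exact: (measurableT_comp (measurable_eval _) measurable_fst).
  exact: (measurableT_comp (measurable_eval _) measurable_snd).
by have := mf measurableT _ mB; rewrite setTI.
Qed.

Section Laws.
Variables (gamma : R) (mu : probability (kernel_space R d) R)
  (mus : probability (kernel_space R ds) R)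
  (mut : probability (kernel_space R (d - ds)) R).
Hypothesis HA1 : A1 gamma mu mus mut.

(** Each step of [l] is charged by exactly one of the two independent parts. *)
Lemma mean_site_prod l :
  mean mu (site_prod l) =
  mean mus (head_prod (xi_part xi_dir l)) * mean mut (tail_prod (other_part xi_dir l)).
Proof.
have [_ _ muE] := HA1.
have um := unit_valued_site_prod l.
have uh := unit_valued_head_prod (xi_part xi_dir l).
have ut := unit_valued_tail_prod (other_part xi_dir l).
apply: EFin_inj; rewrite EFinM !meanE //.
have mg := measurable_glue.
transitivity (\int[pushforward (mus \x mut)%E (fun x => Defs.glue x.1 x.2 : kernel_space R d)]_w
    (site_prod l w)%:E)%E.
  by apply: eq_measure_integral => A mA _; apply: muE.
rewrite ge0_integral_pushforward //; last 2 first.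
- by apply/measurable_EFinP; case: um.
- by move=> w _; rewrite lee_fin; case: um => _ /(_ w)/andP[].
rewrite preimage_setT.
have mh : measurable_fun setT (fun x : kernel_space R ds * kernel_space R (d - ds) =>
     ((head_prod (xi_part xi_dir l) x.1)%:E * (tail_prod (other_part xi_dir l) x.2)%:E)%E).
  apply: emeasurable_funM; apply/measurable_EFinP.
    by case: uh => mh _; apply: (measurableT_comp mh measurable_fst).
  by case: ut => mt _; apply: (measurableT_comp mt measurable_snd).
transitivity (\int[(mus \x mut)%E]_x
   ((head_prod (xi_part xi_dir l) x.1)%:E * (tail_prod (other_part xi_dir l) x.2)%:E))%E.
  by apply: eq_integral => x _; rewrite /= glue_prod EFinM.
have h0 x : (0 <= (head_prod (xi_part xi_dir l) x)%:E)%E.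
  by rewrite lee_fin; case: uh => _ /(_ x)/andP[].
have t0 x : (0 <= (tail_prod (other_part xi_dir l) x)%:E)%E.
  by rewrite lee_fin; case: ut => _ /(_ x)/andP[].
rewrite fubini_tonelli1 //; last by move=> x; apply: mule_ge0.
rewrite /fubini_F /=.
under eq_integral => x _.
  rewrite ge0_integralZl //; last by apply/measurable_EFinP; case: ut.
  over.
rewrite ge0_integralZr //; first by apply/measurable_EFinP; case: uh.
exact: integral_ge0.
Qed.

Hypothesis gamma01 : 0 < gamma <= 1.

Lemma head_ae : {ae mus, forall xi : kernel_space R ds,
  (forall u, 0 <= xi u <= 1) /\ \sum_(u | xi_dir u) xi (head (inr u)) = gamma}.
Proof.
have [H _ _] := HA1; apply: (aeS _ H) => xi [xik xis]; split.
  move=> u; have [xi0 _] := xik; rewrite xi0 /=.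
  by case/andP: gamma01 => _; apply: le_trans; apply: kernel_le_mass.
apply: kernel_mass_sum xik xis.
  by move=> u v uP vP /(step_head_inj ds_bounds) e; case: (e uP vP).
move=> u /(step_head_surj d1 ds_bounds)[[//|w] wP <-]; by exists w.
Qed.

Lemma tail_ae : {ae mut, forall txi : kernel_space R (d - ds),
  (forall u, 0 <= txi u <= 1) /\
  \sum_v txi (tail (inl v)) + \sum_(u | ~~ xi_dir u) txi (tail (inr u)) = 1 - gamma}.
Proof.
have [_ H _] := HA1; apply: (aeS _ H) => txi [xik xis]; split.
  move=> u; have [xi0 _] := xik; rewrite xi0 /=.
  apply: (@le_trans _ _ (1 - gamma)); last by rewrite gerBl ltW //; case/andP: gamma01.
  exact: kernel_le_mass.
rewrite -(big_sumType _ (fun x : step => ~~ is_xi x) (fun x => txi (tail x))) /=.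
apply: kernel_mass_sum xik xis; first exact: step_tail_inj.
by move=> u /(step_tail_surj ds_bounds)[x xP <-]; exists x.
Qed.

Definition head_moment l := mean mus (head_prod l).
Definition tail_moment l := mean mut (tail_prod l).
Definition jump_moment l := mean mut (fun txi =>
  tail_prod l txi * clamp (\sum_v clamp (txi (tail (inl v))))).

Lemma unit_valued_jump l : unit_valued (fun txi =>
  tail_prod l txi * clamp (\sum_v clamp (txi (tail (inl v))))).
Proof.
apply: unit_valuedM; first exact: unit_valued_tail_prod.
apply: unit_valued_clamp; apply: measurable_sum => v.
exact: (unit_valued_eval (tail (inl v))).1.
Qed.

Lemma head_moment_nil : head_moment [::] = 1.
Proof.
rewrite /head_moment -(mean1 mus); congr mean.
by apply/funext => xi; rewrite /head_prod big_nil.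
Qed.

Lemma tail_moment_nil : tail_moment [::] = 1.
Proof.
rewrite /tail_moment -(mean1 mut); congr mean.
by apply/funext => xi; rewrite /tail_prod big_nil.
Qed.

Lemma tail_moment_ge0 l : 0 <= tail_moment l.
Proof. by apply: mean_ge0 => x; case: (unit_valued_tail_prod l) => _ /(_ x)/andP[]. Qed.

Lemma tail_moment_sum l : jump_moment l +
  \sum_(u | ~~ xi_dir u) tail_moment (rcons l (inr u)) = (1 - gamma) * tail_moment l.
Proof.
pose f (o : option D) := if o is Some u then tail_prod (rcons l (inr u)) else
  fun txi => tail_prod l txi * clamp (\sum_v clamp (txi (tail (inl v)))).
have := @mean_sum_ae R _ _ mut _ (None :: [seq Some u | u <- index_enum _ & ~~ xi_dir u]) f
  (1 - gamma) (tail_prod l).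
rewrite big_cons big_map big_filter /=; apply.
- by case=> [u|]; [apply: unit_valued_tail_prod|apply: unit_valued_jump].
- exact: unit_valued_tail_prod.
- by rewrite subr_ge0; case/andP: gamma01.
apply: (aeS _ tail_ae) => txi [txi01 txis].
have cl u : clamp (txi u) = txi u by case/andP: (txi01 u) => *; apply: clampE.
rewrite big_cons big_map big_filter /= -txis [RHS]mulrC [RHS]mulrDr [X in _ = _ + X]mulr_sumr.
under eq_bigr => v _ do rewrite cl.
rewrite clampE //.
- by congr (_ + _); apply: eq_bigr => u _; rewrite tail_prod_rcons cl.
- by apply: sumr_ge0 => v _; case/andP: (txi01 (tail (inl v))).
- apply: (@le_trans _ _ (1 - gamma)); last by rewrite gerBl ltW //; case/andP: gamma01.
  by rewrite -txis lerDl sumr_ge0 // => u _; case/andP: (txi01 (tail (inr u))).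
Qed.

(** The next xi step has total probability [gamma] for each kernel, hence also on a set [C]
    of kernels. *)
Lemma head_moment_sum (C : set (kernel_space R ds)) l : measurable C ->
  \sum_(u | xi_dir u) mean mus (fun xi => head_prod (rcons l (inr u)) xi * \1_C xi)
  = gamma * mean mus (fun xi => head_prod l xi * \1_C xi).
Proof.
move=> mC; rewrite -big_filter; apply: mean_sum_ae.
- move=> u; apply: unit_valuedM; [exact: unit_valued_head_prod|exact: unit_valued_indic].
- apply: unit_valuedM; [exact: unit_valued_head_prod|exact: unit_valued_indic].
- by case/andP: gamma01 => /ltW.
apply: (aeS _ head_ae) => xi [xi01 xis].
have cl u : clamp (xi u) = xi u by case/andP: (xi01 u) => *; apply: clampE.
rewrite big_filter -xis !mulr_suml; apply: eq_bigr => u _.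
by rewrite head_prod_rcons cl mulrA (mulrC (xi _)).
Qed.
End Laws.

(** The law of a site inherits nonnegativity from an environment with this law. *)
Lemma rwre_ge0 (mu : probability (kernel_space R d) R) (W : rwre mu) :
  {ae mu, forall w : kernel_space R d, forall u, 0 <= w u}.
Proof.
pose N := \bigcap_u [set w : kernel_space R d | 0 <= w u].
have mN : measurable N.
  apply: bigcap_points_measurable => u.
  have := measurable_eval u measurableT (@measurable_itv R `[0, +oo[).
  rewrite setTI; congr measurable; apply/seteqP; split=> w /=; by rewrite in_itv /= andbT.
exists (~` N); split; first exact: measurableC.
- have := @env_iid _ _ _ W [:: 0] (fun=> N) isT (fun=> mN).
  rewrite big_seq1 => muN; rewrite probability_setC // -muN.
  rewrite [X in env_prob W X](_ : _ = setT) ?probability_setT ?subee //.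
  apply/seteqP; split=> // w _ x _ u _ /=.
  by case: (@env_kernel _ _ _ W x w).
- move=> w /= nw Nw; apply: nw => u; exact: Nw.
Qed.

Lemma rsubmx_unit (u : 'Z^d) : signed_units u ->
  signed_units (rsubmx u : 'Z^d1) \/ (rsubmx u : 'Z^d1) = 0.
Proof.
move=> /step_vec_surj[x <-]; rewrite rsubmx_step; case: x => [v|u']; last by right.
by left; rewrite signed_unitsE; exists v.
Qed.

Lemma level_mass (w : 'Z^d -> R) (v : Q) : (forall u, 0 <= w u) ->
  supp w `<=` @signed_units d ->
  (\esum_(u in [set u : 'Z^d | rsubmx u = unit_vec v :> 'Z^d1]) (w u)%:E
    = (w (vec (inl v)))%:E)%E.
Proof.
move=> w0 ws; rewrite -[RHS](@esum_set1 _ _ (vec (inl v)) (fun u => (w u)%:E)) ?lee_fin //.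
rewrite esum_mkcond [RHS]esum_mkcond; apply: eq_esum => u _.
case: ifPn => uA; case: ifPn => uB //.
  have [-> //|/eqP wu] := pselect (w u = 0).
  have [x xu] := step_vec_surj (ws _ wu).
  move: uA uB; rewrite inE /= -xu rsubmx_step notin_setE /= => e; case.
  case: x {xu} e => [v'|u'] e; last by have := unit_vec_neq0 v; rewrite -e eqxx.
  by rewrite (unit_vec_inj e).
by move: uA uB; rewrite inE notin_setE /= => nu e; case: nu; rewrite e rsubmx_step.
Qed.

Section Levels.
Variables (q : 'Z^d1 -> R) (delta gamma : R) (mu : probability (kernel_space R d) R)
  (mus : probability (kernel_space R ds) R)
  (mut : probability (kernel_space R (d - ds)) R).
Hypothesis delta_gt0 : 0 < delta.
Hypothesis HA0 : A0 q delta mu.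
Let qs (v : Q) := q (unit_vec v).

(** The projection of a nearest-neighbour kernel lives on unit vectors and 0, and away from
    0 it is a positive multiple of [q]. *)
Lemma A0_supp : supp q `<=` @signed_units d1.
Proof.
have [Hs q0 Hq _] := HA0.
have [w [ws [alpha da Ha]]] : exists w : kernel_space R d, supp w `<=` @signed_units d /\
   (exists2 alpha : R, delta <= alpha &
        forall y : 'Z^d1,
          (\esum_(u in [set u : 'Z^d | rsubmx u = y]) (w u)%:E
           = (alpha * q y + (1 - alpha) * unit_mass y)%:E)%E).
  by apply: (ae_exists (mu := mu)); apply: (aeS2 _ Hs Hq) => w.
move=> y /= qy; apply: contrapT => ny.
have y0 : y != 0 by apply: contra qy => /eqP ->; rewrite q0.
have := Ha y; rewrite /unit_mass (negPf y0) mulr0 addr0 esum1; last first.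
  move=> u uy; congr (_%:E); apply: contrapT => /eqP wu.
  have [] := rsubmx_unit (ws u wu); rewrite uy //.
  by move=> e; rewrite e eqxx in y0.
move=> [] /esym/eqP; rewrite mulf_eq0 (negPf qy) orbF => /eqP a0.
by move: da; rewrite a0 leNgt delta_gt0.
Qed.

Hypothesis q_mass : kernels_of_mass 1 q.

Lemma level_law_sum : \sum_v qs v = 1.
Proof. exact: kernel_units_sum q_mass A0_supp. Qed.

Hypothesis HA1 : A1 gamma mu mus mut.
Hypothesis gamma01 : 0 < gamma <= 1.
Variable W : rwre mu.

(** A condition on the whole kernel that only involves its values at level steps, which
    belong to the other part; so it passes from [mu] to [mut] by Fubini. *)
Lemma tail_level_ae : {ae mut, forall txi : kernel_space R (d - ds),
  delta <= \sum_v txi (tail (inl v)) /\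
  forall v, txi (tail (inl v)) = qs v * \sum_v' txi (tail (inl v'))}.
Proof.
have [Hs q0 Hq _] := HA0.
pose G k (e : Q -> 'Z^k) : set (kernel_space R k) :=
  [set w | delta <= \sum_v w (e v) /\ forall v, w (e v) = qs v * \sum_v' w (e v')].
have mG k e : measurable (G k e).
  have mS : measurable_fun setT (fun w : kernel_space R k => \sum_v w (e v)).
    by apply: measurable_sum => v; apply: measurable_eval.
  rewrite (_ : G k e = [set w | delta <= \sum_v w (e v)] `&`
    \bigcap_(v in [set: Q]) [set w | w (e v) - qs v * \sum_v' w (e v') = 0]).
    apply: measurableI.
      have := mS measurableT _ (@measurable_itv R `[delta, +oo[); rewrite setTI.
      by congr measurable; apply/seteqP; split=> w /=; rewrite in_itv /= andbT.
    apply: fin_bigcap_measurable => // v _.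
    have mh : measurable_fun setT (fun w : kernel_space R k => w (e v) - qs v * \sum_v' w (e v')).
      apply: measurable_funB; first exact: measurable_eval.
      by apply: measurable_funM.
    by have := mh measurableT _ (measurable_set1 0); rewrite setTI.
  apply/seteqP; split=> w [wd wq]; split => // v.
    by move=> _ /=; rewrite -wq subrr.
  by have /eqP := wq v I; rewrite subr_eq0 => /eqP.
have muG : mu (~` G d (fun v => vec (inl v))) = 0%E.
  apply/negligibleP; first exact: measurableC.
  have : {ae mu, forall w, G d (fun v => vec (inl v)) w}; last by [].
  apply: (aeS3 _ Hs Hq (rwre_ge0 W)) => w ws [alpha da Ha] w0.
  have wE v : w (vec (inl v)) = alpha * qs v.
    apply: EFin_inj; rewrite -level_mass // Ha /unit_mass.
    by rewrite (negPf (unit_vec_neq0 v)) mulr0 addr0.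
  have wS : \sum_v w (vec (inl v)) = alpha.
    by under eq_bigr => v _ do rewrite wE; rewrite -mulr_sumr level_law_sum mulr1.
  by rewrite /G /= wS; split => // v; rewrite wE mulrC.
have [_ _ muE] := HA1.
have gE (x : kernel_space R ds * kernel_space R (d - ds)) :
    G d (fun v => vec (inl v)) (Defs.glue x.1 x.2) <-> G (d - ds)%N (fun v => tail (inl v)) x.2.
  have gv v : Defs.glue x.1 x.2 (vec (inl v)) = x.2 (tail (inl v)) by rewrite glue_step.
  have gS : \sum_v Defs.glue x.1 x.2 (vec (inl v)) = \sum_v x.2 (tail (inl v)).
    by apply: eq_bigr => v _; apply: gv.
  by rewrite /G /= gS; split=> -[? H]; split=> // v; rewrite ?gv -?H ?gv // -gv H.
have mG' := mG (d - ds)%N (fun v => tail (inl v)).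
exists (~` G (d - ds)%N (fun v => tail (inl v))); split; [exact: measurableC| |].
  move: muG; rewrite muE; last by apply: measurableC; apply: mG.
  rewrite [X in (mus \x mut)%E X](_ : _ = setT `*` ~` G (d - ds)%N (fun v => tail (inl v))).
    rewrite product_measure1E //; last exact: measurableC.
    by rewrite [X in (X * _)%E](_ : _ = 1%E) ?mul1e //; exact: probability_setT.
  apply/seteqP; split=> x /=; first by move=> nG; split=> // /gE.
  by move=> [_ nG] /gE.
by move=> txi /= nG; apply: contra_not nG.
Qed.

Let qs_ge0 v : 0 <= qs v. Proof. by have [q0 _] := q_mass; apply: q0. Qed.

Lemma tail_moment_inl l v :
  tail_moment mut (rcons l (inl v)) = qs v * jump_moment mut l.
Proof.
apply: mean_ae_eq => //; [exact: unit_valued_tail_prod|exact: unit_valued_jump|].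
apply: (aeS2 _ (tail_ae HA1 gamma01) tail_level_ae) => txi [txi01 txis] [_ txiq].
have cl u : clamp (txi u) = txi u by case/andP: (txi01 u) => *; apply: clampE.
rewrite tail_prod_rcons cl txiq.
under [in RHS]eq_bigr => v' _ do rewrite cl.
rewrite clampE; first by rewrite mulrCA.
- by apply: sumr_ge0 => v' _; case/andP: (txi01 (tail (inl v'))).
- apply: (@le_trans _ _ (1 - gamma)); last by rewrite gerBl ltW //; case/andP: gamma01.
  by rewrite -txis lerDl sumr_ge0 // => u _; case/andP: (txi01 (tail (inr u))).
Qed.

Lemma jump_moment_ge l : delta * tail_moment mut l <= jump_moment mut l.
Proof.
apply: le_mean_ae; [exact: unit_valued_tail_prod|exact: unit_valued_jump|exact: ltW|].
apply: (aeS2 _ (tail_ae HA1 gamma01) tail_level_ae) => txi [txi01 txis] [txid _].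
have cl u : clamp (txi u) = txi u by case/andP: (txi01 u) => *; apply: clampE.
under eq_bigr => v' _ do rewrite cl.
rewrite clampE; first 1 last.
- by apply: sumr_ge0 => v' _; case/andP: (txi01 (tail (inl v'))).
- apply: (@le_trans _ _ (1 - gamma)); last by rewrite gerBl ltW //; case/andP: gamma01.
  by rewrite -txis lerDl sumr_ge0 // => u _; case/andP: (txi01 (tail (inr u))).
rewrite mulrC ler_wpM2l //; case: (unit_valued_tail_prod l) => _ /(_ txi)/andP[] //.
Qed.
End Levels.
End Moments.

(** * The types of sites *)

Section Types.
Context {R : realType} (d0 d1 ds : nat).
Hypothesis ds_bounds : (1 <= ds <= d0)%N.
Local Notation d := (d0 + d1)%N.
Local Notation Q := ('I_d1 * bool)%type.
Local Notation D := ('I_d0 * bool)%type.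
Local Notation step := (Q + D)%type.
Local Notation xi_dir := (@xi_dir d0 ds).
Local Notation is_xi := (xi_step xi_dir).
Local Notation head := (@step_head d0 d1 ds).
Local Notation head_prod := (@head_prod R d0 d1 ds).

Variables (gamma kappa : R) (nu1 nu2 : kernel_space R ds)
  (lambda : probability (kernel_space R ds) R)
  (mus : R -> probability (kernel_space R ds) R)
  (mut : probability (kernel_space R (d - ds)) R)
  (mu : R -> probability (kernel_space R d) R).
Hypothesis gamma01 : 0 < gamma <= 1.
Hypothesis HA1 : forall b, 0 <= b <= 1 -> A1 gamma (mu b) (mus b) mut.
Hypothesis HA2 : forall b, 0 <= b <= 1 -> A2 gamma kappa b nu1 nu2 (mus b).
Hypothesis Hlam : forall b, 0 <= b <= 1 -> conditional_law kappa nu1 nu2 lambda (mus b).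

Let i0 : 0 <= (0 : R) <= 1. Proof. by rewrite lexx ler01. Qed.

Let nu1K : kernels_of_mass gamma nu1. Proof. by case: (HA2 i0) => -[]. Qed.
Let nu2K : kernels_of_mass gamma nu2. Proof. by case: (HA2 i0) => -[]. Qed.
Let nu12 : supp nu1 `&` supp nu2 = set0. Proof. by case: (HA2 i0) => -[]. Qed.
Let nu1S : supp nu1 `<=` @signed_units ds. Proof. by case: (HA2 i0) => -[]. Qed.
Let nu2S : supp nu2 `<=` @signed_units ds. Proof. by case: (HA2 i0) => -[]. Qed.

Lemma kernel_clamp k (c : R) (f : 'Z^k -> R) u : c <= 1 -> kernels_of_mass c f ->
  clamp (f u) = f u.
Proof.
move=> c1 fc; apply: clampE; first by case: fc.
by apply: le_trans c1; apply: kernel_le_mass.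
Qed.

Lemma kernel_supp_neq0 k (c : R) (f : 'Z^k -> R) : 0 < c -> kernels_of_mass c f ->
  supp f !=set0.
Proof.
move=> c0 [f0 fm]; apply/set0P/eqP => s0.
have : c%:E = 0%E :> \bar R.
  rewrite -fm esum1 // => u _; congr (_%:E); apply: contrapT => /eqP fu.
  by have : supp f u by []; rewrite s0.
by move=> [] c00; rewrite c00 ltxx in c0.
Qed.

Let gamma_gt0 : 0 < gamma. Proof. by case/andP: gamma01. Qed.
Let gamma_le1 : gamma <= 1. Proof. by case/andP: gamma01. Qed.

Lemma nu1_neq_nu2 : nu1 != nu2.
Proof.
apply/eqP => e; have [u nu] := kernel_supp_neq0 gamma_gt0 nu1K.
have : (supp nu1 `&` supp nu2) u by split => //; rewrite -e.
by rewrite nu12.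
Qed.

Definition other_types : set (kernel_space R ds) := ~` [set nu1; nu2].

Lemma measurable_other_types : measurable other_types.
Proof.
by apply: measurableC; apply: measurableU; apply: measurable_kernel1.
Qed.

Lemma mean_indic T0 (T : measurableType T0) (P : probability T R) (A : set T) :
  measurable A -> mean P (\1_A) = fine (P A).
Proof. by move=> mA; rewrite /mean integral_indic // setIT. Qed.

(** On the other types the law does not depend on the parameter, since its mass is always
    [1 - kappa] and its normalisation is [lambda]; the parameter 0 serves as reference. *)
Lemma mean_restrict_other b (F : kernel_space R ds -> R) : 0 <= b <= 1 -> unit_valued F ->
  mean (mus b) (fun xi => F xi * \1_other_types xi) =
  mean (mus 0) (fun xi => F xi * \1_other_types xi).
Proof.
move=> b01 uF; have mC := measurable_other_types.
have E (P : probability (kernel_space R ds) R) :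
   (\int[P]_xi (F xi * \1_other_types xi)%:E = \int[P]_(xi in other_types) (F xi)%:E)%E.
  rewrite [RHS]integral_mkcond; apply: eq_integral => xi _.
  by rewrite epatch_indic /= EFinM.
rewrite /mean !E; congr fine; apply: eq_measure_integral => A mA AC.
have AE : A `\` [set nu1; nu2] = A.
  by apply/seteqP; split => [x []//|x Ax]; split => //; exact: AC.
transitivity ((1 - kappa)%:E * lambda A)%E.
  by rewrite -(Hlam b01) // AE.
by rewrite -(Hlam i0) // AE.
Qed.

Lemma mean_types b (F : kernel_space R ds -> R) : 0 <= b <= 1 -> unit_valued F ->
  mean (mus b) F = kappa * (1 - b) * F nu1 + kappa * b * F nu2
    + mean (mus 0) (fun xi => F xi * \1_other_types xi).
Proof.
move=> b01 uF; have mC := measurable_other_types.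
have [_ m1 m2 _ _] := HA2 b01.
have u1 (A : set (kernel_space R ds)) : measurable A -> unit_valued (fun xi => F xi * \1_A xi).
  by move=> mA; apply: unit_valuedM => //; apply: unit_valued_indic.
have ms (nu : kernel_space R ds) := measurable_kernel1 nu.
have atom (nu : kernel_space R ds) :
   mean (mus b) (fun xi => F xi * \1_[set nu] xi) = F nu * fine (mus b [set nu]).
  rewrite -mean_indic //; apply: mean_ae_eq; [exact: u1|exact: unit_valued_indic| |].
    by case: uF => _ /(_ nu)/andP[].
  apply: aeW => xi; rewrite indicE; case: (boolP (xi \in [set nu])) => [|_].
    by rewrite inE => ->.
  by rewrite !mulr0.
pose f (A : set (kernel_space R ds)) xi := F xi * \1_A xi.
have := @mean_sum_ae R _ _ (mus b) _ [:: [set nu1]; [set nu2]; other_types]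
   (fun A => if `[< measurable A >] then f A else F) 1 F.
rewrite mul1r => <- //.
- rewrite !big_cons big_nil addr0 !asboolT // -(mean_restrict_other b01) //.
  rewrite /f !atom m1 m2 /= addrA; congr (_ + _ + _); exact: mulrC.
- by move=> A; case: asboolP => // mA; apply: u1.
- apply: aeW => xi; rewrite !big_cons big_nil addr0 !asboolT // /f mul1r -!mulrDr !indicE.
  rewrite -[RHS]mulr1; congr (_ * _).
  have n12 := nu1_neq_nu2.
  have [->|x1] := eqVneq xi nu1.
    rewrite (mem_set (erefl nu1 : [set nu1] nu1)) !memNset ?addr0 //.
      by move=> /= ; apply; left.
    by move=> /= e; move: n12; rewrite e eqxx.
  have [->|x2] := eqVneq xi nu2.
    rewrite (mem_set (erefl nu2 : [set nu2] nu2)) !memNset ?addr0 ?add0r //.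
      by move=> /= ; apply; right.
    by move=> /= e; move: n12; rewrite e eqxx.
  rewrite (mem_set (_ : other_types xi)) ?memNset ?add0r //.
  - by apply/eqP.
  - by apply/eqP.
  - by move=> [] /= e; [move: x1|move: x2]; rewrite e eqxx.
Qed.

Definition type_kernel (nu : 'Z^ds -> R) (u : D) : R :=
  if xi_dir u then nu (head (inr u)) else 0.

Definition other_moment (l : seq step) : R :=
  mean (mus 0) (fun xi => head_prod l xi * \1_other_types xi).

Lemma kernel_at0 (nu : 'Z^ds -> R) : supp nu `<=` @signed_units ds -> nu 0 = 0.
Proof.
move=> nuS; apply: contrapT => /eqP /nuS; rewrite signed_unitsE => -[x _ /eqP].
by rewrite (negPf (unit_vec_neq0 x)).
Qed.

Lemma head_prod_word (nu : kernel_space R ds) l : kernels_of_mass gamma nu ->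
  supp nu `<=` @signed_units ds -> head_prod l nu = word_prod (type_kernel nu) l.
Proof.
move=> nuK nuS; apply: eq_bigr => x _; rewrite (kernel_clamp _ gamma_le1 nuK).
case: x => [v|u]; last rewrite /type_kernel; last case: ifPn => // xu;
  by rewrite (step_head0 ds_bounds) // kernel_at0.
Qed.

Lemma head_moment_types b l : 0 <= b <= 1 ->
  head_moment (mus b) l = kappa * (1 - b) * word_prod (type_kernel nu1) l
   + kappa * b * word_prod (type_kernel nu2) l + other_moment l.
Proof.
move=> b01; rewrite /head_moment mean_types //; last exact: unit_valued_head_prod.
by rewrite !head_prod_word.
Qed.

Lemma type_kernel_sum (nu : 'Z^ds -> R) : kernels_of_mass gamma nu ->
  supp nu `<=` @signed_units ds -> \sum_u type_kernel nu u = gamma.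
Proof.
move=> nuK nuS; rewrite /type_kernel -big_mkcond /=; apply: kernel_mass_sum nuK nuS.
  by move=> u v uP vP /(step_head_inj ds_bounds) e; case: (e uP vP).
move=> u /(step_head_surj d1 ds_bounds)[[//|w] wP <-]; by exists w.
Qed.

Lemma types_disjoint u : type_kernel nu1 u * type_kernel nu2 u = 0.
Proof.
rewrite /type_kernel; case: ifP => _; last by rewrite mul0r.
apply: contrapT => /eqP; rewrite mulf_eq0 negb_or => /andP[a b].
by have : (supp nu1 `&` supp nu2) (head (inr u)) by []; rewrite nu12.
Qed.

Lemma mus0_other : mus 0 other_types = (1 - kappa)%:E.
Proof.
have := Hlam i0 measurableT; rewrite setTD probability_setT mule1 => <- //.
Qed.

Lemma other_moment_nil : other_moment [::] = 1 - kappa.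
Proof.
rewrite /other_moment -[RHS]/(fine (1 - kappa)%:E) -mus0_other -mean_indic; last first.
  exact: measurable_other_types.
by congr mean; apply/funext => xi; rewrite /head_prod big_nil mul1r.
Qed.

Lemma other_moment_ge0 l : 0 <= other_moment l.
Proof.
apply: mean_ge0 => xi; rewrite mulr_ge0 //.
have uh : unit_valued (head_prod l) by exact: unit_valued_head_prod.
by case: uh => _ /(_ xi)/andP[].
Qed.

Lemma other_moment_sum l :
  \sum_(u | xi_dir u) other_moment (rcons l (inr u)) = gamma * other_moment l.
Proof.
apply: (head_moment_sum ds_bounds (HA1 i0) gamma01).
exact: measurable_other_types.
Qed.

(** The kernels that vanish on the supports of [nu1] and [nu2] and at the two unit vectors
    along e1 carry the full mass [1 - kappa] of the other types, which therefore do so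
    almost surely. *)
Lemma other_moment_supp l u : inr u \in l ->
  [|| type_kernel nu1 u != 0, type_kernel nu2 u != 0 | disp u != 0 :> R] ->
  other_moment l = 0.
Proof.
move=> ul nz.
pose third := [set xi : kernel_space R ds |
   supp xi `&` (supp nu1 `|` supp nu2 `|` [set e1 ds; - e1 ds]) = set0].
have m3 : measurable third by apply: measurable_vanish.
have [_ _ _ mu3 _] := HA2 i0.
have uF : (supp nu1 `|` supp nu2 `|` [set e1 ds; - e1 ds]) (head (inr u)).
  case/or3P: nz => [n1|n2|du].
  - by left; left; move: n1; rewrite /type_kernel; case: ifP; rewrite ?eqxx.
  - by left; right; move: n2; rewrite /type_kernel; case: ifP; rewrite ?eqxx.
  - by right; rewrite (step_head_e1 d1 ds du); case: ifP; [right|left].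
have sub3 : third `<=` other_types.
  move=> xi t3 [] e; move: t3; rewrite e /third /= => t3.
    have [w nw] := kernel_supp_neq0 gamma_gt0 nu1K.
    have : (supp nu1 `&` (supp nu1 `|` supp nu2 `|` [set e1 ds; - e1 ds])) w.
      by split=> //; left; left.
    by rewrite t3.
  have [w nw] := kernel_supp_neq0 gamma_gt0 nu2K.
  have : (supp nu2 `&` (supp nu1 `|` supp nu2 `|` [set e1 ds; - e1 ds])) w.
    by split=> //; left; right.
  by rewrite t3.
have mC := measurable_other_types.
have null : mus 0 (other_types `\` third) = 0%E.
  rewrite measureD //; last by rewrite [ltLHS](_ : _ = (1 - kappa)%:E) ?ltry //; exact: mus0_other.
  rewrite setIidr //; move: mu3; rewrite -/third => mu3.
  rewrite [X in (X - _)%E](_ : _ = (1 - kappa)%:E); last exact: mus0_other.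
  by rewrite [X in (_ - X)%E](_ : _ = (1 - kappa)%:E) // -EFinB subrr.
rewrite /other_moment.
have uf : unit_valued (fun xi : kernel_space R ds => head_prod l xi * \1_other_types xi).
  by apply: unit_valuedM; [exact: unit_valued_head_prod|exact: unit_valued_indic].
rewrite (@mean_ae_eq R _ _ (mus 0) _ _ 0 uf uf) ?mul0r //.
exists (other_types `\` third); split => //; first exact: measurableD.
move=> xi /= nz'; split.
  by apply: contrapT => no; apply: nz'; rewrite indicE memNset // mulr0 mul0r.
move=> t3; apply: nz'; rewrite mul0r.
suff -> : head_prod l xi = 0 by rewrite mul0r.
apply/eqP; rewrite prodf_seq_eq0; apply/hasP; exists (inr u) => //=.
suff -> : xi (head (inr u)) = 0 by rewrite clamp0.
apply: contrapT => /eqP xu.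
by have : (supp xi `&` (supp nu1 `|` supp nu2 `|` [set e1 ds; - e1 ds])) (head (inr u)) by [];
   rewrite t3.
Qed.

Definition drift_gap : R := (nu2 (e1 ds) - nu2 (- e1 ds)) - (nu1 (e1 ds) - nu1 (- e1 ds)).

Lemma drift_gap_gt0 : 0 < drift_gap.
Proof. by case: (HA2 i0). Qed.

(** At each of the two unit vectors along e1 one of [nu1] and [nu2] vanishes; together with
    the positive gap this forces the signs. *)
Lemma drift_signs : [/\ \sum_u type_kernel nu1 u * disp u <= 0,
   0 <= \sum_u type_kernel nu2 u * disp u &
   \sum_u type_kernel nu2 u * disp u - \sum_u type_kernel nu1 u * disp u = drift_gap].
Proof.
rewrite !(sum_disp d1 ds_bounds).
have [p1 _] := nu1K; have [p2 _] := nu2K; have := drift_gap_gt0; rewrite /drift_gap.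
have dj w : nu1 w * nu2 w = 0.
  apply: contrapT => /eqP; rewrite mulf_eq0 negb_or => /andP[a b].
  by have : (supp nu1 `&` supp nu2) w by []; rewrite nu12.
have := dj (e1 ds); have := dj (- e1 ds).
move: (p1 (e1 ds)) (p1 (- e1 ds)) (p2 (e1 ds)) (p2 (- e1 ds)).
set a := nu1 (e1 ds); set b := nu1 (- e1 ds); set c := nu2 (e1 ds); set e := nu2 (- e1 ds).
move=> a0 b0 c0 e0 be ac gap; split => //.
- move/eqP: ac; rewrite mulf_eq0 => /orP[] /eqP z; lra.
- move/eqP: be; rewrite mulf_eq0 => /orP[] /eqP z; lra.
Qed.
End Types.

(** * The annealed walk *)

Section Mixture.
Local Open Scope ereal_scope.
Context d d' (T : measurableType d) (S : measurableType d') (R : realType)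
  (P : probability T R) (k : R.-pker T ~> S).

Definition mixture (A : set S) : \bar R := \int[P]_w k w A.

Let mixture0 : mixture set0 = 0.
Proof. by rewrite /mixture integral0_eq. Qed.

Let mixture_ge0 A : 0 <= mixture A. Proof. by apply: integral_ge0. Qed.

Let mixture_additive : semi_sigma_additive mixture.
Proof.
move=> F mF tF _; rewrite [X in _ --> X](_ : _ =
    \int[P]_w (\sum_(0 <= i <oo) k w (F i))); last first.
  by apply: eq_integral => w _; apply/esym/cvg_lim => //; exact: measure_sigma_additive.
rewrite [X in X @ _](_ : _ =
    (fun n => \int[P]_w (\sum_(0 <= i < n) k w (F i)))); last first.
  apply/funext => n; rewrite -ge0_integral_sum//.
  by move=> i; apply: measurable_kernel.
apply: cvg_monotone_convergence => //.
- by move=> n; apply: emeasurable_sum => m; apply: measurable_kernel.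
- by move=> n w _; rewrite sume_ge0.
- by move=> w _ m n mn; exact: ereal_nondecreasing_series.
Qed.

HB.instance Definition _ := isMeasure.Build d' S R mixture
  mixture0 mixture_ge0 mixture_additive.

Let mixture_setT : mixture setT = 1.
Proof.
rewrite /mixture (eq_integral (cst 1)); last by move=> w _; rewrite prob_kernel.
by rewrite integral_cst // mul1e [LHS](_ : _ = P setT) // probability_setT.
Qed.

HB.instance Definition _ := Measure_isProbability.Build _ _ _ mixture mixture_setT.
Definition mixture_prob : probability S R := mixture.
End Mixture.

Section Paths.
Context {R : realType} (Q D : finType) (V : zmodType) (vec : Q + D -> V).
Local Notation step := (Q + D)%type.

Fixpoint departures_from (z : V) (H : seq step) (y : V) : seq step :=
  if H is x :: H' then
    (if z == y then [:: x] else [::]) ++ departures_from (z + vec x) H' y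
  else [::].

Fixpoint visited (z : V) (H : seq step) : seq V :=
  if H is x :: H' then z :: visited (z + vec x) H' else [:: z].

Lemma displacement_cons x H : displacement vec (x :: H) = vec x + displacement vec H.
Proof. by rewrite /displacement big_cons. Qed.

Lemma displacement_rcons x H : displacement vec (rcons H x) = displacement vec H + vec x.
Proof. by rewrite /displacement -cats1 big_cat big_seq1. Qed.

Lemma departures_fromE z H :
  departures_from z H (z + displacement vec H) = departures vec H.
Proof.
elim: H z => //= x H IH z; rewrite displacement_cons.
rewrite -[X in X == _]addr0 (inj_eq (addrI z)) eq_sym; congr (_ ++ _).
by rewrite addrA IH.
Qed.

Lemma departures_from_rcons z H x y :
  departures_from z (rcons H x) y =
  departures_from z H y ++ (if z + displacement vec H == y then [:: x] else [::]).
Proof.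
elim: H z => [|x' H IH] z /=.
  by rewrite cats0 /displacement big_nil addr0.
by rewrite IH -catA displacement_cons addrA.
Qed.

Lemma visited_last z H : z + displacement vec H \in visited z H.
Proof.
elim: H z => [|x H IH] z /=; first by rewrite /displacement big_nil addr0 mem_seq1.
by rewrite displacement_cons addrA inE IH orbT.
Qed.

Lemma visited_rcons z H x : {subset visited z H <= visited z (rcons H x)}.
Proof.
elim: H z => [|x' H IH] z y /=; first by rewrite !inE => ->.
by rewrite !inE => /orP[->//|/IH ->]; rewrite orbT.
Qed.

Variable kern : seq step -> step -> R.

Fixpoint path_prob (H0 H : seq step) : R :=
  if H is x :: H' then kern (departures vec H0) x * path_prob (rcons H0 x) H' else 1.

Lemma path_prob_rcons H0 H x :
  path_prob H0 (rcons H x) = path_prob H0 H * kern (departures vec (H0 ++ H)) x.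
Proof.
elim: H H0 => [|x' H IH] H0 /=; first by rewrite cats0 mulr1 mul1r.
by rewrite IH mulrA cat_rcons.
Qed.

Variable Phi : seq step -> R.
Hypothesis Phi_nil : Phi [::] = 1.
Hypothesis Phi_rcons : forall l x, Phi (rcons l x) = Phi l * kern l x.

(** Grouping the steps of a path by the sites they leave; at each site the product of the
    kernels telescopes by the chain rule. *)
Lemma path_prob_sites H (s : seq V) : uniq s -> {subset visited 0 H <= s} ->
  \prod_(y <- s) Phi (departures_from 0 H y) = path_prob [::] H.
Proof.
move=> us; elim/last_ind: H => [|H x IH] sub.
  by rewrite big1.
have sub' : {subset visited 0 H <= s} by move=> y /visited_rcons yH; apply: sub.
rewrite path_prob_rcons -IH // cat0s.
have ys : displacement vec H \in s.
  by apply: sub'; have := visited_last 0 H; rewrite add0r.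
rewrite (bigD1_seq (displacement vec H)) //= [in RHS](bigD1_seq (displacement vec H)) //=.
rewrite departures_from_rcons add0r eqxx cats1 Phi_rcons.
have -> : departures_from 0 H (displacement vec H) = departures vec H.
  by rewrite -(departures_fromE 0 H) add0r.
rewrite -!mulrA; congr (_ * _); rewrite mulrC; congr (_ * _).
apply: eq_bigr => y yH; rewrite departures_from_rcons add0r.
by rewrite eq_sym (negPf yH) cats0.
Qed.

(** Quenched probability of the path: [e z x] is the probability of the step [x] at [z]. *)
Fixpoint env_weight (e : V -> step -> R) (z : V) (H : seq step) : R :=
  if H is x :: H' then e z x * env_weight e (z + vec x) H' else 1.

Lemma env_weight_rcons e z H x :
  env_weight e z (rcons H x) = env_weight e z H * e (z + displacement vec H) x.
Proof.
elim: H z => [|x' H IH] z /=; first by rewrite /displacement big_nil addr0 mulr1 mul1r.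
by rewrite IH mulrA displacement_cons addrA.
Qed.

Lemma env_weight_sites e z H (s : seq V) : uniq s -> {subset visited z H <= s} ->
  env_weight e z H = \prod_(y <- s) \prod_(x <- departures_from z H y) e y x.
Proof.
move=> us; elim: H z => [|x H IH] z sub /=.
  by rewrite big1 // => y _; rewrite big_nil.
have zs : z \in s by apply: sub; rewrite inE eqxx.
rewrite IH; last by move=> y yH; apply: sub; rewrite inE yH orbT.
rewrite [in RHS](bigD1_seq z) //= eqxx big_cons -mulrA; congr (_ * _).
rewrite (bigD1_seq z) //=; congr (_ * _).
by apply: eq_bigr => y yz; rewrite eq_sym (negPf yz).
Qed.
End Paths.

Section PathMeans.
Context {R : realType} {Q D : finType} {V : zmodType} (vec : Q + D -> V).
Local Notation step := (Q + D)%type.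
Variables (q : Q -> R) (a : seq step -> R) (p : seq step -> D -> R) (disp : D -> R).
Hypothesis q_sum1 : \sum_v q v = 1.
Hypothesis p_sum : forall l, a l + \sum_u p l u = 1.

Local Notation kern := (walk_kernel q a p).
Definition step_disp (x : step) : R := if x is inr u then disp u else 0.
Definition path_disp (H : seq step) : R := \sum_(x <- H) step_disp x.

Lemma walk_kernel_sum l : \sum_x kern l x = 1.
Proof. by rewrite big_sumType /= -mulr_sumr q_sum1 mulr1 p_sum. Qed.

Lemma path_prob_sum n H0 : \sum_(H <- words n) path_prob vec kern H0 H = 1.
Proof.
elim: n H0 => [|n IH] H0 /=; first by rewrite big_seq1.
rewrite big_allpairs_dep big_enum /= -[RHS](walk_kernel_sum (departures vec H0)).
by apply: eq_bigr => x _; rewrite -mulr_sumr IH mulr1.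
Qed.

Lemma path_mean_disp n H0 :
  \sum_(H <- words n) path_prob vec kern H0 H * path_disp H
  = mean_disp vec q a disp p n H0.
Proof.
elim: n H0 => [|n IH] H0 /=; first by rewrite big_seq1 /path_disp big_nil mulr0.
rewrite big_allpairs_dep big_enum /=.
transitivity (\sum_x kern (departures vec H0) x *
    (step_disp x + mean_disp vec q a disp p n (rcons H0 x))).
  apply: eq_bigr => x _; rewrite -IH -[step_disp x]mul1r -(path_prob_sum n (rcons H0 x)).
  rewrite mulr_suml -big_split mulr_sumr /=; apply: eq_bigr => H _.
  by rewrite /path_disp big_cons -mulrA mulrDr.
rewrite big_sumType /= /step_mean.
under eq_bigr => v _ do rewrite add0r -mulrA.
under [X in _ + X]eq_bigr => u _ do rewrite mulrDr.
by rewrite -mulr_sumr big_split /= addrCA.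
Qed.
End PathMeans.

Section Annealed.
Context {R : realType} (d0 d1 ds : nat).
Hypothesis ds_bounds : (1 <= ds <= d0)%N.
Local Notation d := (d0 + d1)%N.
Local Notation Q := ('I_d1 * bool)%type.
Local Notation D := ('I_d0 * bool)%type.
Local Notation step := (Q + D)%type.
Local Notation vec := (@step_vec d0 d1).
Variables (mu : probability (kernel_space R d) R) (W : rwre mu).
Variables (q : Q -> R) (a : seq step -> R) (p : seq step -> D -> R).
Hypothesis q_sum1 : \sum_v q v = 1.
Hypothesis p_sum : forall l, a l + \sum_u p l u = 1.
Local Notation kern := (walk_kernel q a p).
Hypothesis site_rcons : forall l x,
  mean mu (site_prod (rcons l x)) = mean mu (site_prod l) * kern l x.

Let prob : probability (path_space d) R := mixture_prob (env_prob W) (quenched W).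

Lemma measurable_position n (A : set 'Z^d) :
  measurable [set X : path_space d | A (X n)].
Proof.
rewrite (_ : [set X | _] = \bigcup_u (if `[< A u >] then
    [set X : path_space d | X n = u] else set0)).
  apply: countable_bigcupT_measurable => // u; case: ifP => // _.
  by apply: sub_sigma_algebra; exists n, u.
apply/seteqP; split=> X /=.
  by move=> AX; exists (X n) => //; rewrite asboolT.
by case=> u _; case: ifPn => // /asboolP Au /= ->.
Qed.

Definition cylinder (H : seq step) : set (path_space d) :=
  [set X | forall i, (i <= size H)%N -> X i = displacement vec (take i H)].

Lemma measurable_cylinder H : measurable (cylinder H).
Proof.
rewrite (_ : cylinder H = \bigcap_i (if (i <= size H)%N then
   [set X : path_space d | X i = displacement vec (take i H)] else setT)).
  apply: bigcapT_measurable => i; case: ifP => // _.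
  exact: (measurable_position i [set displacement vec (take i H)]).
apply/seteqP; split=> X HX i; first by move=> _; case: ifP => // iH; apply: HX.
by move=> iH; have := HX i I; rewrite iH.
Qed.

Lemma quenched_cylinder w H : quenched W w (cylinder H) =
  (env_weight vec (fun y x => (env y w : 'Z^d -> R) (vec x)) 0 H)%:E.
Proof.
elim/last_ind: H => [|H x IH].
  rewrite /= -(@quenched_start _ _ _ W w); congr (quenched W w _).
  apply/seteqP; split=> X /=; first by move=> HX; rewrite (HX 0%N) // /displacement big_nil.
  by move=> X0 i; rewrite leqn0 => /eqP ->; rewrite X0 /displacement big_nil.
have := @quenched_step _ _ _ W w (size H) (fun i => displacement vec (take i (rcons H x))).
rewrite [X in quenched W w X = _](_ : _ = cylinder (rcons H x)); last first.
  by rewrite /cylinder size_rcons.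
move=> ->; rewrite env_weight_rcons EFinM -IH; congr (quenched W w _ * _)%E.
  apply/seteqP; split=> X HX i iH; rewrite HX //; congr (displacement vec _);
    by rewrite -cats1 takel_cat.
rewrite add0r -[(size H).+1](size_rcons H x) take_size.
rewrite -cats1 take_size_cat // cats1 displacement_rcons.
by rewrite addrC addKr.
Qed.

(** The quenched probability of a path is a product over the visited sites, whose kernels
    are independent; and each factor has the mean given by the chain rule. *)
Lemma annealed_cylinder H : prob (cylinder H) = (path_prob vec kern [::] H)%:E.
Proof.
rewrite /prob /mixture_prob /= /mixture.
under eq_integral => w _ do rewrite quenched_cylinder.
pose s := undup (visited vec 0 H).
have us : uniq s by apply: undup_uniq.
have sub : {subset visited vec 0 H <= s} by move=> y; rewrite mem_undup.
pose f y := @site_prod R d0 d1 (departures_from vec 0 H y).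
have wE (w : env_space W) : env_weight vec (fun y x => (env y w : 'Z^d -> R) (vec x)) 0 H =
    \prod_(y <- s) f y (env y w).
  rewrite (env_weight_sites _ us sub); apply: eq_bigr => y _; apply: eq_bigr => x _.
  have kW := @env_kernel _ _ _ W y w.
  by rewrite clampE //; [case: kW|apply: kernel_le_mass].
under eq_integral => w _ do rewrite wE.
have uf y : unit_valued (f y) by apply: unit_valued_site_prod.
have menv y : measurable_fun setT (@env _ _ _ W y) by apply: env_measurable.
rewrite -meanE; last first.
  by apply: unit_valued_prod => y; apply: (unit_valued_comp (menv y)).
rewrite (mean_prod_iid menv (@env_iid _ _ _ W)) //.
congr (_%:E); apply: (path_prob_sites _ site_rcons us sub).
rewrite -(mean1 mu); congr mean; apply/funext => w.
by rewrite /site_prod big_nil.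
Qed.

Lemma cylinder_disjoint H H' X : size H = size H' -> cylinder H X -> cylinder H' X -> H = H'.
Proof.
move=> sHH' HX HX'; apply: (inj_map (@step_vec_inj d0 d1)).
apply: (@eq_from_nth _ 0); first by rewrite !size_map.
move=> i; rewrite size_map => iH.
have inc H1 : cylinder H1 X -> (i < size H1)%N -> nth 0 (map vec H1) i = X i.+1 - X i.
  move=> H1X; case: H1 H1X => // x0 H0; set H1 := _ :: _ => H1X iH1.
  rewrite (nth_map x0) // !H1X //; last exact: ltnW.
  by rewrite (take_nth x0) // displacement_rcons addrC addKr.
by rewrite !inc // -sHH'.
Qed.

Lemma coordinateD (T : zmodType) k (u v : 'rV[T]_k) i :
  coordinate (u + v) i = coordinate u i + coordinate v i.
Proof. by rewrite /coordinate; case: insub => [j|]; rewrite ?mxE ?addr0. Qed.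

Lemma coordinate0 (T : zmodType) k i : coordinate (0 : 'rV[T]_k) i = 0.
Proof. by rewrite /coordinate; case: insub => [j|]; rewrite ?mxE. Qed.

Lemma path_disp_coordinate (H : seq step) :
  path_disp (@disp d0 R) H = (coordinate (displacement vec H) 0)%:~R.
Proof.
elim: H => [|x H IH].
  by rewrite /path_disp /displacement !big_nil coordinate0.
rewrite /path_disp big_cons displacement_cons coordinateD intrD.
by rewrite (coordinate_step ds_bounds) -IH.
Qed.

Lemma path_disp_le (H : seq step) : `|path_disp (@disp d0 R) H| <= (size H)%:R.
Proof.
elim: H => [|x H IH]; first by rewrite /path_disp big_nil normr0.
rewrite /path_disp big_cons /= -natr1 addrC.
apply: le_trans (ler_normD _ _) _; apply: lerD => //.
case: x => [v|u] /=; first by rewrite normr0.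
by rewrite /disp; case: ifP => _; rewrite ?normr0 //; case: ifP => _; rewrite ?normrN normr1.
Qed.

Let fn (n : nat) (X : path_space d) : R :=
  n%:R^-1 * \sum_(H <- words n) path_disp (@disp d0 R) H * \1_(cylinder H) X.

Lemma fn_cylinder n H X : size H = n -> cylinder H X ->
  fn n X = n%:R^-1 * path_disp (@disp d0 R) H.
Proof.
move=> sH HX; rewrite /fn; congr (_ * _).
have Hw : H \in words n by rewrite mem_words sH.
rewrite (bigD1_seq H) ?uniq_words //= indicE mem_set // mulr1 big_seq_cond big1 ?addr0 //.
move=> H'; rewrite mem_words => /andP[/eqP sH' HH']; rewrite indicE memNset ?mulr0 //.
by move=> HX'; move: HH'; rewrite (cylinder_disjoint _ HX' HX) ?eqxx // sH.
Qed.

(** The probabilities of the nearest-neighbour paths of length [n] add up to 1. *)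
Lemma ae_cylinder : {ae prob, forall X, forall n, exists2 H, size H = n & cylinder H X}.
Proof.
apply: ae_foralln => n.
pose U := \bigcup_(H in [set` words n]) cylinder H.
have mU : measurable U by apply: fin_bigcup_measurable => // H _; apply: measurable_cylinder.
have PU : prob U = 1%E.
  rewrite /U measure_fin_bigcup; first last.
  - by move=> H _; apply: measurable_cylinder.
  - move=> H H' /=; rewrite !mem_words => /eqP sH /eqP sH' [X [HX HX']].
    by apply: cylinder_disjoint HX HX'; rewrite sH.
  - exact: finite_seq.
  rewrite -fsbig_seq ?uniq_words //.
  rewrite (eq_bigr (fun H => (path_prob vec kern [::] H)%:E)); last first.
    by move=> H _; apply: annealed_cylinder.
  by rewrite sumEFin path_prob_sum.
exists (~` U); split; first exact: measurableC.
  rewrite [LHS](_ : _ = prob (~` U)) // probability_setC // PU subee //.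
move=> X /= nH [H Hw HX]; apply: nH; exists H => //.
by move: Hw => /=; rewrite mem_words => /eqP.
Qed.

(** Dominated convergence, as the first coordinate of [X_n / n] is bounded by 1. *)
Lemma velocity_limit (v : 'rV[R]_d) :
  annealed W [set X : path_space d |
      (fun n : nat => n%:R^-1 *: map_mx intr (X n) : 'rV[R]_d) @ \oo --> v] = 1%E ->
  (fun n => n%:R^-1 * mean_disp vec q a (@disp d0 R) p n [::]) @ \oo --> coordinate v 0.
Proof.
pose S (X : path_space d) (n : nat) : 'rV[R]_d := n%:R^-1 *: map_mx intr (X n).
set C := [set X | _] => PC.
have mC : measurable C.
  rewrite (_ : C = \bigcap_k \bigcup_N \bigcap_n (if (N <= n)%N then
     [set X : path_space d | ball v (k.+1%:R^-1) (S X n)] else setT)).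
    apply: bigcapT_measurable => k; apply: bigcupT_measurable => N.
    apply: bigcapT_measurable => n; case: ifP => // _.
    exact: (measurable_position n [set u | ball v (k.+1%:R^-1) (n%:R^-1 *: map_mx intr u : 'rV[R]_d)]).
  apply/seteqP; split=> X.
    move=> /cvg_ballP Xv k _.
    have [N _ HN] := Xv (k.+1%:R^-1) ltac:(by rewrite invr_gt0).
    by exists N => // n _; case: ifP => // Nn; apply: HN.
  move=> HX; apply/cvg_ballP => e e0.
  have [k ke] := ltr_add_invr (e0 : 0 < e).
  have [N _ HN] := HX k I; exists N => // n Nn.
  apply: (@le_ball _ _ _ (k.+1%:R^-1)); first by rewrite add0r in ke; apply: ltW.
  by have := HN n I; rewrite ifT.
have aeC : {ae prob, forall X, C X}.
  have pC : prob (~` C) = 0%E.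
    rewrite probability_setC //; have -> : prob C = 1%E := PC.
    by rewrite subee.
  by exists (~` C); split => //; exact: measurableC.
have fn_meas n : measurable_fun setT (fn n).
  apply: measurable_funM => //; apply: measurable_sum => H.
  by apply: measurable_funM => //; apply: measurable_indic; apply: measurable_cylinder.
have fn_int n : (\int[prob]_X (fn n X)%:E = (n%:R^-1 * mean_disp vec q a (@disp d0 R) p n [::])%:E)%E.
  rewrite -(path_mean_disp vec (@disp d0 R) q_sum1 p_sum).
  have fE X : (fn n X)%:E = (\sum_(H <- words n)
     ((n%:R^-1 * path_disp (@disp d0 R) H)%:E * (\1_(cylinder H) X)%:E))%E.
    rewrite /fn mulr_sumr -sumEFin; apply: eq_bigr => H _.
    by rewrite -EFinM mulrA.
  under eq_integral => X _ do rewrite fE.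
  have mcy H := measurable_cylinder H.
  have ic H : prob.-integrable setT (fun X => (\1_(cylinder H) X)%:E).
    exact: integrable_indic.
  rewrite integral_sum //; last by move=> H; apply: integrableZl.
  rewrite mulr_sumr -sumEFin; apply: eq_bigr => H _.
  rewrite integralZl // integral_indic // setIT.
  rewrite [X in (_ * X)%E](_ : _ = prob (cylinder H)) // annealed_cylinder -EFinM.
  by congr (_%:E); rewrite -mulrA; congr (_ * _); rewrite mulrC.
have fn_cvg : {ae prob, forall X, setT X -> (fun n => (fn n X)%:E) @ \oo --> (coordinate v 0)%:E}.
  apply: (aeS2 _ aeC ae_cylinder) => X CX cylX _.
  apply/fine_cvgP; split; first by apply: nearW.
  have d_gt0 : (0 < d)%N by case/andP: ds_bounds; lia.
  rewrite (_ : fine \o _ = fun n => S X n ord0 (Ordinal d_gt0)).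
    rewrite (_ : coordinate v 0 = v ord0 (Ordinal d_gt0)); last first.
      by rewrite /coordinate insubT.
    apply/cvg_ballP => e e0; have /cvg_ballP /(_ e e0) [N _ HN] := CX.
    exists N => // n Nn /=; have [_ H] := HN n Nn; exact: H.
  apply/funext => n /=; have [H sH HX] := cylX n.
  rewrite (fn_cylinder sH HX) path_disp_coordinate /S !mxE.
  have -> : X n = displacement vec H by rewrite -sH HX // take_size.
  by rewrite /coordinate insubT.
have fn_bound : {ae prob, forall X n, setT X -> (`|(fn n X)%:E| <= (cst 1 X)%:E)%E}.
  apply: (aeS _ ae_cylinder) => X cylX n _.
  have [H sH HX] := cylX n; rewrite (fn_cylinder sH HX) /= lee_fin normrM.
  rewrite ger0_norm ?invr_ge0 //.
  case: n sH => [|n] sH; first by rewrite invr0 mul0r ler01.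
  by rewrite ler_pdivrMl // mulr1 -sH path_disp_le.
have ig : prob.-integrable setT (fun=> 1%E) by exact: finite_measure_integrable_cst.
have mfn n : measurable_fun setT (fun X => (fn n X)%:E) by exact/measurable_EFinP.
have mv : measurable_fun setT (fun _ : path_space d => (coordinate v 0)%:E) by [].
have [_ _ H] := dominated_convergence measurableT mfn mv fn_cvg ig fn_bound.
move: H; rewrite integral_cst // [X in (_ * X)%E](_ : _ = prob setT) // probability_setT mule1.
under eq_fun => n do rewrite fn_int.
by move=> /fine_cvgP[].
Qed.
End Annealed.

(** * The velocity as a function of the parameter *)

Section Velocity.
Context {R : realType} (d0 d1 ds : nat) (q : 'Z^d1 -> R)
  (gamma kappa delta : R) (nu1 nu2 : 'Z^ds -> R)
  (mut : probability (kernel_space R (d0 + d1 - ds)) R)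
  (lambda : probability (kernel_space R ds) R)
  (mus : R -> probability (kernel_space R ds) R)
  (mu : R -> probability (kernel_space R (d0 + d1)) R)
  (v : R -> 'rV[R]_(d0 + d1)) (K : R).
Hypothesis ds_bounds : (1 <= ds <= d0)%N.
Hypothesis gamma01 : 0 < gamma <= 1.
Hypothesis kappa01 : 0 < kappa <= 1.
Hypothesis delta_gt0 : 0 < delta.
Hypothesis q_mass : kernels_of_mass 1 q.
Hypothesis HA3 : A3 q.
Hypothesis HA0 : forall b, 0 <= b <= 1 -> A0 q delta (mu b).
Hypothesis HA1 : forall b, 0 <= b <= 1 -> A1 gamma (mu b) (mus b) mut.
Hypothesis HA2 : forall b, 0 <= b <= 1 -> A2 gamma kappa b nu1 nu2 (mus b).
Hypothesis Hlam : forall b, 0 <= b <= 1 -> conditional_law kappa nu1 nu2 lambda (mus b).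
Hypothesis Hv : forall b, 0 <= b <= 1 -> limiting_velocity (mu b) (v b).
Let qs (x : 'I_d1 * bool) := q (unit_vec x).
Hypothesis cut_bound : forall k n,
  iidE qs k (fun s => iidE qs n (fun t => (first_cut (@unit_vec d1) s t)%:R)) <= K.

Let i0 : 0 <= (0 : R) <= 1. Proof. by rewrite lexx ler01. Qed.

Let mT : seq _ -> R := @tail_moment R d0 d1 ds mut.
Let A : seq _ -> R := @jump_moment R d0 d1 ds mut.
Let n1 : _ -> R := @type_kernel R d0 d1 ds nu1.
Let n2 : _ -> R := @type_kernel R d0 d1 ds nu2.
Let M : seq _ -> R := @other_moment R d0 d1 ds nu1 nu2 mus.
Let xi := @xi_dir d0 ds.
Let rate := jump_rate xi mT A.
Let kern b := site_kernel xi kappa mT n1 n2 M b.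
Let rho : R := @drift_gap R ds nu1 nu2.

Let q_ge0 x : 0 <= qs x. Proof. by have [q0 _] := q_mass; apply: q0. Qed.
Let q_sum1 : \sum_x qs x = 1. Proof. exact: level_law_sum delta_gt0 (HA0 i0) q_mass. Qed.
Let kappa01' : 0 <= kappa <= 1. Proof. by case/andP: kappa01 => /ltW -> ->. Qed.

Let mT_nil : mT [::] = 1. Proof. exact: tail_moment_nil. Qed.
Let mT_ge0 l : 0 <= mT l. Proof. exact: tail_moment_ge0. Qed.
Let mT_sum l : A l + \sum_(u | ~~ xi u) mT (rcons l (inr u)) = (1 - gamma) * mT l.
Proof. exact: tail_moment_sum ds_bounds _ _ _ _ (HA1 i0) gamma01 l. Qed.
Let mT_inl l x : mT (rcons l (inl x)) = qs x * A l.
Proof.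
have [W _] := Hv i0.
exact: (tail_moment_inl ds_bounds delta_gt0 (HA0 i0) q_mass (HA1 i0) gamma01 W).
Qed.
Let A_ge l : delta * mT l <= A l.
Proof.
have [W _] := Hv i0.
exact: (jump_moment_ge ds_bounds delta_gt0 (HA0 i0) q_mass (HA1 i0) gamma01 W).
Qed.

Let nu_facts : [/\ kernels_of_mass gamma nu1, kernels_of_mass gamma nu2,
  supp nu1 `<=` @signed_units ds & supp nu2 `<=` @signed_units ds].
Proof. by case: (HA2 i0) => -[]. Qed.

Let n1_ge0 u : 0 <= n1 u.
Proof. by rewrite /n1 /type_kernel; case: ifP => // _; case: nu_facts => -[]. Qed.
Let n2_ge0 u : 0 <= n2 u.
Proof. by rewrite /n2 /type_kernel; case: ifP => // _; case: nu_facts => _ -[]. Qed.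
Let n1_supp u : ~~ xi u -> n1 u = 0.
Proof. by rewrite /n1 /type_kernel /xi => /negPf ->. Qed.
Let n2_supp u : ~~ xi u -> n2 u = 0.
Proof. by rewrite /n2 /type_kernel /xi => /negPf ->. Qed.
Let n1_sum : \sum_u n1 u = gamma.
Proof. by case: nu_facts => k1 _ s1 _; apply: type_kernel_sum. Qed.
Let n2_sum : \sum_u n2 u = gamma.
Proof. by case: nu_facts => _ k2 _ s2; apply: type_kernel_sum. Qed.
Let n12 u : n1 u * n2 u = 0.
Proof. exact: types_disjoint HA2 u. Qed.
Let M_nil : M [::] = 1 - kappa.
Proof. exact: other_moment_nil Hlam. Qed.
Let M_ge0 l : 0 <= M l. Proof. exact: other_moment_ge0. Qed.
Let M_sum l : \sum_(u | xi u) M (rcons l (inr u)) = gamma * M l.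
Proof. exact: (other_moment_sum ds_bounds nu1 nu2 gamma01 HA1). Qed.
Let M_supp l u : inr u \in l ->
  [|| n1 u != 0, n2 u != 0 | @disp d0 R u != 0] -> M l = 0.
Proof. exact: (other_moment_supp gamma01 HA2 Hlam). Qed.
Let disp_supp u : ~~ xi u -> @disp d0 R u = 0.
Proof. exact: disp_xi. Qed.
Let drifts := drift_signs d1 ds_bounds HA2.

Let kernL b : 0 <= b <= 1 -> local_kernel rate rho (@disp d0 R) (kern b).
Proof.
exact: (site_kernel_local kappa01' mT_nil mT_ge0 mT_sum n1_ge0 n2_ge0 n1_supp n2_supp
  n1_sum n2_sum M_nil M_ge0 M_sum M_supp disp_supp drifts).
Qed.

Let site_chain b l x : 0 <= b <= 1 ->
  mean (mu b) (site_prod (rcons l x)) =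
  mean (mu b) (site_prod l) * walk_kernel qs rate (kern b) l x.
Proof.
move=> b01; rewrite !(mean_site_prod ds_bounds (HA1 b01)).
pose mX c (l' : seq _) : R := @head_moment R d0 d1 ds (mus c) l'.
have mX_nil c : mX c [::] = 1 by exact: head_moment_nil.
have mX_E c l' : 0 <= c <= 1 -> l' != [::] ->
    mX c l' = kappa * (1 - c) * word_prod n1 l' + kappa * c * word_prod n2 l' + M l'.
  by move=> c01 _; exact: (head_moment_types ds_bounds gamma01 HA2 Hlam).
exact: (path_weight_rcons mT_ge0 mT_inl A_ge mT_sum n12 M_ge0 M_sum M_supp mX_nil mX_E l x b01).
Qed.

Let speed b : 0 <= b <= 1 ->
  (fun n => n%:R^-1 * mean_disp (@step_vec d0 d1) qs rate (@disp d0 R) (kern b) n [::])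
    @ \oo --> coordinate (v b) 0.
Proof.
move=> b01; have [W HW] := Hv b01.
have [_ ks _] := kernL b01.
apply: (velocity_limit ds_bounds q_sum1 ks _ HW) => l x.
exact: site_chain.
Qed.

Let rho_gt0 : 0 < rho. Proof. exact: drift_gap_gt0 HA2. Qed.

(** The comparison of mean displacements, divided by [n], passes to the limit. *)
Lemma velocity_increment b b' : 0 <= b <= 1 -> 0 <= b' <= 1 -> b <= b' ->
  `|coordinate (v b') 0 - coordinate (v b) 0 - kappa * (b' - b) * rho|
  <= kappa * (b' - b) * rho * (gamma * (2 / delta + 4 * K / delta ^+ 2)).
Proof.
move=> b01 b01' bb'.
have eps0 : 0 <= kappa * (b' - b).
  by rewrite mulr_ge0 ?subr_ge0 //; case/andP: kappa01'.
have q0 u : 0 <= q u by have [q0 _] := q_mass; apply: q0.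
have [G2 _] := A3_moments q0 q_sum1 HA3.
have rate_ge l : delta <= rate l by apply: jump_rate_ge.
have xim l : \sum_(u | xi u) kern b l u <= gamma.
  by rewrite (site_kernel_xi_mass mT n1_supp n2_supp n1_sum n2_sum M_nil M_sum).
have nd : \sum_u (n2 u - n1 u) * @disp d0 R u = rho.
  have [_ _ e] := drifts; rewrite -[RHS]e -sumrB; apply: eq_bigr => u _; exact: mulrBl.
have kd l u := site_kernel_diff kappa mT M n1_supp n2_supp b b' l u.
have cmp := mean_disp_comparison (@level_vec d0 d1) q_ge0 q_sum1 delta_gt0 rate_ge
  (ltW rho_gt0) (kernL b01) (kernL b01') xim G2 eps0 n1_ge0 n2_ge0 n1_sum n2_sum nd kd cut_bound.
set c := kappa * (b' - b) * rho in cmp *; set r := c * _ in cmp *.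
have lim : (fun n : nat => n%:R^-1 * mean_disp (@step_vec d0 d1) qs rate (@disp d0 R) (kern b') n [::]
   - n%:R^-1 * mean_disp (@step_vec d0 d1) qs rate (@disp d0 R) (kern b) n [::])
   @ \oo --> coordinate (v b') 0 - coordinate (v b) 0.
  by apply: cvgB; apply: speed.
have bnd n : (0 < n)%N ->
   `|n%:R^-1 * mean_disp (@step_vec d0 d1) qs rate (@disp d0 R) (kern b') n [::]
   - n%:R^-1 * mean_disp (@step_vec d0 d1) qs rate (@disp d0 R) (kern b) n [::] - c| <= r.
  move=> n0; have n0' : (0 : R) < n%:R by rewrite ltr0n.
  rewrite -(ler_pM2l n0') [leRHS]mulr_natl; apply: le_trans (cmp n).
  rewrite -[X in X * _](ger0_norm (ltW n0')) -normrM !mulrBr.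
  rewrite -/(kern b) -/(kern b') !mulVKf ?gt_eqF // mulr_natl.
  exact: lexx.
rewrite ler_norml; apply/andP; split.
  rewrite lerBrDl; apply: (cvgr_to_ge lim); exists 1%N => // n n0.
  by have := bnd n n0; rewrite ler_norml => /andP[+ _]; rewrite lerBrDl.
rewrite lerBlDl; apply: (cvgr_to_le lim); exists 1%N => // n n0.
by have := bnd n n0; rewrite ler_norml => /andP[_]; rewrite lerBlDl.
Qed.
End Velocity.

Lemma exists_cut_bound (R : realType) d1 (q : 'Z^d1 -> R) :
  kernels_of_mass 1 q -> supp q `<=` @signed_units d1 -> A3 q -> has_cut_times q ->
  exists2 K : R, 0 <= K & forall k n,
  iidE (fun x => q (unit_vec x)) k (fun s => iidE (fun x => q (unit_vec x)) n
     (fun t => (first_cut (@unit_vec d1) s t)%:R)) <= K.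
Proof.
move=> qm qS qA3 qcut.
have [q0 _] := qm.
have q1 := kernel_units_sum qm qS.
have [p p0 pl] := local_cut_prob_ge q1 qcut.
have [_ [M3 HM]] := A3_moments q0 q1 qA3.
have M0 : 0 <= M3 by have := HM 0%N; rewrite big_ord0.
have qs0 x : 0 <= q (unit_vec x) by [].
have p1 : p <= 1.
  apply: le_trans (pl 0%N) _; rewrite -[leRHS](iidE_cst q1 0).
  by apply: le_iidE => // w _; rewrite lern1 leq_b1.
have [A pA] : exists A, (1 - p) ^+ A <= 4^-1.
  have : `|1 - p| < 1 by rewrite ger0_norm ?subr_ge0 // gtrBl.
  move=> /cvg_expr /cvgr_le /(_ (4^-1)) /(_ ltac:(by rewrite invr_gt0)) [N _ HN].
  by exists N; apply: HN => /=.
exists (48 * A%:R * (1 + A%:R * M3)).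
  by rewrite !mulr_ge0 // addr_ge0 // mulr_ge0.
apply: (first_cut_bounded qs0 q1 pl pA _ HM).
by rewrite ltW.
Qed.

(** The projection of the line onto the interval extends [f] to a Lipschitz function. *)
Lemma lipschitz_within (R : realType) (f : R -> R) (L : R) :
  (forall x y, 0 <= x <= 1 -> 0 <= y <= 1 -> x <= y -> `|f y - f x| <= L * (y - x)) ->
  {within `[0, 1], continuous f}.
Proof.
move=> fL; pose pr (x : R) := Num.max 0 (Num.min x 1).
have pr01 x : 0 <= pr x <= 1.
  by rewrite /pr le_max lexx /= ge_max ler01 ge_min lexx orbT.
have prE x : 0 <= x <= 1 -> pr x = x.
  by case/andP => x0 x1; rewrite /pr min_l // max_r.
apply: (@subspace_eq_continuous _ _ _ (f \o pr)).
  by move=> x; rewrite inE /= in_itv /= => x01; rewrite /= prE.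
apply: continuous_subspaceT => x.
have L0 : 0 <= L.
  have := fL 0 1; rewrite !lexx ler01 subr0 mulr1 => /(_ isT isT isT).
  exact: le_trans.
have prm a b : a <= b -> pr a <= pr b <= pr a + (b - a).
  move=> ab; rewrite /pr !maxEle !minEle.
  by do !case: ifPn; rewrite -?ltNge => *; apply/andP; split; lra.
have H a b : a <= b -> `|f (pr b) - f (pr a)| <= L * (b - a).
  move=> ab; have /andP[p1 p2] := prm a b ab.
  by apply: le_trans (fL _ _ (pr01 a) (pr01 b) p1) _; rewrite ler_wpM2l // lerBlDl.
apply/cvg_ballP => e e0; near=> y.
rewrite /ball /= /ball_ /=.
have : `|x - y| < e / (L + 1).
  near: y; apply: (@cvgr_dist_lt _ _ _ _ _ (fun y => y) x) => //.
  by rewrite divr_gt0 // ltr_wpDl.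
have L1 : 0 < L + 1 by rewrite ltr_wpDl.
rewrite ltr_pdivlMr // => xy.
apply: (@le_lt_trans _ _ (L * `|x - y|)); last first.
  apply: le_lt_trans xy; rewrite mulrC ler_wpM2l // lerDl //.
have [xley|yltx] := leP x y.
  by rewrite distrC [X in _ * X]distrC [X in _ * X]ger0_norm ?subr_ge0 //; apply: H.
by rewrite [X in _ * X]ger0_norm ?subr_ge0 ?(ltW yltx) //; apply: (H y x (ltW yltx)).
Unshelve. all: by end_near.
Qed.

Theorem theorem1p2 (R : realType) (d1 : nat) (q : 'Z^d1 -> R) :
  (1 <= d1)%N -> kernels_of_mass 1 q ->
  exists2 delta_q : R, 0 < delta_q < 1 &
  forall (d0 ds : nat) (gamma kappa delta : R) (nu1 nu2 : 'Z^ds -> R)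
    (mut : probability (kernel_space R (d0 + d1 - ds)) R)
    (lambda : probability (kernel_space R ds) R)
    (mus : R -> probability (kernel_space R ds) R)
    (mu : R -> probability (kernel_space R (d0 + d1)) R)
    (v : R -> 'rV[R]_(d0 + d1)),
  (1 <= ds <= d0)%N ->
  0 < gamma <= 1 -> 0 < kappa <= 1 -> 0 < delta <= 1 -> gamma + delta <= 1 ->
  A3 q ->
  (forall beta, 0 <= beta <= 1 ->
    [/\ A0 q delta (mu beta),
        A1 gamma (mu beta) (mus beta) mut,
        A2 gamma kappa beta nu1 nu2 (mus beta),
        conditional_law kappa nu1 nu2 lambda (mus beta) &
        limiting_velocity (mu beta) (v beta)]) ->
  delta_q < delta < 1 ->
  {within `[0, 1], continuous (fun beta => coordinate (v beta) 0)} /\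
  {in `[0, 1] &, forall beta beta', beta < beta' ->
     coordinate (v beta) 0 < coordinate (v beta') 0}.
Proof.
move=> _ q_mass.
have [[qS [qA3 qcut]]|nq] := pselect (supp q `<=` @signed_units d1 /\ A3 q /\ has_cut_times q); last first.
  (* no environment satisfies the assumptions with this [q]: any threshold will do *)
  exists (2^-1); first by lra.
  move=> d0 ds gamma kappa delta nu1 nu2 mut lambda mus mu v _ _ _ /andP[delta0 _] _ HA3 H _.
  have [HA0 _ _ _ _] := H 0 ltac:(by rewrite lexx ler01).
  exfalso; apply: nq; split; first exact: A0_supp delta0 HA0.
  by split => //; case: HA0.
have [K K0 cut_bound] := exists_cut_bound q_mass qS qA3 qcut.
pose c := 2 * (4 + 16 * K).
have c8 : 8 <= c by rewrite /c; lra.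
have c0 : 0 < c by lra.
have ci : c^-1 <= 8^-1 by rewrite lef_pV2 ?posrE //; lra.
have ci0 : 0 < c^-1 by rewrite invr_gt0.
(* [gamma <= 1 - delta < c^-1] will make [gamma * (2 / delta + 4 * K / delta ^+ 2)] at
   most 1/2; as [c >= 8], also [delta >= 1/2], so the last factor is at most [c / 2] *)
exists (1 - c^-1); first by lra.
move=> d0 ds gamma kappa delta nu1 nu2 mut lambda mus mu v ds_bounds gamma01 kappa01
  /andP[delta0 _] gd HA3 H /andP[dq d1'].
have HA0 b (b01 : 0 <= b <= 1) : A0 q delta (mu b) by case: (H b b01).
have HA1 b (b01 : 0 <= b <= 1) : A1 gamma (mu b) (mus b) mut by case: (H b b01).
have HA2 b (b01 : 0 <= b <= 1) : A2 gamma kappa b nu1 nu2 (mus b) by case: (H b b01).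
have Hlam b (b01 : 0 <= b <= 1) : conditional_law kappa nu1 nu2 lambda (mus b) by case: (H b b01).
have Hv b (b01 : 0 <= b <= 1) : limiting_velocity (mu b) (v b) by case: (H b b01).
have inc := velocity_increment ds_bounds gamma01 kappa01 delta0 q_mass HA3 HA0 HA1 HA2 Hlam Hv cut_bound.
set rho := drift_gap nu1 nu2 in inc.
have rho0 : 0 < rho by apply: drift_gap_gt0 HA2.
have half : gamma * (2 / delta + 4 * K / delta ^+ 2) <= 2^-1.
  have g1 : gamma <= c^-1 by lra.
  have di : delta^-1 <= 2 by rewrite -[leRHS]invrK lef_pV2 ?posrE //; lra.
  have di0 : 0 <= delta^-1 by rewrite invr_ge0 ltW.
  have dd : (delta ^+ 2)^-1 <= 4.
    by rewrite -exprVn expr2; have := ler_pM di0 di0 di di; lra.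
  have g0 : 0 <= gamma by case/andP: gamma01 => /ltW.
  have e1 : 2 / delta + 4 * K / delta ^+ 2 <= 4 + 16 * K.
    apply: lerD; first by lra.
    by have := ler_wpM2l (_ : 0 <= 4 * K) dd; rewrite mulr_ge0 // => /(_ isT); lra.
  apply: (@le_trans _ _ (c^-1 * (4 + 16 * K))).
    apply: ler_pM => //; rewrite addr_ge0 // ?mulr_ge0 //.
    by rewrite invr_ge0 exprn_ge0 // ltW.
  by rewrite /c invfM -mulrA mulVf ?mulr1 //; apply: lt0r_neq0; lra.
have [k0 k1] := andP kappa01.
have bounds b b' : 0 <= b <= 1 -> 0 <= b' <= 1 -> b <= b' ->
   kappa * (b' - b) * rho / 2 <= coordinate (v b') 0 - coordinate (v b) 0 <= kappa * rho * 2 * (b' - b).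
  move=> b01 b01' bb'; have := inc b b' b01 b01' bb'.
  set e := kappa * (b' - b) * rho.
  have e0 : 0 <= e by rewrite mulr_ge0 ?(ltW rho0) // mulr_ge0 ?(ltW k0) // subr_ge0.
  have er : e * (gamma * (2 / delta + 4 * K / delta ^+ 2)) <= e / 2 by rewrite ler_wpM2l.
  move=> /le_trans /(_ er); rewrite ler_norml => /andP[lo hi].
  have -> : kappa * rho * 2 * (b' - b) = 2 * e by rewrite /e; ring.
  by apply/andP; split; lra.
split.
  apply: (@lipschitz_within _ _ (kappa * rho * 2)) => x y x01 y01 xy.
  have /andP[lo hi] := bounds x y x01 y01 xy.
  rewrite ger0_norm //; apply: le_trans lo.
  by rewrite divr_ge0 // mulr_ge0 ?(ltW rho0) // mulr_ge0 ?(ltW k0) // subr_ge0.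
move=> b b'; rewrite !in_itv /= => b01 b01' bb'.
have /andP[lo _] := bounds b b' b01 b01' (ltW bb').
rewrite -subr_gt0; apply: lt_le_trans lo.
by rewrite divr_gt0 // !mulr_gt0 // subr_gt0.
Qed.
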